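(* Let $R$ be a ring and $M$ an $R$-$R$-bimodule such that ${}_RM$ is finitely generated projective. Then there is an equivalence $$\mathcal{S}(R\text{-mod},M\otimes_R-)\simeq L_R(M)\text{-grmod},$$ which induces an equivalence $$\mathcal{S}(R\text{-}\underline{\mathrm{mod}},M\otimes_R-)\simeq L_R(M)\text{-}\underline{\mathrm{grmod}}.$$
   Context: Rings are unital; modules are left modules. For a ring $R$, $R\text{-mod}$ is the category of finitely presented left $R$-modules, $R\text{-proj}$ its full subcategory of finitely generated projective modules, and $R\text{-}\underline{\mathrm{mod}}=R\text{-mod}/R\text{-proj}$ (same objects; Hom groups modulo morphisms factoring through $R\text{-proj}$); the endofunctor $M\otimes_R-$ of $R\text{-mod}$ induces an endofunctor of $R\text{-}\underline{\mathrm{mod}}$ denoted by the same symbol. For a $\mathbb{Z}$-graded ring $\Gamma$, $\Gamma\text{-grmod}$ is the category of finitely presented graded left $\Gamma$-modules (degree-preserving homomorphisms) and $\Gamma\text{-}\underline{\mathrm{grmod}}$ is its factor category modulo finitely generated projective graded modules. Stabilization: for an additive category $\mathcal{C}$ with an additive endofunctor $\Omega$, $\mathcal{S}(\mathcal{C},\Omega)$ has as objects pairs $(X,n)$ with $X\in\mathcal{C}$, $n\in\mathbb{Z}$, and $\mathrm{Hom}((X,n),(Y,m))=\mathrm{colim}_{p\ge\max\{n,m\}}\,\mathcal{C}(\Omega^{p-n}(X),\Omega^{p-m}(Y))$ with structure maps induced by $\Omega$. The class of $f\in\mathcal{C}(\Omega^{p-n}(X),\Omega^{p-m}(Y))$ is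 denoted $[f;p]$; for $[f;p]\colon (X,n)\to(Y,m)$ and $[g;q]\colon(Y,m)\to(Z,l)$ with $q\ge p$, $[g;q]\circ[f;p]=[g\circ\Omega^{q-p}(f);q]$. Leavitt ring: put $M^*=\mathrm{Hom}_R({}_RM,{}_RR)$ with $(af)(x)=f(xa)$, $(fb)(x)=f(x)b$. Choose a finite dual basis $\{\alpha_j,\alpha_j^*\}_{j\in J}$, $\alpha_j\in M$, $\alpha_j^*\in M^*$, so that $x=\sum_j\alpha_j^*(x)\alpha_j$ and $f=\sum_j\alpha_j^*f(\alpha_j)$ for all $x\in M$, $f\in M^*$; the Casimir element $c=\sum_j\alpha_j^*\otimes_R\alpha_j\in M^*\otimes_RM$ is independent of the choice. The Leavitt ring is $L_R(M)=T_R(M^*\oplus M)/(x\otimes_R f-f(x),\ c-1_R\mid x\in M,f\in M^* )$, where $T_R$ denotes the tensor ring; it is $\mathbb{Z}$-graded with $R$ in degree $0$, $\deg(x)=-1$ for $x\in M$ and $\deg(f)=1$ for $f\in M^*$. *)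

(* Defs.v *)
From HB Require Import structures.
From mathcomp Require Import all_boot all_algebra.
From mathcomp Require Import boolp zify.

Set Implicit Arguments.
Unset Strict Implicit.
Unset Printing Implicit Defensive.

Import GRing.Theory.
Local Open Scope ring_scope.
Local Open Scope quotient_scope.

Local Obligation Tactic := intros.

(* Categories are setoid-enriched: [hom X Y] is a type of representatives and
   [heq] is equality of morphisms.  Thus a factor category, or a category whose
   Hom sets are colimits, has the representatives as its [hom] and the defining
   equivalence relation as its [heq]. *)
Record category := Category {
  ob :> Type;
  hom : ob -> ob -> Type;
  heq : forall X Y, hom X Y -> hom X Y -> Prop;
  idm : forall X, hom X X;
  comp : forall X Y Z, hom Y Z -> hom X Y -> hom X Z;
  heq_refl : forall X Y (f : hom X Y), heq f f;
  heq_sym : forall X Y (f g : hom X Y), heq f g -> heq g f;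
  heq_trans : forall X Y (f g h : hom X Y), heq f g -> heq g h -> heq f h;
  comp_heq : forall X Y Z (g g' : hom Y Z) (f f' : hom X Y),
    heq g g' -> heq f f' -> heq (comp g f) (comp g' f');
  comp1m : forall X Y (f : hom X Y), heq (comp (idm Y) f) f;
  compm1 : forall X Y (f : hom X Y), heq (comp f (idm X)) f;
  compA : forall X Y Z W (h : hom Z W) (g : hom Y Z) (f : hom X Y),
    heq (comp h (comp g f)) (comp (comp h g) f)
}.
Arguments idm {c} X.

Record functor (C D : category) := Functor {
  fob :> C -> D;
  fmap : forall X Y, hom X Y -> hom (fob X) (fob Y);
  fmap_heq : forall X Y (f g : hom X Y), heq f g -> heq (fmap f) (fmap g);
  fmap1 : forall X, heq (fmap (idm X)) (idm (fob X));
  fmapM : forall X Y Z (g : hom Y Z) (f : hom X Y),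
    heq (fmap (comp g f)) (comp (fmap g) (fmap f))
}.

Program Definition fid (C : category) : functor C C :=
  @Functor C C (fun X => X) (fun _ _ f => f) _ _ _.
Next Obligation. by []. Qed.
Next Obligation. exact: heq_refl. Qed.
Next Obligation. exact: heq_refl. Qed.

Program Definition fcomp (C D E : category) (G : functor D E) (F : functor C D)
    : functor C E :=
  @Functor C E (fun X => G (F X)) (fun _ _ f => fmap G (fmap F f)) _ _ _.
Next Obligation. by do 2!apply: fmap_heq. Qed.
Next Obligation.
by apply: heq_trans (fmap1 G _); apply: fmap_heq; apply: fmap1.
Qed.
Next Obligation.
by apply: heq_trans (fmapM G _ _); apply: fmap_heq; apply: fmapM.
Qed.

Definition nat_iso (C D : category) (F G : functor C D) : Prop :=
  exists (eta : forall X, hom (F X) (G X)) (eta' : forall X, hom (G X) (F X)),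
  [/\ forall X, heq (comp (eta' X) (eta X)) (idm (F X)),
      forall X, heq (comp (eta X) (eta' X)) (idm (G X))
    & forall X Y (f : hom X Y),
        heq (comp (eta Y) (fmap F f)) (comp (fmap G f) (eta X))].

Definition is_equivalence (C D : category) (F : functor C D) : Prop :=
  exists G : functor D C,
    nat_iso (fcomp G F) (fid C) /\ nat_iso (fcomp F G) (fid D).

Record congruence (C : category) := Congruence {
  crel : forall X Y : C, hom X Y -> hom X Y -> Prop;
  crel_heq : forall (X Y : C) (f g : hom X Y), heq f g -> crel f g;
  crel_sym : forall (X Y : C) (f g : hom X Y), crel f g -> crel g f;
  crel_trans : forall (X Y : C) (f g h : hom X Y),
    crel f g -> crel g h -> crel f h;
  crel_comp : forall (X Y Z : C) (g g' : hom Y Z) (f f' : hom X Y),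
    crel g g' -> crel f f' -> crel (comp g f) (comp g' f')
}.

Program Definition quot_cat (C : category) (E : congruence C) : category :=
  @Category (ob C) (@hom C) (@crel C E) (@idm C) (@comp C) _ _ _ _ _ _ _.
Next Obligation. by apply: crel_heq; apply: heq_refl. Qed.
Next Obligation. exact: crel_sym. Qed.
Next Obligation. exact: crel_trans H H0. Qed.
Next Obligation. exact: crel_comp. Qed.
Next Obligation. by apply: crel_heq; apply: comp1m. Qed.
Next Obligation. by apply: crel_heq; apply: compm1. Qed.
Next Obligation. by apply: crel_heq; apply: compA. Qed.

Program Definition quot_proj (C : category) (E : congruence C) :
    functor C (quot_cat E) :=
  @Functor C (quot_cat E) (fun X => X) (fun _ _ f => f) _ _ _.
Next Obligation. exact: crel_heq. Qed.
Next Obligation. by apply: crel_heq; apply: heq_refl. Qed.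
Next Obligation. by apply: crel_heq; apply: heq_refl. Qed.

Definition preserves_cong (C D : category) (E : congruence C)
    (E' : congruence D) (F : functor C D) : Prop :=
  forall (X Y : C) (f g : hom X Y), crel E f g -> crel E' (fmap F f) (fmap F g).

Program Definition quot_functor (C D : category) (E : congruence C)
    (E' : congruence D) (F : functor C D) (H : preserves_cong E E' F) :
    functor (quot_cat E) (quot_cat E') :=
  @Functor (quot_cat E) (quot_cat E') (fob F) (fun _ _ f => fmap F f) _ _ _.
Next Obligation. exact: H. Qed.
Next Obligation. by apply: crel_heq; apply: fmap1. Qed.
Next Obligation. by apply: crel_heq; apply: fmapM. Qed.

(* Additivity of C and Om plays no role in the objects, the Hom sets and the
   composition of S(C, Om), so they are arbitrary here. *)
Section Stabilization.
Variables (C : category) (Om : functor C C).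

Definition oiter (k : nat) (X : C) : C := iter k Om X.

Definition ocast (a b : nat) (e : a = b) (X : C) : hom (oiter a X) (oiter b X) :=
  match e in _ = c return hom (oiter a X) (oiter c X) with
  | erefl => idm (oiter a X)
  end.

Fixpoint raise (k a b : nat) (X Y : C) (f : hom (oiter a X) (oiter b Y)) :
    hom (oiter (k + a) X) (oiter (k + b) Y) :=
  match k return hom (oiter (k + a) X) (oiter (k + b) Y) with
  | 0%N => f
  | k'.+1 => fmap Om (raise k' f)
  end.

(* A representative [f; p] of a morphism (X, n) -> (Y, m): here a = p - n and
   b = p - m, so that p is the common value of n + a and m + b. *)
Record shom (A B : C * int) := SHom {
  sa : nat;
  sb : nat;
  slevel : A.2 + sa%:Z = B.2 + sb%:Z;
  smor : hom (oiter sa A.1) (oiter sb B.1)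
}.

Definition sheq (A B : C * int) (f g : shom A B) : Prop :=
  exists (k l : nat) (ea : (k + sa f = l + sa g)%N)
         (eb : (k + sb f = l + sb g)%N),
    heq (comp (ocast eb B.1) (raise k (smor f)))
        (comp (raise l (smor g)) (ocast ea A.1)).

Definition sid (A : C * int) : shom A A :=
  @SHom A A 0 0 erefl (idm A.1).

Lemma smid (b b' : nat) : ((b' - b) + b = (b - b') + b')%N.
Proof. by rewrite [LHS]addnC [RHS]addnC -!maxnE maxnC. Qed.

Lemma scomp_level (A B D : C * int) (g : shom B D) (f : shom A B) :
  A.2 + (sa g - sb f + sa f)%N%:Z = D.2 + (sb f - sa g + sb g)%N%:Z.
Proof.
rewrite !PoszD addrCA (slevel f) [RHS]addrCA -(slevel g) !(addrCA _ B.2).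
by rewrite -!PoszD smid.
Qed.

(* [g; q] \o [f; p] : both are raised to the level max(p, q).  If q >= p then
   sb f - sa g = 0 and sa g - sb f = q - p. *)
Definition scomp (A B D : C * int) (g : shom B D) (f : shom A B) : shom A D :=
  @SHom A D (sa g - sb f + sa f) (sb f - sa g + sb g) (scomp_level g f)
    (comp (raise (sb f - sa g) (smor g))
          (comp (ocast (smid (sb f) (sa g)) B.1)
                (raise (sa g - sb f) (smor f)))).

Lemma ocast_id a (e : a = a) X : ocast e X = idm _.
Proof. by rewrite (eq_irrelevance e erefl). Qed.

Lemma ocast_trans a b c (e1 : a = b) (e2 : b = c) X :
  heq (comp (ocast e2 X) (ocast e1 X)) (ocast (etrans e1 e2) X).
Proof. by case: c / e2; case: b / e1; apply: comp1m. Qed.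

Lemma raise_heq k a b X Y (f g : hom (oiter a X) (oiter b Y)) :
  heq f g -> heq (raise k f) (raise k g).
Proof. by elim: k => //= k IH H; apply: fmap_heq; apply: IH. Qed.

Lemma raise_comp k a b c X Y Z (g : hom (oiter b Y) (oiter c Z))
    (f : hom (oiter a X) (oiter b Y)) :
  heq (raise k (comp g f)) (comp (raise k g) (raise k f)).
Proof.
elim: k => /= [|k IH]; first exact: heq_refl.
by apply: heq_trans (fmap_heq _ IH) _; apply: fmapM.
Qed.

Lemma raise_id k a X : heq (raise k (idm (oiter a X))) (idm (oiter (k + a) X)).
Proof.
elim: k => /= [|k IH]; first exact: heq_refl.
by apply: heq_trans (fmap_heq _ IH) _; apply: fmap1.
Qed.

Lemma raise_ocast k a b (e : a = b) (e' : (k + a = k + b)%N) X :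
  heq (raise k (ocast e X)) (ocast e' X).
Proof. by case: b / e e' => e'; rewrite (ocast_id e'); apply: raise_id. Qed.

Definition rel_hom a b a' b' X Y (f : hom (oiter a X) (oiter b Y))
    (g : hom (oiter a' X) (oiter b' Y)) : Prop :=
  exists (ea : a = a') (eb : b = b'),
    heq (comp (ocast eb Y) f) (comp g (ocast ea X)).

Lemma rel_homE a b X Y (f g : hom (oiter a X) (oiter b Y)) :
  rel_hom f g <-> heq f g.
Proof.
split=> [[ea [eb]]|H].
  rewrite !ocast_id => H.
  apply: heq_trans (heq_sym (comp1m f)) _.
  exact: heq_trans H (compm1 g).
exists erefl, erefl => /=.
apply: heq_trans (comp1m f) _.
exact: heq_trans H (heq_sym (compm1 g)).
Qed.

Lemma rel_hom_refl a b X Y (f : hom (oiter a X) (oiter b Y)) : rel_hom f f.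
Proof. by apply/rel_homE; apply: heq_refl. Qed.

Lemma rel_hom_sym a b a' b' X Y (f : hom (oiter a X) (oiter b Y))
    (g : hom (oiter a' X) (oiter b' Y)) : rel_hom f g -> rel_hom g f.
Proof.
move=> H; have [ea [eb _]] := H; subst a' b'.
by move/rel_homE: H => H; apply/rel_homE/heq_sym.
Qed.

Lemma rel_hom_trans a b a' b' a'' b'' X Y (f : hom (oiter a X) (oiter b Y))
    (g : hom (oiter a' X) (oiter b' Y)) (h : hom (oiter a'' X) (oiter b'' Y)) :
  rel_hom f g -> rel_hom g h -> rel_hom f h.
Proof.
move=> H1 H2; have [ea [eb _]] := H1; have [ea' [eb' _]] := H2; subst.
move/rel_homE: H1 => H1; move/rel_homE: H2 => H2; apply/rel_homE.
exact: heq_trans H1 H2.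
Qed.

Lemma rel_hom_raise k a b a' b' X Y (f : hom (oiter a X) (oiter b Y))
    (g : hom (oiter a' X) (oiter b' Y)) :
  rel_hom f g -> rel_hom (raise k f) (raise k g).
Proof.
move=> H; have [ea [eb _]] := H; subst a' b'.
by move/rel_homE: H => H; apply/rel_homE/raise_heq.
Qed.

Lemma rel_hom_raiseD k l a b X Y (f : hom (oiter a X) (oiter b Y)) :
  rel_hom (raise k (raise l f)) (raise (k + l) f).
Proof.
elim: k => /= [|k IH]; first exact: rel_hom_refl.
exact: (rel_hom_raise 1 IH).
Qed.

Lemma rel_hom_raise_eq k l a b X Y (f : hom (oiter a X) (oiter b Y)) :
  k = l -> rel_hom (raise k f) (raise l f).
Proof. by move=> ->; apply: rel_hom_refl. Qed.

Lemma rel_hom_comp a b c a' b' c' X Y Z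
    (f : hom (oiter a X) (oiter b Y)) (g : hom (oiter b Y) (oiter c Z))
    (f' : hom (oiter a' X) (oiter b' Y)) (g' : hom (oiter b' Y) (oiter c' Z)) :
  rel_hom f f' -> rel_hom g g' -> rel_hom (comp g f) (comp g' f').
Proof.
move=> H1 H2; have [ea [eb _]] := H1; have [_ [ec _]] := H2; subst.
move/rel_homE: H1 => H1; move/rel_homE: H2 => H2; apply/rel_homE.
exact: comp_heq.
Qed.

Lemma rel_hom_cast a b c (e : b = c) X Y (f : hom (oiter a X) (oiter b Y)) :
  rel_hom (comp (ocast e Y) f) f.
Proof. by case: c / e; apply/rel_homE; apply: comp1m. Qed.

Lemma sheqP (A B : C * int) (f g : shom A B) :
  sheq f g <-> exists k l, rel_hom (raise k (smor f)) (raise l (smor g)).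
Proof.
split; first by case=> k [l [ea [eb H]]]; exists k, l, ea, eb.
by case=> k [l [ea [eb H]]]; exists k, l, ea, eb.
Qed.

Lemma sheq_refl A B (f : shom A B) : sheq f f.
Proof. by apply/sheqP; exists 0%N, 0%N; apply: rel_hom_refl. Qed.

Lemma sheq_sym A B (f g : shom A B) : sheq f g -> sheq g f.
Proof.
by move/sheqP=> [k [l H]]; apply/sheqP; exists l, k; apply: rel_hom_sym.
Qed.

Lemma rel_hom_raise2 j k a b a' b' X Y (f : hom (oiter a X) (oiter b Y))
    (g : hom (oiter a' X) (oiter b' Y)) l :
  rel_hom (raise k f) (raise l g) ->
  rel_hom (raise (j + k) f) (raise (j + l) g).
Proof.
move=> H; apply: rel_hom_trans (rel_hom_sym (rel_hom_raiseD j k f)) _.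
apply: rel_hom_trans _ (rel_hom_raiseD j l g).
exact: rel_hom_raise.
Qed.

Lemma sheq_trans A B (f g h : shom A B) : sheq f g -> sheq g h -> sheq f h.
Proof.
move=> /sheqP[k [l H]] /sheqP[k' [l' H']]; apply/sheqP.
exists (k' + k)%N, (l + l')%N.
apply: rel_hom_trans (rel_hom_raise2 k' H) _.
apply: rel_hom_trans (rel_hom_raise2 l H').
by apply: rel_hom_raise_eq; rewrite addnC.
Qed.

(* A composite may be computed at any sufficiently high level. *)
Lemma scompP (A B D : C * int) (g : shom B D) (f : shom A B) (k l : nat)
    (e : (k + sb f = l + sa g)%N) j :
  k = (j + (sa g - sb f))%N -> l = (j + (sb f - sa g))%N ->
  rel_hom (raise j (smor (scomp g f)))
          (comp (raise l (smor g))
                (comp (ocast e B.1) (raise k (smor f)))).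
Proof.
move=> ek el; rewrite /scomp /=.
apply: rel_hom_trans.
  by apply/rel_homE; apply: raise_comp.
apply: rel_hom_comp; last first.
  by apply: rel_hom_trans (rel_hom_raiseD _ _ _) _; apply: rel_hom_raise_eq.
apply: rel_hom_trans (rel_hom_raise j (rel_hom_cast _ _)) _.
apply: rel_hom_trans _ (rel_hom_sym (rel_hom_cast _ _)).
by apply: rel_hom_trans (rel_hom_raiseD _ _ _) _; apply: rel_hom_raise_eq.
Qed.

Lemma scomp_levelP (b b' k l : nat) : (k + b = l + b')%N ->
  exists j, k = (j + (b' - b))%N /\ l = (j + (b - b'))%N.
Proof.
move=> e; exists (k - (b' - b))%N.
have H1 : (b' - b <= k)%N by rewrite leq_subLR addnC e leq_addl.
split; first by rewrite subnK.
apply: (@addIn b'); rewrite -addnA -smid addnA subnK //.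
Qed.

Lemma scompE (A B D : C * int) (g : shom B D) (f : shom A B) (k l : nat)
    (e : (k + sb f = l + sa g)%N) :
  exists j, rel_hom (raise j (smor (scomp g f)))
          (comp (raise l (smor g))
                (comp (ocast e B.1) (raise k (smor f)))).
Proof. by have [j [ek el]] := scomp_levelP e; exists j; apply: scompP. Qed.

Lemma scomp_sheq (A B D : C * int) (g g' : shom B D) (f f' : shom A B) :
  sheq g g' -> sheq f f' -> sheq (scomp g f) (scomp g' f').
Proof.
move=> /sheqP[k [l H]] /sheqP[k' [l' H']].
have [ea [eb _]] := H; have [ea' [eb' _]] := H'.
pose u := ((k + sa g) + k')%N; pose v := ((k' + sb f) + k)%N.
pose u' := ((k + sa g) + l')%N; pose v' := ((k' + sb f) + l)%N.
have e : (u + sb f = v + sa g)%N by rewrite /u /v; lia.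
have e' : (u' + sb f' = v' + sa g')%N by rewrite /u' /v'; lia.
have [j Hj] := scompE e; have [j' Hj'] := scompE e'.
apply/sheqP; exists j, j'; apply: rel_hom_trans Hj _.
apply: rel_hom_trans _ (rel_hom_sym Hj').
apply: rel_hom_comp; last exact: rel_hom_raise2.
apply: rel_hom_trans (rel_hom_cast _ _) _.
apply: rel_hom_trans _ (rel_hom_sym (rel_hom_cast _ _)).
exact: rel_hom_raise2.
Qed.

Lemma scomp1m (A B : C * int) (f : shom A B) : sheq (scomp (sid B) f) f.
Proof.
have e : (0 + sb f = sb f + sa (sid B))%N by rewrite add0n addn0.
have [j Hj] := scompE e; apply/sheqP; exists j, 0%N.
apply: rel_hom_trans Hj _ => /=.
have H : rel_hom (comp (idm (oiter (sb f + 0) B.1))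
                     (comp (ocast e B.1) (smor f))) (smor f).
  apply: rel_hom_trans _ (rel_hom_cast e (smor f)).
  by apply/rel_homE; apply: comp1m.
apply: rel_hom_trans _ H.
apply/rel_homE/comp_heq; last exact: heq_refl.
exact: raise_id.
Qed.

Lemma scompm1 (A B : C * int) (f : shom A B) : sheq (scomp f (sid A)) f.
Proof.
have e : (sa f + sb (sid A) = 0 + sa f)%N by rewrite add0n addn0.
have [j Hj] := scompE e; apply/sheqP; exists j, 0%N.
apply: rel_hom_trans Hj _ => /=.
have H : rel_hom (comp (smor f) (idm _)) (smor f).
  by apply/rel_homE; apply: compm1.
apply: rel_hom_trans _ H.
apply: rel_hom_comp; last exact: rel_hom_refl.
apply: rel_hom_trans (rel_hom_cast _ _) _.
apply: rel_hom_trans; first by apply/rel_homE; apply: raise_id.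
by rewrite addn0; apply: rel_hom_refl.
Qed.

Lemma rel_hom_compA a b c d b' c' X Y Z W (e1 : b = b') (e2 : c = c')
    (f : hom (oiter a X) (oiter b Y)) (g : hom (oiter b' Y) (oiter c Z))
    (h : hom (oiter c' Z) (oiter d W)) :
  rel_hom (comp h (comp (ocast e2 _) (comp g (comp (ocast e1 _) f))))
          (comp (comp h (comp (ocast e2 _) g)) (comp (ocast e1 _) f)).
Proof.
subst b' c'; rewrite !ocast_id; apply/rel_homE.
have H : heq (comp (idm (oiter c Z)) (comp g (comp (idm _) f)))
             (comp (comp (idm _) g) (comp (idm _) f)) by exact: compA.
apply: heq_trans (comp_heq (heq_refl h) H) _; exact: compA.
Qed.

Lemma scompA (A B D E : C * int) (h : shom D E) (g : shom B D) (f : shom A B) :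
  sheq (scomp h (scomp g f)) (scomp (scomp h g) f).
Proof.
pose x := (sa g + sa h)%N; pose y := (sb f + sa h)%N; pose z := (sb f + sb g)%N.
have e1 : (x + sb f = y + sa g)%N by rewrite /x /y; lia.
have e2 : (y + sb g = z + sa h)%N by rewrite /y /z; lia.
have [j [ek el]] := scomp_levelP e1; have [j' [ek' el']] := scomp_levelP e2.
have H := scompP e1 ek el; have H' := scompP e2 ek' el'.
have e3 : (j + sb (scomp g f) = z + sa h)%N by rewrite /=; lia.
have e4 : (x + sb f = j' + sa (scomp h g))%N by rewrite /=; lia.
have [i Hi] := scompE e3; have [i' Hi'] := scompE e4.
apply/sheqP; exists i, i'; apply: rel_hom_trans Hi _.
apply: rel_hom_trans _ (rel_hom_sym Hi').
have P1 := rel_hom_compA e1 e2 (raise x (smor f)) (raise y (smor g))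
             (raise z (smor h)).
apply: rel_hom_trans; last first.
  apply: rel_hom_trans P1 _; apply: rel_hom_comp; last exact: rel_hom_sym H'.
  apply: rel_hom_trans (rel_hom_cast _ _) _.
  exact: rel_hom_sym (rel_hom_cast _ _).
apply: rel_hom_comp; last exact: rel_hom_refl.
apply: rel_hom_trans (rel_hom_cast _ _) _.
apply: rel_hom_trans H _.
exact: rel_hom_sym (rel_hom_cast _ _).
Qed.

Definition stab : category :=
  @Category (C * int)%type shom sheq sid scomp sheq_refl sheq_sym sheq_trans
    scomp_sheq scomp1m scompm1 scompA.

End Stabilization.

Section StabQuot.
Variables (C : category) (E : congruence C) (Om : functor C C).
Hypothesis H : preserves_cong E E Om.

Let Q := quot_cat E.
Let OmQ : functor Q Q := quot_functor H.

Lemma quot_raise k a b (X Y : C) (f : hom (oiter Om a X) (oiter Om b Y)) :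
  @raise Q OmQ k a b X Y f = raise k f.
Proof. by elim: k => //= k ->. Qed.

Lemma quot_ocast a b (e : a = b) (X : C) :
  @ocast Q OmQ a b e X = ocast Om e X.
Proof. by case: b / e. Qed.

Definition stab_quot_hom (A B : stab Om) (f : hom A B) :
    @hom (stab OmQ) A B :=
  @SHom Q OmQ A B (sa f) (sb f) (slevel f) (smor f).

(* The canonical functor S(C, Om) -> S(C / E, Om). *)
Program Definition stab_quot : functor (stab Om) (stab OmQ) :=
  @Functor (stab Om) (stab OmQ) (fun A => A) stab_quot_hom _ _ _.
Next Obligation.
case: H0 => k [l [ea [eb h]]]; exists k, l, ea, eb.
by rewrite !quot_raise !quot_ocast; apply: crel_heq.
Qed.
Next Obligation. exact: (sheq_refl (sid OmQ X)). Qed.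
Next Obligation.
suff -> : stab_quot_hom (comp g f) = scomp (stab_quot_hom g) (stab_quot_hom f).
  exact: sheq_refl.
rewrite /scomp !quot_raise quot_ocast /=.
by congr SHom; apply: Prop_irrelevance.
Qed.

End StabQuot.

HB.mixin Record Lmodule_isBimodule (R : pzRingType) V of GRing.Lmodule R V := {
  ract : V -> R -> V;
  ract1 : forall v, ract v 1 = v;
  ractA : forall v r s, ract (ract v r) s = ract v (r * s);
  ractDl : forall v w r, ract (v + w) r = ract v r + ract w r;
  ractDr : forall v r s, ract v (r + s) = ract v r + ract v s;
  ractZ : forall r v s, ract (r *: v) s = r *: ract v s
}.

#[short(type="bimodType")]
HB.structure Definition Bimodule (R : pzRingType) :=
  { V of Lmodule_isBimodule R V & GRing.Lmodule R V }.

Section LinearAlgebra.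
Variable R : pzRingType.

Definition fin_gen (X : lmodType R) : Prop :=
  exists (n : nat) (g : 'I_n -> X),
    forall x, exists a : 'I_n -> R, x = \sum_(i < n) a i *: g i.

Definition projective (P : lmodType R) : Prop :=
  forall (X Y : lmodType R) (g : {linear X -> Y}) (h : {linear P -> Y}),
    (forall y, exists x, g x = y) ->
    exists h' : {linear P -> X}, forall p, g (h' p) = h p.

Definition fg_proj (P : lmodType R) : Prop := fin_gen P /\ projective P.

(* An exact sequence R^m -> R^n -> X -> 0. *)
Definition fin_pres (X : lmodType R) : Prop :=
  exists (m n : nat) (rho : {linear 'rV[R]_m -> 'rV[R]_n})
         (pi : {linear 'rV[R]_n -> X}),
    (forall x, exists v, pi v = x) /\
    (forall v, pi v = 0 <-> exists w, v = rho w).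

Lemma exists_linear (X Y : lmodType R) (f : X -> Y) :
  (forall a x y, f (a *: x + y) = a *: f x + f y) ->
  exists g : {linear X -> Y}, forall x, g x = f x.
Proof.
move=> Hf; pose m := GRing.isLinear.Build R X Y *:%R f Hf.
by pose g : {linear X -> Y} := HB.pack f m; exists g.
Qed.

Lemma row_lift (X : lmodType R) n (g : 'I_n -> X) :
  exists f : {linear 'rV[R]_n -> X}, forall v, f v = \sum_i v 0 i *: g i.
Proof.
apply: exists_linear => a u v; rewrite scaler_sumr -big_split /=.
by apply: eq_bigr => i _; rewrite !mxE scalerDl scalerA.
Qed.

Lemma row_sum n (v : 'rV[R]_n) : v = \sum_i v 0 i *: delta_mx 0 i.
Proof. exact: row_sum_delta. Qed.

Lemma fg_proj_row n : fg_proj 'rV[R]_n.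
Proof.
split.
  by exists n, (fun i => delta_mx 0 i) => x; exists (fun i => x 0 i); apply: row_sum.
move=> X Y g h Hg.
have /choice[s Hs] : forall i : 'I_n, exists x, g x = h (delta_mx 0 i).
  by move=> i; apply: Hg.
have [h' Hh'] := row_lift s; exists h' => p.
rewrite Hh' linear_sum {2}(row_sum p) linear_sum.
by apply: eq_bigr => i _; rewrite !linearZ /= Hs.
Qed.

Lemma fin_genP (X : lmodType R) : fin_gen X <->
  exists n (f : {linear 'rV[R]_n -> X}), forall x, exists v, f v = x.
Proof.
split=> [[n [g Hg]]|[n [f Hf]]].
  have [f Ef] := row_lift g; exists n, f => x; have [a ->] := Hg x.
  exists (\row_i a i); rewrite Ef; apply: eq_bigr => i _; by rewrite mxE.
exists n, (fun i => f (delta_mx 0 i)) => x; have [v <-] := Hf x.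
exists (fun i => v 0 i); rewrite {1}(row_sum v) linear_sum.
by apply: eq_bigr => i _; rewrite linearZ.
Qed.

(* A surjection from a free module onto a f.g. projective one splits. *)
Lemma fg_proj_split (P : lmodType R) : fg_proj P ->
  exists n (f : {linear 'rV[R]_n -> P}) (t : {linear P -> 'rV[R]_n}),
    forall p, f (t p) = p.
Proof.
case=> /fin_genP[n [f Hf]] HP; exists n, f.
by have [t Ht] := HP _ _ f (idfun : {linear P -> P}) Hf; exists t.
Qed.

Lemma fin_pres_coker (P Q X : lmodType R) (r : {linear Q -> P})
    (p : {linear P -> X}) : fg_proj P -> fin_gen Q ->
  (forall x, exists v, p v = x) ->
  (forall v, p v = 0 <-> exists w, v = r w) -> fin_pres X.
Proof.
move=> /fg_proj_split[a [s [t st]]] /fin_genP[b [u Hu]] Hp Hr.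
have [rho Hrho] : exists rho : {linear 'rV[R]_(a + b) -> 'rV[R]_a},
    forall z, rho z = lsubmx z - t (s (lsubmx z)) + t (r (u (rsubmx z))).
  apply: exists_linear => c x y; rewrite !linearP /= !scalerDr.
  by rewrite (addrACA (c *: lsubmx x)) (addrACA (_ + _)). 
exists (a + b)%N, a, rho, (p \o s); split=> [x|v].
  by have [y <-] := Hp x; exists (t y); rewrite /= st.
split=> [/= /Hr[w Ew]|[w ->]].
  have [z Ez] := Hu w; exists (row_mx v z).
  by rewrite Hrho row_mxKl row_mxKr Ez Ew subrK.
have E : s (rho w) = r (u (rsubmx w)).
  by rewrite Hrho linearD linearB /= !st subrr add0r.
rewrite /= E.
by apply/Hr; exists (u (rsubmx w)).
Qed.

Lemma fg_proj_fin_pres (P : lmodType R) : fg_proj P -> fin_pres P.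
Proof.
move=> HP; apply: (@fin_pres_coker P 'rV[R]_0 P \0 idfun) => //.
- by have [] := fg_proj_row 0.
- by move=> x; exists x.
by move=> v; split=> [/= ->|[w ->]] //; exists 0.
Qed.

Lemma fg_proj_sum (P Q : lmodType R) : fg_proj P -> fg_proj Q ->
  fg_proj (P * Q)%type.
Proof.
move=> [/fin_genP[m [f Hf]] HP] [/fin_genP[n [g Hg]] HQ]; split.
  apply/fin_genP; exists (m + n)%N.
  have [h Hh] : exists h : {linear 'rV[R]_(m + n) -> (P * Q)%type},
      forall z, h z = (f (lsubmx z), g (rsubmx z)).
    by apply: exists_linear => c x y; rewrite !linearP.
  exists h => -[x y]; have [v <-] := Hf x; have [w <-] := Hg y.
  by exists (row_mx v w); rewrite Hh row_mxKl row_mxKr.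
move=> X Y s h Hs.
have [h1 Hh1] : exists h1 : {linear P -> Y}, forall p, h1 p = h (p, 0).
  apply: exists_linear => c x y; rewrite -linearP /=; congr (h _).
  by congr pair; rewrite /= scaler0 addr0.
have [h2 Hh2] : exists h2 : {linear Q -> Y}, forall p, h2 p = h (0, p).
  apply: exists_linear => c x y; rewrite -linearP /=; congr (h _).
  by congr pair; rewrite /= scaler0 addr0.
have [k1 Hk1] := HP _ _ s h1 Hs; have [k2 Hk2] := HQ _ _ s h2 Hs.
have [k Hk] : exists k : {linear (P * Q)%type -> X},
    forall z, k z = k1 z.1 + k2 z.2.
  apply: exists_linear => c x y /=; rewrite !linearP /= scalerDr.
  by rewrite addrACA.
exists k => -[x y]; rewrite Hk linearD Hk1 Hk2 Hh1 Hh2 -linearD; congr (h _).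
by congr pair; rewrite /= ?addr0 ?add0r.
Qed.

End LinearAlgebra.

Section Tensor.
Variables (R : pzRingType) (M : bimodType R) (X : lmodType R).

(* M (x)_R X is the abelian group generated by the symbols m (x) x subject to
   biadditivity and (m r) (x) x = m (x) (r x): formal expressions modulo the
   smallest congruence containing the group axioms and these relations. *)
Inductive tens_term : Type :=
  | TensZero
  | TensOpp of tens_term
  | TensAdd of tens_term & tens_term
  | TensPure of M & X.

Inductive tens_rel : tens_term -> tens_term -> Prop :=
  | tens_refl a : tens_rel a a
  | tens_sym a b : tens_rel a b -> tens_rel b a
  | tens_trans a b c : tens_rel a b -> tens_rel b c -> tens_rel a c
  | tens_opp a b : tens_rel a b -> tens_rel (TensOpp a) (TensOpp b)
  | tens_add a a' b b' : tens_rel a a' -> tens_rel b b' ->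
      tens_rel (TensAdd a b) (TensAdd a' b')
  | tens_addA a b c :
      tens_rel (TensAdd a (TensAdd b c)) (TensAdd (TensAdd a b) c)
  | tens_addC a b : tens_rel (TensAdd a b) (TensAdd b a)
  | tens_add0 a : tens_rel (TensAdd TensZero a) a
  | tens_addN a : tens_rel (TensAdd (TensOpp a) a) TensZero
  | tens_Dl m m' x :
      tens_rel (TensPure (m + m') x) (TensAdd (TensPure m x) (TensPure m' x))
  | tens_Dr m x x' :
      tens_rel (TensPure m (x + x')) (TensAdd (TensPure m x) (TensPure m x'))
  | tens_bal m r x : tens_rel (TensPure (ract m r) x) (TensPure m (r *: x)).

HB.instance Definition _ := gen_eqMixin tens_term.
HB.instance Definition _ := gen_choiceMixin tens_term.

Definition tens_relb : rel tens_term := fun a b => `[< tens_rel a b >].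

Lemma tens_relb_refl : reflexive tens_relb.
Proof. by move=> a; apply/asboolP; apply: tens_refl. Qed.
Lemma tens_relb_sym : symmetric tens_relb.
Proof. by move=> a b; apply/asboolP/asboolP; apply: tens_sym. Qed.
Lemma tens_relb_trans : transitive tens_relb.
Proof.
move=> b a c /asboolP H1 /asboolP H2; apply/asboolP; exact: tens_trans H1 H2.
Qed.

Canonical tens_equiv :=
  EquivRel tens_relb tens_relb_refl tens_relb_sym tens_relb_trans.

Definition tensor : Type := {eq_quot tens_equiv}.
HB.instance Definition _ := Choice.copy tensor {eq_quot tens_equiv}.

Definition tens_pi (a : tens_term) : tensor := \pi_{eq_quot tens_equiv} a.
Definition tens_repr (z : tensor) : tens_term := repr (z : {eq_quot tens_equiv}).

Lemma tens_reprK z : tens_pi (tens_repr z) = z.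
Proof. exact: reprK. Qed.

Lemma tens_piP a b : tens_pi a = tens_pi b <-> tens_rel a b.
Proof.
split=> [/eqP|H]; first by rewrite eqmodE => /asboolP.
by apply/eqP; rewrite eqmodE; apply/asboolP.
Qed.

Lemma tens_repr_pi a : tens_rel (tens_repr (tens_pi a)) a.
Proof. by apply/tens_piP; rewrite tens_reprK. Qed.

Definition tensor_add (z w : tensor) : tensor :=
  tens_pi (TensAdd (tens_repr z) (tens_repr w)).
Definition tensor_opp (z : tensor) : tensor := tens_pi (TensOpp (tens_repr z)).

Lemma tensor_addE a b : tensor_add (tens_pi a) (tens_pi b) = tens_pi (TensAdd a b).
Proof. by apply/tens_piP; apply: tens_add; apply: tens_repr_pi. Qed.
Lemma tensor_oppE a : tensor_opp (tens_pi a) = tens_pi (TensOpp a).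
Proof. by apply/tens_piP; apply: tens_opp; apply: tens_repr_pi. Qed.

Lemma tensor_addA : associative tensor_add.
Proof.
move=> x y z; rewrite -(tens_reprK x) -(tens_reprK y) -(tens_reprK z).
by rewrite !tensor_addE; apply/tens_piP; apply: tens_addA.
Qed.
Lemma tensor_addC : commutative tensor_add.
Proof. by move=> x y; apply/tens_piP; apply: tens_addC. Qed.
Lemma tensor_add0 : left_id (tens_pi TensZero) tensor_add.
Proof.
move=> x; rewrite -(tens_reprK x) tensor_addE; apply/tens_piP.
exact: tens_add0.
Qed.
Lemma tensor_addN : left_inverse (tens_pi TensZero) tensor_opp tensor_add.
Proof.
move=> x; rewrite -(tens_reprK x) tensor_oppE tensor_addE; apply/tens_piP.
exact: tens_addN.
Qed.

HB.instance Definition _ := GRing.isZmodule.Build tensor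
  tensor_addA tensor_addC tensor_add0 tensor_addN.

Fixpoint tens_scale (r : R) (a : tens_term) : tens_term :=
  match a with
  | TensZero => TensZero
  | TensOpp b => TensOpp (tens_scale r b)
  | TensAdd b c => TensAdd (tens_scale r b) (tens_scale r c)
  | TensPure m x => TensPure (r *: m) x
  end.

Lemma tens_scale_rel r a b :
  tens_rel a b -> tens_rel (tens_scale r a) (tens_scale r b).
Proof.
elim=> /=; try by constructor.
- by move=> ? ? ? _ H1 _ H2; apply: tens_trans H1 H2.
- by move=> m m' x; rewrite scalerDr; constructor.
by move=> m s x; rewrite -ractZ; constructor.
Qed.

Definition tensor_scale (r : R) (z : tensor) : tensor :=
  tens_pi (tens_scale r (tens_repr z)).

Lemma tensor_scaleE r a : tensor_scale r (tens_pi a) = tens_pi (tens_scale r a).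
Proof. by apply/tens_piP; apply: tens_scale_rel; apply: tens_repr_pi. Qed.

Lemma tens_ind (P : tensor -> Prop) : P 0 -> (forall z, P z -> P (- z)) ->
  (forall z w, P z -> P w -> P (z + w)) ->
  (forall m x, P (tens_pi (TensPure m x))) -> forall z, P z.
Proof.
move=> P0 PN PD Pp z; rewrite -(tens_reprK z).
elim: (tens_repr z) => //= [a IH|a IHa b IHb].
  by have := PN _ IH; rewrite /GRing.opp /= tensor_oppE.
by have := PD _ _ IHa IHb; rewrite /GRing.add /= tensor_addE.
Qed.

Lemma tensor_scaleDr : right_distributive tensor_scale +%R.
Proof.
move=> r x y; rewrite -(tens_reprK x) -(tens_reprK y).
by rewrite /GRing.add /= tensor_addE !tensor_scaleE tensor_addE.
Qed.

Lemma tensor_scale0 r : tensor_scale r 0 = 0.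
Proof. by apply: (@addrI _ (tensor_scale r 0)); rewrite -tensor_scaleDr !addr0. Qed.

Lemma tensor_scaleN r z : tensor_scale r (- z) = - tensor_scale r z.
Proof.
by apply/eqP; rewrite -addr_eq0 -tensor_scaleDr addNr tensor_scale0.
Qed.

Lemma tensor_scaleA r s z :
  tensor_scale r (tensor_scale s z) = tensor_scale (r * s) z.
Proof.
elim/tens_ind: z => [|z IH|z w IHz IHw|m x].
- by rewrite !tensor_scale0.
- by rewrite !tensor_scaleN IH.
- by rewrite !tensor_scaleDr IHz IHw.
by rewrite !tensor_scaleE /= scalerA.
Qed.

Lemma tensor_scale1 : left_id 1 tensor_scale.
Proof.
elim/tens_ind => [|z IH|z w IHz IHw|m x].
- by rewrite !tensor_scale0.
- by rewrite !tensor_scaleN IH.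
- by rewrite !tensor_scaleDr IHz IHw.
by rewrite !tensor_scaleE /= scale1r.
Qed.

Lemma tensor_scaleDl z : {morph tensor_scale^~ z : r s / r + s}.
Proof.
move=> r s /=; elim/tens_ind: z => [|z IH|z w IHz IHw|m x].
- by rewrite !tensor_scale0 addr0.
- by rewrite !tensor_scaleN IH opprD.
- by rewrite !tensor_scaleDr IHz IHw addrACA.
rewrite !tensor_scaleE /= scalerDl /GRing.add /= tensor_addE.
by apply/tens_piP; constructor.
Qed.

HB.instance Definition _ := GRing.Zmodule_isLmodule.Build R tensor
  tensor_scaleA tensor_scale1 tensor_scaleDr tensor_scaleDl.

Definition tens (m : M) (x : X) : tensor := tens_pi (TensPure m x).

Lemma tensor_ind (P : tensor -> Prop) : P 0 -> (forall z, P z -> P (- z)) ->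
  (forall z w, P z -> P w -> P (z + w)) ->
  (forall m x, P (tens m x)) -> forall z, P z.
Proof. exact: tens_ind. Qed.

Lemma tensDl m m' x : tens (m + m') x = tens m x + tens m' x.
Proof. by rewrite [RHS]tensor_addE; apply/tens_piP; constructor. Qed.
Lemma tensDr m x x' : tens m (x + x') = tens m x + tens m x'.
Proof. by rewrite [RHS]tensor_addE; apply/tens_piP; constructor. Qed.
Lemma tens_ract m r x : tens (ract m r) x = tens m (r *: x).
Proof. by apply/tens_piP; constructor. Qed.
Lemma tensZ r m x : tens (r *: m) x = r *: tens m x.
Proof. by rewrite [RHS]tensor_scaleE. Qed.

Lemma tens_suml x I (s : seq I) (P : pred I) (F : I -> M) :
  tens (\sum_(i <- s | P i) F i) x = \sum_(i <- s | P i) tens (F i) x.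
Proof.
apply: (big_morph (tens^~ x)) => [m m'|]; first exact: tensDl.
by apply: (@addrI _ (tens 0 x)); rewrite -tensDl !addr0.
Qed.

Lemma tens_sumr m I (s : seq I) (P : pred I) (F : I -> X) :
  tens m (\sum_(i <- s | P i) F i) = \sum_(i <- s | P i) tens m (F i).
Proof.
apply: (big_morph (tens m)) => [x x'|]; first exact: tensDr.
by apply: (@addrI _ (tens m 0)); rewrite -tensDr !addr0.
Qed.

Section Lift.
Variables (Y : lmodType R) (b : M -> X -> Y).
Hypotheses (bDl : forall m m' x, b (m + m') x = b m x + b m' x)
  (bDr : forall m x x', b m (x + x') = b m x + b m x')
  (b_bal : forall m r x, b (ract m r) x = b m (r *: x))
  (bZ : forall r m x, b (r *: m) x = r *: b m x).

Fixpoint tens_eval (a : tens_term) : Y :=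
  match a with
  | TensZero => 0
  | TensOpp c => - tens_eval c
  | TensAdd c d => tens_eval c + tens_eval d
  | TensPure m x => b m x
  end.

Lemma tens_eval_rel a c : tens_rel a c -> tens_eval a = tens_eval c.
Proof.
elim=> //= [? ? ? _ -> _ //|? ? _ -> //|? ? ? ? _ -> _ -> //|? ? ?|? ?|?|?].
- exact: addrA.
- exact: addrC.
- exact: add0r.
exact: addNr.
Qed.

Lemma tensor_lift : exists f : {linear tensor -> Y},
  forall m x, f (tens m x) = b m x.
Proof.
pose F (z : tensor) := tens_eval (tens_repr z).
have FE a : F (tens_pi a) = tens_eval a.
  by apply: tens_eval_rel; apply: tens_repr_pi.
have FD z w : F (z + w) = F z + F w.
  by rewrite -(tens_reprK z) -(tens_reprK w) [_ + _]tensor_addE !FE.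
have FZ r z : F (r *: z) = r *: F z.
  rewrite -(tens_reprK z) [_ *: _]tensor_scaleE !FE.
  elim: (tens_repr z) => /= [|a ->|a -> c ->|m x].
  - by rewrite scaler0.
  - by rewrite scalerN.
  - by rewrite scalerDr.
  exact: bZ.
have [f Hf] : exists f : {linear tensor -> Y}, forall z, f z = F z.
  by apply: exists_linear => c z w; rewrite FD FZ.
by exists f => m x; rewrite Hf FE.
Qed.

End Lift.

End Tensor.

Section TensorFunctor.
Variables (R : pzRingType) (M : bimodType R).

Section TensorMap.
Variables (X Y : lmodType R) (f : {linear X -> Y}).

Lemma tensor_map_exists : exists g : {linear tensor M X -> tensor M Y},
  forall m x, g (tens m x) = tens m (f x).
Proof.
apply: tensor_lift => [m m' x|m x x'|m r x|r m x].
- exact: tensDl.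
- by rewrite linearD tensDr.
- by rewrite tens_ract linearZ.
exact: tensZ.
Qed.

Definition tensor_map : {linear tensor M X -> tensor M Y} :=
  sval (cid tensor_map_exists).

Lemma tensor_mapE m x : tensor_map (tens m x) = tens m (f x).
Proof. by rewrite /tensor_map; case: cid. Qed.

End TensorMap.

Lemma linear_tensor_ext (X Y : lmodType R) (f g : {linear tensor M X -> Y}) :
  (forall m x, f (tens m x) = g (tens m x)) -> forall z, f z = g z.
Proof.
move=> H; elim/tensor_ind => [|z IH|z w IHz IHw|m x].
- by rewrite !linear0.
- by rewrite !linearN IH.
- by rewrite !linearD IHz IHw.
exact: H.
Qed.

Hypothesis HM : fg_proj M.

Lemma tensor_fin_gen (P : lmodType R) : fin_gen P -> fin_gen (tensor M P).
Proof.
have [/fin_genP[k [u Hu]] _] := HM; case=> n [g Hg]; apply/fin_genP.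
have [F HF] : exists F : {linear 'M[R]_(n, k) -> tensor M P},
    forall A, F A = \sum_i tens (u (row i A)) (g i).
  apply: exists_linear => c A B; rewrite scaler_sumr -big_split /=.
  by apply: eq_bigr => i _; rewrite !linearP /= tensDl tensZ.
exists (n * k)%N, (F \o vec_mx) => z.
suff [A <-] : exists A, F A = z by exists (mxvec A); rewrite /= mxvecK.
elim/tensor_ind: z => [|z [A <-]|z w [A <-] [B <-]|m x].
- by exists 0; rewrite linear0.
- by exists (- A); rewrite linearN.
- by exists (A + B); rewrite linearD.
have [a ->] := Hg x.
have /choice[v Hv] : forall i, exists v, u v = ract m (a i).
  by move=> i; apply: Hu.
exists (\matrix_i v i); rewrite HF tens_sumr; apply: eq_bigr => i _.
by rewrite rowK Hv tens_ract.
Qed.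

(* The left R-module Hom_R(M, X), with (r f) m = f (m r). *)
Section HomModule.
Variable X : lmodType R.

Definition hom_mod : Type := {f : M -> X | linear f}.
HB.instance Definition _ := gen_eqMixin hom_mod.
HB.instance Definition _ := gen_choiceMixin hom_mod.

Lemma hom_modP (f g : hom_mod) : (forall m, sval f m = sval g m) -> f = g.
Proof.
case: f g => [f Hf] [g Hg] /= /funext E; subst g; congr exist.
exact: Prop_irrelevance.
Qed.

Lemma hom_add_subproof (f g : hom_mod) : linear (fun m => sval f m + sval g m).
Proof. by move=> a x y; rewrite (svalP f) (svalP g) scalerDr addrACA. Qed.
Lemma hom_opp_subproof (f : hom_mod) : linear (fun m => - sval f m).
Proof. by move=> a x y; rewrite (svalP f) opprD scalerN. Qed.
Lemma hom_zero_subproof : linear (fun _ : M => 0 : X).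
Proof. by move=> a x y; rewrite scaler0 addr0. Qed.
Lemma hom_scale_subproof r (f : hom_mod) : linear (fun m => sval f (ract m r)).
Proof. by move=> a x y; rewrite ractDl ractZ (svalP f). Qed.

Definition hom_add (f g : hom_mod) : hom_mod := exist _ _ (hom_add_subproof f g).
Definition hom_opp (f : hom_mod) : hom_mod := exist _ _ (hom_opp_subproof f).
Definition hom_zero : hom_mod := exist _ _ hom_zero_subproof.
Definition hom_scale r (f : hom_mod) : hom_mod :=
  exist _ _ (hom_scale_subproof r f).

Lemma hom_addA : associative hom_add.
Proof. by move=> f g h; apply: hom_modP => m /=; rewrite addrA. Qed.
Lemma hom_addC : commutative hom_add.
Proof. by move=> f g; apply: hom_modP => m /=; rewrite addrC. Qed.
Lemma hom_add0 : left_id hom_zero hom_add.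
Proof. by move=> f; apply: hom_modP => m /=; rewrite add0r. Qed.
Lemma hom_addN : left_inverse hom_zero hom_opp hom_add.
Proof. by move=> f; apply: hom_modP => m /=; rewrite addNr. Qed.
HB.instance Definition _ := GRing.isZmodule.Build hom_mod
  hom_addA hom_addC hom_add0 hom_addN.

Lemma hom_scaleA r s f : hom_scale r (hom_scale s f) = hom_scale (r * s) f.
Proof. by apply: hom_modP => m /=; rewrite ractA. Qed.
Lemma hom_scale1 : left_id 1 hom_scale.
Proof. by move=> f; apply: hom_modP => m /=; rewrite ract1. Qed.
Lemma hom_scaleDr : right_distributive hom_scale +%R.
Proof. by move=> r f g; apply: hom_modP. Qed.
Lemma linear_fD (f : hom_mod) m m' : sval f (m + m') = sval f m + sval f m'.
Proof. by rewrite -[m]scale1r (svalP f) !scale1r. Qed.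
Lemma hom_scaleDl f : {morph hom_scale^~ f : r s / r + s}.
Proof. by move=> r s; apply: hom_modP => m /=; rewrite ractDr linear_fD. Qed.
HB.instance Definition _ := GRing.Zmodule_isLmodule.Build R hom_mod
  hom_scaleA hom_scale1 hom_scaleDr hom_scaleDl.

Lemma hom_linear (f : hom_mod) : exists g : {linear M -> X}, forall m, g m = sval f m.
Proof. by apply: exists_linear; apply: (svalP f). Qed.

Lemma linear_hom (g : {linear M -> X}) : exists f : hom_mod, forall m, sval f m = g m.
Proof.
have L : linear g by move=> a x y; rewrite linearP.
by exists (exist _ _ L).
Qed.

End HomModule.

Lemma tensor_fg_proj (P : lmodType R) : fg_proj P -> fg_proj (tensor M P).
Proof.
case=> fgP HP; split; first exact: tensor_fin_gen.
move=> X Y g h Hg.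
have [g' Hg'] : exists g' : {linear hom_mod X -> hom_mod Y},
    forall f m, sval (g' f) m = g (sval f m).
  have L (f : hom_mod X) : linear (fun m => g (sval f m)).
    by move=> a x y; rewrite (svalP f) linearP.
  have [k Hk] : exists k : {linear hom_mod X -> hom_mod Y},
      forall f, k f = exist _ _ (L f).
    apply: exists_linear => a x y; apply: hom_modP => m /=.
    by rewrite linearD.
  by exists k => f m; rewrite Hk.
have surj_g' f : exists f', g' f' = f.
  have [k Hk] := hom_linear f; have [_ pM] := HM.
  have [k' Hk'] := pM _ _ g k Hg; have [f' Hf'] := linear_hom k'.
  by exists f'; apply: hom_modP => m; rewrite Hg' Hf' Hk' Hk.
have L p : linear (fun m => h (tens m p)).
  by move=> a x y; rewrite tensDl tensZ linearP.
have [hh Hhh] : exists hh : {linear P -> hom_mod Y},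
    forall p, hh p = exist _ _ (L p).
  apply: exists_linear => a x y; apply: hom_modP => m /=.
  by rewrite tensDr linearD tens_ract.
have [q Hq] := HP _ _ g' hh surj_g'.
have [r Hr] : exists r : {linear tensor M P -> X},
    forall m p, r (tens m p) = sval (q p) m.
  apply: (@tensor_lift R M P X (fun m p => sval (q p) m))
    => [m m' x|m x x'|m s x|s m x].
  - exact: linear_fD.
  - by rewrite linearD.
  - by rewrite linearZ.
  have := svalP (q x) s m 0; rewrite addr0 => ->.
  have -> : sval (q x) 0 = 0.
    by apply: (@addrI _ (sval (q x) 0)); rewrite -linear_fD !addr0.
  by rewrite addr0.
exists r; apply: (@linear_tensor_ext P Y (g \o r) h) => m p /=.
by rewrite Hr -Hg' Hq Hhh.
Qed.

Lemma tensor_right_exact (A B X : lmodType R) (r : {linear A -> B})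
    (p : {linear B -> X}) :
  (forall x, exists v, p v = x) -> (forall v, p v = 0 <-> exists w, v = r w) ->
  (forall z, exists y, tensor_map p y = z) /\
  (forall z, tensor_map p z = 0 <-> exists w, z = tensor_map r w).
Proof.
move=> Hp Hr; split.
  elim/tensor_ind => [|z [y <-]|z w [y <-] [y' <-]|m x].
  - by exists 0; rewrite linear0.
  - by exists (- y); rewrite linearN.
  - by exists (y + y'); rewrite linearD.
  by have [v <-] := Hp x; exists (tens m v); rewrite tensor_mapE.
move=> z; split=> [Hz|[w ->]]; last first.
  elim/tensor_ind: w => [|w IH|w w' IH IH'|m x].
  - by rewrite !linear0.
  - by rewrite !linearN IH oppr0.
  - by rewrite !linearD IH IH' addr0.
  rewrite !tensor_mapE; have -> : p (r x) = 0 by apply/Hr; exists x.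
  by apply: (@addrI _ (tens m 0)); rewrite -tensDr !addr0.
pose D z := exists w, z = tensor_map r w.
have D0 : D 0 by exists 0; rewrite linear0.
have DN x : D x -> D (- x) by case=> w ->; exists (- w); rewrite linearN.
have DD x y : D x -> D y -> D (x + y).
  by case=> w -> [w' ->]; exists (w + w'); rewrite linearD.
have DB m v : p v = 0 -> D (tens m v).
  by move/Hr=> [w ->]; exists (tens m w); rewrite tensor_mapE.
have /choice[s Hs] := Hp.
pose fix ev (a : tens_term M X) : tensor M B :=
  match a with
  | TensZero => 0
  | TensOpp c => - ev c
  | TensAdd c d => ev c + ev d
  | TensPure m x => tens m (s x)
  end.
have tensN m v : tens m (- v) = - tens m v :> tensor M B.
  apply/eqP; rewrite -addr_eq0 -tensDr addNr; apply/eqP.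
  by apply: (@addrI _ (tens m 0)); rewrite -tensDr !addr0.
have evP a c : tens_rel a c -> D (ev a - ev c).
  elim=> /= [a'|a' c' _ H|x y t _ H _ H'|x y _ H|x x' y y' _ H _ H'|x y t|x y|x
           |x|m m' x|m x x'|m q x].
  - by rewrite subrr.
  - by rewrite -opprB; apply: DN.
  - by have := DD _ _ H H'; rewrite addrA subrK.
  - by rewrite -opprD; apply: DN.
  - by rewrite opprD addrACA; apply: DD.
  - by rewrite addrA subrr.
  - by rewrite (addrC (ev x) (ev y)) subrr.
  - by rewrite add0r subrr.
  - by rewrite addNr subrr.
  - by rewrite tensDl subrr.
  - rewrite -tensDr -tensN -tensDr; apply: DB.
    by rewrite linearB linearD /= !Hs subrr.
  rewrite tens_ract -tensN -tensDr; apply: DB.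
  by rewrite linearB linearZ /= !Hs subrr.
pose F (y : tensor M X) := ev (tens_repr y).
have FE a : D (F (tens_pi a) - ev a).
  by apply: evP; apply: tens_repr_pi.
suff : D (F (tensor_map p z) - z).
  rewrite Hz => H; have H0 := FE (TensZero M X).
  rewrite /= subr0 in H0.
  by have := DD _ _ (DN _ H) H0; rewrite opprB subrK.
elim/tensor_ind: z {Hz} => [|z IH|z w IHz IHw|m v].
- by rewrite linear0 subr0; have := FE (TensZero M X); rewrite subr0.
- rewrite linearN; set y := tensor_map p z in IH *.
  have := FE (TensOpp (tens_repr y)); rewrite -tensor_oppE tens_reprK /=.
  rewrite -/(F y) !opprK => H; have := DD _ _ H (DN _ IH).
  by rewrite opprB -addrA (addrCA (F y)) subrr addr0.
- rewrite linearD; set y := tensor_map p z in IHz *.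
  set y' := tensor_map p w in IHw *.
  have := FE (TensAdd (tens_repr y) (tens_repr y')).
  rewrite -tensor_addE !tens_reprK /= -/(F y) -/(F y') => H.
  have := DD _ _ H (DD _ _ IHz IHw).
  by rewrite [X in _ + X]addrACA -opprD addrA subrK.
rewrite tensor_mapE; have := FE (TensPure m (p v)) => /= H.
have H' : D (tens m (s (p v)) - tens m v).
  by rewrite -tensN -tensDr; apply: DB; rewrite linearB /= Hs subrr.
by have := DD _ _ H H'; rewrite addrA subrK.
Qed.

Lemma tensor_fin_pres (X : lmodType R) : fin_pres X -> fin_pres (tensor M X).
Proof.
case=> m [n [rho [pi [Hpi Hrho]]]].
have [H1 H2] := tensor_right_exact Hpi Hrho.
apply: (fin_pres_coker _ _ H1 H2); first by apply/tensor_fg_proj/fg_proj_row.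
by apply: tensor_fin_gen; case: (fg_proj_row R m).
Qed.

End TensorFunctor.

Section TensorRing.
Variables (R : pzRingType) (V : bimodType R).

(* The tensor ring T_R(V) as the ring generated by R and V subject to the ring
   operations of R, the addition of V and r * v = r v, v * r = v r.  Its
   universal property is [tensor_ring_lift] and [tensor_ring_ind]. *)
Inductive tr_term : Type :=
  | TrScalar of R
  | TrVec of V
  | TrOpp of tr_term
  | TrAdd of tr_term & tr_term
  | TrMul of tr_term & tr_term.

Inductive tr_rel : tr_term -> tr_term -> Prop :=
  | tr_refl a : tr_rel a a
  | tr_sym a b : tr_rel a b -> tr_rel b a
  | tr_trans a b c : tr_rel a b -> tr_rel b c -> tr_rel a c
  | tr_opp a b : tr_rel a b -> tr_rel (TrOpp a) (TrOpp b)
  | tr_add a a' b b' : tr_rel a a' -> tr_rel b b' ->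
      tr_rel (TrAdd a b) (TrAdd a' b')
  | tr_mul a a' b b' : tr_rel a a' -> tr_rel b b' ->
      tr_rel (TrMul a b) (TrMul a' b')
  | tr_addA a b c : tr_rel (TrAdd a (TrAdd b c)) (TrAdd (TrAdd a b) c)
  | tr_addC a b : tr_rel (TrAdd a b) (TrAdd b a)
  | tr_add0 a : tr_rel (TrAdd (TrScalar 0) a) a
  | tr_addN a : tr_rel (TrAdd (TrOpp a) a) (TrScalar 0)
  | tr_mulA a b c : tr_rel (TrMul a (TrMul b c)) (TrMul (TrMul a b) c)
  | tr_mul1l a : tr_rel (TrMul (TrScalar 1) a) a
  | tr_mul1r a : tr_rel (TrMul a (TrScalar 1)) a
  | tr_mulDl a b c :
      tr_rel (TrMul (TrAdd a b) c) (TrAdd (TrMul a c) (TrMul b c))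
  | tr_mulDr a b c :
      tr_rel (TrMul a (TrAdd b c)) (TrAdd (TrMul a b) (TrMul a c))
  | tr_scalarD r s :
      tr_rel (TrScalar (r + s)) (TrAdd (TrScalar r) (TrScalar s))
  | tr_scalarM r s :
      tr_rel (TrScalar (r * s)) (TrMul (TrScalar r) (TrScalar s))
  | tr_vecD v w : tr_rel (TrVec (v + w)) (TrAdd (TrVec v) (TrVec w))
  | tr_lact r v : tr_rel (TrVec (r *: v)) (TrMul (TrScalar r) (TrVec v))
  | tr_ract v r : tr_rel (TrVec (ract v r)) (TrMul (TrVec v) (TrScalar r)).

HB.instance Definition _ := gen_eqMixin tr_term.
HB.instance Definition _ := gen_choiceMixin tr_term.

Definition tr_relb : rel tr_term := fun a b => `[< tr_rel a b >].

Lemma tr_relb_refl : reflexive tr_relb.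
Proof. by move=> a; apply/asboolP; apply: tr_refl. Qed.
Lemma tr_relb_sym : symmetric tr_relb.
Proof. by move=> a b; apply/asboolP/asboolP; apply: tr_sym. Qed.
Lemma tr_relb_trans : transitive tr_relb.
Proof.
move=> b a c /asboolP H1 /asboolP H2; apply/asboolP; exact: tr_trans H1 H2.
Qed.

Canonical tr_equiv := EquivRel tr_relb tr_relb_refl tr_relb_sym tr_relb_trans.

Definition tensor_ring : Type := {eq_quot tr_equiv}.
HB.instance Definition _ := Choice.copy tensor_ring {eq_quot tr_equiv}.

Definition tr_pi (a : tr_term) : tensor_ring := \pi_{eq_quot tr_equiv} a.
Definition tr_repr (z : tensor_ring) : tr_term := repr (z : {eq_quot tr_equiv}).

Lemma tr_reprK z : tr_pi (tr_repr z) = z.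
Proof. exact: reprK. Qed.

Lemma tr_piP a b : tr_pi a = tr_pi b <-> tr_rel a b.
Proof.
split=> [/eqP|H]; first by rewrite eqmodE => /asboolP.
by apply/eqP; rewrite eqmodE; apply/asboolP.
Qed.

Lemma tr_repr_pi a : tr_rel (tr_repr (tr_pi a)) a.
Proof. by apply/tr_piP; rewrite tr_reprK. Qed.

Definition tring_add (z w : tensor_ring) : tensor_ring :=
  tr_pi (TrAdd (tr_repr z) (tr_repr w)).
Definition tring_opp (z : tensor_ring) : tensor_ring := tr_pi (TrOpp (tr_repr z)).
Definition tring_mul (z w : tensor_ring) : tensor_ring :=
  tr_pi (TrMul (tr_repr z) (tr_repr w)).

Lemma tring_addE a b : tring_add (tr_pi a) (tr_pi b) = tr_pi (TrAdd a b).
Proof. by apply/tr_piP; apply: tr_add; apply: tr_repr_pi. Qed.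
Lemma tring_oppE a : tring_opp (tr_pi a) = tr_pi (TrOpp a).
Proof. by apply/tr_piP; apply: tr_opp; apply: tr_repr_pi. Qed.
Lemma tring_mulE a b : tring_mul (tr_pi a) (tr_pi b) = tr_pi (TrMul a b).
Proof. by apply/tr_piP; apply: tr_mul; apply: tr_repr_pi. Qed.

Lemma tring_addA : associative tring_add.
Proof.
move=> x y z; rewrite -(tr_reprK x) -(tr_reprK y) -(tr_reprK z).
by rewrite !tring_addE; apply/tr_piP; apply: tr_addA.
Qed.
Lemma tring_addC : commutative tring_add.
Proof. by move=> x y; apply/tr_piP; apply: tr_addC. Qed.
Lemma tring_add0 : left_id (tr_pi (TrScalar 0)) tring_add.
Proof.
by move=> x; rewrite -(tr_reprK x) tring_addE; apply/tr_piP; apply: tr_add0.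
Qed.
Lemma tring_addN : left_inverse (tr_pi (TrScalar 0)) tring_opp tring_add.
Proof.
move=> x; rewrite -(tr_reprK x) tring_oppE tring_addE; apply/tr_piP.
exact: tr_addN.
Qed.
Lemma tring_mulA : associative tring_mul.
Proof.
move=> x y z; rewrite -(tr_reprK x) -(tr_reprK y) -(tr_reprK z).
by rewrite !tring_mulE; apply/tr_piP; apply: tr_mulA.
Qed.
Lemma tring_mul1l : left_id (tr_pi (TrScalar 1)) tring_mul.
Proof.
by move=> x; rewrite -(tr_reprK x) tring_mulE; apply/tr_piP; apply: tr_mul1l.
Qed.
Lemma tring_mul1r : right_id (tr_pi (TrScalar 1)) tring_mul.
Proof.
by move=> x; rewrite -(tr_reprK x) tring_mulE; apply/tr_piP; apply: tr_mul1r.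
Qed.
Lemma tring_mulDl : left_distributive tring_mul tring_add.
Proof.
move=> x y z; rewrite -(tr_reprK x) -(tr_reprK y) -(tr_reprK z).
by rewrite !(tring_addE, tring_mulE); apply/tr_piP; apply: tr_mulDl.
Qed.
Lemma tring_mulDr : right_distributive tring_mul tring_add.
Proof.
move=> x y z; rewrite -(tr_reprK x) -(tr_reprK y) -(tr_reprK z).
by rewrite !(tring_addE, tring_mulE); apply/tr_piP; apply: tr_mulDr.
Qed.

HB.instance Definition _ := GRing.isPzRing.Build tensor_ring
  tring_addA tring_addC tring_add0 tring_addN
  tring_mulA tring_mul1l tring_mul1r tring_mulDl tring_mulDr.

Definition tr_scalar (r : R) : tensor_ring := tr_pi (TrScalar r).
Definition tr_vec (v : V) : tensor_ring := tr_pi (TrVec v).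

Lemma tr_scalar1E : tr_scalar 1 = 1. Proof. by []. Qed.
Lemma tr_scalarDE r s : tr_scalar (r + s) = tr_scalar r + tr_scalar s.
Proof. by rewrite [RHS]tring_addE; apply/tr_piP; constructor. Qed.
Lemma tr_scalarME r s : tr_scalar (r * s) = tr_scalar r * tr_scalar s.
Proof. by rewrite [RHS]tring_mulE; apply/tr_piP; constructor. Qed.
Lemma tr_vecDE v w : tr_vec (v + w) = tr_vec v + tr_vec w.
Proof. by rewrite [RHS]tring_addE; apply/tr_piP; constructor. Qed.
Lemma tr_lactE r v : tr_vec (r *: v) = tr_scalar r * tr_vec v.
Proof. by rewrite [RHS]tring_mulE; apply/tr_piP; constructor. Qed.
Lemma tr_ractE v r : tr_vec (ract v r) = tr_vec v * tr_scalar r.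
Proof. by rewrite [RHS]tring_mulE; apply/tr_piP; constructor. Qed.

Lemma tensor_ring_ind (P : tensor_ring -> Prop) :
  (forall r, P (tr_scalar r)) -> (forall v, P (tr_vec v)) ->
  (forall z, P z -> P (- z)) -> (forall z w, P z -> P w -> P (z + w)) ->
  (forall z w, P z -> P w -> P (z * w)) -> forall z, P z.
Proof.
move=> Ps Pv PN PD PM z; rewrite -(tr_reprK z).
elim: (tr_repr z) => //= [a IH|a IHa b IHb|a IHa b IHb].
- by have := PN _ IH; rewrite [- _]tring_oppE.
- by have := PD _ _ IHa IHb; rewrite [_ + _]tring_addE.
by have := PM _ _ IHa IHb; rewrite [_ * _]tring_mulE.
Qed.

Section Lift.
Variables (S : pzRingType) (phi : {rmorphism R -> S}) (psi : V -> S).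
Hypotheses (psiD : forall v w, psi (v + w) = psi v + psi w)
  (psiZ : forall r v, psi (r *: v) = phi r * psi v)
  (psi_ract : forall v r, psi (ract v r) = psi v * phi r).

Fixpoint tr_eval (a : tr_term) : S :=
  match a with
  | TrScalar r => phi r
  | TrVec v => psi v
  | TrOpp c => - tr_eval c
  | TrAdd c d => tr_eval c + tr_eval d
  | TrMul c d => tr_eval c * tr_eval d
  end.

Lemma tr_eval_rel a b : tr_rel a b -> tr_eval a = tr_eval b.
Proof.
elim=> //=.
- by move=> ? ? ? _ -> _ ->.
- by move=> ? ? _ ->.
- by move=> ? ? ? ? _ -> _ ->.
- by move=> ? ? ? ? _ -> _ ->.
- by move=> ? ? ?; rewrite addrA.
- by move=> ? ?; rewrite addrC.
- by move=> ?; rewrite rmorph0 add0r.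
- by move=> ?; rewrite rmorph0 addNr.
- by move=> ? ? ?; rewrite mulrA.
- by move=> ?; rewrite rmorph1 mul1r.
- by move=> ?; rewrite rmorph1 mulr1.
- by move=> ? ? ?; rewrite mulrDl.
- by move=> ? ? ?; rewrite mulrDr.
- by move=> ? ?; rewrite rmorphD.
by move=> ? ?; rewrite rmorphM.
Qed.

Lemma tensor_ring_lift : exists F : {rmorphism tensor_ring -> S},
  (forall r, F (tr_scalar r) = phi r) /\ (forall v, F (tr_vec v) = psi v).
Proof.
pose F (z : tensor_ring) := tr_eval (tr_repr z).
have FE a : F (tr_pi a) = tr_eval a by apply: tr_eval_rel; apply: tr_repr_pi.
have FB : zmod_morphism F.
  move=> x y; rewrite -(tr_reprK x) -(tr_reprK y).
  by rewrite [- _]tring_oppE [_ + _]tring_addE !FE.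
have FM : monoid_morphism F.
  split=> [|x y]; first by rewrite [LHS]FE /= rmorph1.
  by rewrite -(tr_reprK x) -(tr_reprK y) [_ * _]tring_mulE !FE.
pose m1 := GRing.isZmodMorphism.Build _ _ F FB.
pose m2 := GRing.isMonoidMorphism.Build _ _ F FM.
pose G : {rmorphism tensor_ring -> S} := HB.pack F m1 m2.
by exists G; split=> [r|v]; apply: FE.
Qed.

End Lift.

End TensorRing.

Section IdealQuotient.
Variables (T : pzRingType) (S : T -> Prop).

Inductive two_sided_ideal : T -> Prop :=
  | tsi_gen a : S a -> two_sided_ideal a
  | tsi_zero : two_sided_ideal 0
  | tsi_add a b : two_sided_ideal a -> two_sided_ideal b -> two_sided_ideal (a + b)
  | tsi_mull a b : two_sided_ideal b -> two_sided_ideal (a * b)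
  | tsi_mulr a b : two_sided_ideal a -> two_sided_ideal (a * b).

Definition rq_relb : rel T := fun a b => `[< two_sided_ideal (a - b) >].

Lemma tsi_opp a : two_sided_ideal a -> two_sided_ideal (- a).
Proof. by rewrite -mulN1r; apply: tsi_mull. Qed.

Lemma rq_relb_refl : reflexive rq_relb.
Proof. by move=> a; apply/asboolP; rewrite subrr; apply: tsi_zero. Qed.
Lemma rq_relb_sym : symmetric rq_relb.
Proof. by move=> a b; apply/asboolP/asboolP => /tsi_opp; rewrite opprB. Qed.
Lemma rq_relb_trans : transitive rq_relb.
Proof.
move=> b a c /asboolP H1 /asboolP H2; apply/asboolP.
by have := tsi_add H1 H2; rewrite addrA subrK.
Qed.

Canonical rq_equiv := EquivRel rq_relb rq_relb_refl rq_relb_sym rq_relb_trans.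

Definition ring_quot : Type := {eq_quot rq_equiv}.
HB.instance Definition _ := Choice.copy ring_quot {eq_quot rq_equiv}.

Definition rq_pi (a : T) : ring_quot := \pi_{eq_quot rq_equiv} a.
Definition rq_repr (z : ring_quot) : T := repr (z : {eq_quot rq_equiv}).

Lemma rq_reprK z : rq_pi (rq_repr z) = z.
Proof. exact: reprK. Qed.

Lemma rq_piP a b : rq_pi a = rq_pi b <-> two_sided_ideal (a - b).
Proof.
split=> [/eqP|H]; first by rewrite eqmodE => /asboolP.
by apply/eqP; rewrite eqmodE; apply/asboolP.
Qed.

Lemma rq_repr_pi a : two_sided_ideal (rq_repr (rq_pi a) - a).
Proof. by apply/rq_piP; rewrite rq_reprK. Qed.

Definition rq_add (z w : ring_quot) : ring_quot := rq_pi (rq_repr z + rq_repr w).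
Definition rq_opp (z : ring_quot) : ring_quot := rq_pi (- rq_repr z).
Definition rq_mul (z w : ring_quot) : ring_quot := rq_pi (rq_repr z * rq_repr w).

Lemma rq_addE a b : rq_add (rq_pi a) (rq_pi b) = rq_pi (a + b).
Proof.
by apply/rq_piP; rewrite opprD addrACA; apply: tsi_add; apply: rq_repr_pi.
Qed.
Lemma rq_oppE a : rq_opp (rq_pi a) = rq_pi (- a).
Proof. by apply/rq_piP; rewrite -opprD; apply/tsi_opp/rq_repr_pi. Qed.
Lemma rq_mulE a b : rq_mul (rq_pi a) (rq_pi b) = rq_pi (a * b).
Proof.
apply/rq_piP; set x := rq_repr _; set y := rq_repr _.
have -> : x * y - a * b = (x - a) * y + a * (y - b).
  by rewrite mulrBl mulrBr addrA subrK.
by apply: tsi_add; [apply: tsi_mulr|apply: tsi_mull]; apply: rq_repr_pi.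
Qed.

Lemma rq_addA : associative rq_add.
Proof.
move=> x y z; rewrite -(rq_reprK x) -(rq_reprK y) -(rq_reprK z).
by rewrite !rq_addE addrA.
Qed.
Lemma rq_addC : commutative rq_add.
Proof. by move=> x y; rewrite /rq_add addrC. Qed.
Lemma rq_add0 : left_id (rq_pi 0) rq_add.
Proof. by move=> x; rewrite -(rq_reprK x) rq_addE add0r. Qed.
Lemma rq_addN : left_inverse (rq_pi 0) rq_opp rq_add.
Proof. by move=> x; rewrite -(rq_reprK x) rq_oppE rq_addE addNr. Qed.
Lemma rq_mulA : associative rq_mul.
Proof.
move=> x y z; rewrite -(rq_reprK x) -(rq_reprK y) -(rq_reprK z).
by rewrite !rq_mulE mulrA.
Qed.
Lemma rq_mul1l : left_id (rq_pi 1) rq_mul.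
Proof. by move=> x; rewrite -(rq_reprK x) rq_mulE mul1r. Qed.
Lemma rq_mul1r : right_id (rq_pi 1) rq_mul.
Proof. by move=> x; rewrite -(rq_reprK x) rq_mulE mulr1. Qed.
Lemma rq_mulDl : left_distributive rq_mul rq_add.
Proof.
move=> x y z; rewrite -(rq_reprK x) -(rq_reprK y) -(rq_reprK z).
by rewrite !(rq_addE, rq_mulE) mulrDl.
Qed.
Lemma rq_mulDr : right_distributive rq_mul rq_add.
Proof.
move=> x y z; rewrite -(rq_reprK x) -(rq_reprK y) -(rq_reprK z).
by rewrite !(rq_addE, rq_mulE) mulrDr.
Qed.

HB.instance Definition _ := GRing.isPzRing.Build ring_quot
  rq_addA rq_addC rq_add0 rq_addN rq_mulA rq_mul1l rq_mul1r rq_mulDl rq_mulDr.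

Lemma rq_piB : zmod_morphism rq_pi.
Proof. by move=> a b; rewrite [- rq_pi b]rq_oppE [RHS]rq_addE. Qed.
Lemma rq_piM : monoid_morphism rq_pi.
Proof. by split=> // a b; rewrite [RHS]rq_mulE. Qed.
HB.instance Definition _ := GRing.isZmodMorphism.Build T ring_quot rq_pi rq_piB.
HB.instance Definition _ := GRing.isMonoidMorphism.Build T ring_quot rq_pi rq_piM.

End IdealQuotient.

Section ProductBimodule.
Variables (R : pzRingType) (V W : bimodType R).

Definition prod_ract (z : V * W) (r : R) : V * W := (ract z.1 r, ract z.2 r).

Lemma prod_ract1 z : prod_ract z 1 = z.
Proof. by case: z => v w; rewrite /prod_ract /= !ract1. Qed.
Lemma prod_ractA z r s : prod_ract (prod_ract z r) s = prod_ract z (r * s).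
Proof. by rewrite /prod_ract /= !ractA. Qed.
Lemma prod_ractDl z t r : prod_ract (z + t) r = prod_ract z r + prod_ract t r.
Proof. by rewrite /prod_ract /= !ractDl. Qed.
Lemma prod_ractDr z r s : prod_ract z (r + s) = prod_ract z r + prod_ract z s.
Proof. by rewrite /prod_ract /= !ractDr. Qed.
Lemma prod_ractZ r z s : prod_ract (r *: z) s = r *: prod_ract z s.
Proof. by rewrite /prod_ract /= !ractZ. Qed.

HB.instance Definition _ := Lmodule_isBimodule.Build R (V * W)%type
  prod_ract1 prod_ractA prod_ractDl prod_ractDr prod_ractZ.
End ProductBimodule.

Section Dual.
Variables (R : pzRingType) (M : bimodType R).

(* M^* = Hom_R(M, R), with (a f) x = f (x a) as for any [hom_mod]
   and (f b) x = f x * b. *)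
Definition dual : Type := hom_mod M R^o.
HB.instance Definition _ := GRing.Lmodule.copy dual (hom_mod M R^o).

Definition dual_eval (f : dual) (x : M) : R := sval f x.

Lemma dual_ract_subproof (f : dual) b :
  linear (fun x => (dual_eval f x * b : R^o)).
Proof.
move=> a x y; rewrite /dual_eval (svalP f) mulrDl; congr (_ + _).
by rewrite -[LHS]mulrA.
Qed.
Definition dual_ract (f : dual) (b : R) : dual :=
  exist _ _ (dual_ract_subproof f b).

Lemma dual_ract1 f : dual_ract f 1 = f.
Proof. by apply: hom_modP => x /=; rewrite mulr1. Qed.
Lemma dual_ractA f r s : dual_ract (dual_ract f r) s = dual_ract f (r * s).
Proof. by apply: hom_modP => x /=; rewrite /dual_eval /= mulrA. Qed.
Lemma dual_ractDl f g r : dual_ract (f + g) r = dual_ract f r + dual_ract g r.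
Proof. by apply: hom_modP => x /=; rewrite /dual_eval /= mulrDl. Qed.
Lemma dual_ractDr f r s : dual_ract f (r + s) = dual_ract f r + dual_ract f s.
Proof. by apply: hom_modP => x /=; rewrite /dual_eval /= mulrDr. Qed.
Lemma dual_ractZ r f s : dual_ract (r *: f) s = r *: dual_ract f s.
Proof. by apply: hom_modP. Qed.

HB.instance Definition _ := Lmodule_isBimodule.Build R dual
  dual_ract1 dual_ractA dual_ractDl dual_ractDr dual_ractZ.

Definition is_dual_basis n (al : 'I_n -> M) (al' : 'I_n -> dual) : Prop :=
  (forall x : M, x = \sum_(j < n) dual_eval (al' j) x *: al j) /\
  (forall f : dual, f = \sum_(j < n) ract (al' j) (dual_eval f (al j))).

End Dual.

Section Leavitt.
Variables (R : pzRingType) (M : bimodType R).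

Let T := tensor_ring (dual M * M)%type.
Definition lv_dualT (f : dual M) : T := tr_vec (f, 0).
Definition lv_vecT (x : M) : T := tr_vec (0, x).

(* The Casimir element does not depend on the choice of the dual basis: all the
   generators [leavitt_casimir] are equal. *)
Inductive leavitt_gen : T -> Prop :=
  | leavitt_eval x f :
      leavitt_gen (lv_vecT x * lv_dualT f - tr_scalar _ (dual_eval f x))
  | leavitt_casimir n (al : 'I_n -> M) (al' : 'I_n -> dual M) :
      is_dual_basis al al' ->
      leavitt_gen (\sum_(j < n) lv_dualT (al' j) * lv_vecT (al j) - 1).

Definition leavitt : pzRingType := ring_quot leavitt_gen.

Definition lv_pi : T -> leavitt := @rq_pi T leavitt_gen.
Definition lv_scalar (r : R) : leavitt := lv_pi (tr_scalar _ r).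
Definition lv_vec (x : M) : leavitt := lv_pi (lv_vecT x).
Definition lv_dual (f : dual M) : leavitt := lv_pi (lv_dualT f).

(* The grading induced by that of the tensor ring: the smallest multiplicative
   family of subgroups giving R, M and M^* the degrees 0, -1 and 1. *)
Inductive lv_deg : int -> leavitt -> Prop :=
  | lv_deg0 d : lv_deg d 0
  | lv_degB d a b : lv_deg d a -> lv_deg d b -> lv_deg d (a - b)
  | lv_degM d e a b : lv_deg d a -> lv_deg e b -> lv_deg (d + e) (a * b)
  | lv_deg_scalar r : lv_deg 0 (lv_scalar r)
  | lv_deg_vec x : lv_deg (-1) (lv_vec x)
  | lv_deg_dual f : lv_deg 1 (lv_dual f).

End Leavitt.

(* A decomposition of A as the direct sum of the subgroups [deg d]. *)
Record is_grading (A : zmodType) (deg : int -> A -> Prop) : Prop := IsGrading {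
  gr_zero : forall d, deg d 0;
  gr_sub : forall d a b, deg d a -> deg d b -> deg d (a - b);
  gr_gen : forall a, exists s : seq A,
    (forall b, b \in s -> exists d, deg d b) /\ a = \sum_(b <- s) b;
  gr_indep : forall (s : seq int) (c : int -> A), uniq s ->
    (forall d, deg d (c d)) -> \sum_(d <- s) c d = 0 ->
    forall d, d \in s -> c d = 0
}.

Record graded_ring := GradedRing {
  gr_ring :> pzRingType;
  rdeg : int -> gr_ring -> Prop;
  rdeg_grading : is_grading rdeg;
  rdeg1 : rdeg 0 1;
  rdegM : forall d e a b, rdeg d a -> rdeg e b -> rdeg (d + e) (a * b)
}.

Section LeavittGrading.
Variables (R : pzRingType) (M : bimodType R).
Let T := tensor_ring (dual M * M)%type.
Let L := leavitt M.

Lemma lv_vecE (x : M) (f : dual M) : lv_vec x * lv_dual f = lv_scalar M (dual_eval f x).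
Proof.
rewrite /lv_vec /lv_dual /lv_pi -rmorphM; apply/rq_piP.
by apply: tsi_gen; constructor.
Qed.

Lemma lv_casimirE n (al : 'I_n -> M) (al' : 'I_n -> dual M) :
  is_dual_basis al al' -> \sum_(j < n) lv_dual (al' j) * lv_vec (al j) = 1.
Proof.
move=> H; rewrite -(rmorph1 (@rq_pi T (@leavitt_gen R M))).
under eq_bigr do rewrite /lv_dual /lv_vec /lv_pi -rmorphM.
rewrite -rmorph_sum; apply/rq_piP; apply: tsi_gen.
exact: (leavitt_casimir H).
Qed.

Lemma lv_scalarD r s : lv_scalar M (r + s) = lv_scalar M r + lv_scalar M s.
Proof. by rewrite /lv_scalar /lv_pi tr_scalarDE rmorphD. Qed.
Lemma lv_scalarM r s : lv_scalar M (r * s) = lv_scalar M r * lv_scalar M s.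
Proof. by rewrite /lv_scalar /lv_pi tr_scalarME rmorphM. Qed.
Lemma lv_scalar1 : lv_scalar M 1 = 1.
Proof. by rewrite /lv_scalar /lv_pi tr_scalar1E rmorph1. Qed.
Lemma lv_scalar0 : lv_scalar M 0 = 0.
Proof. by apply: (@addrI _ (lv_scalar M 0)); rewrite -lv_scalarD !addr0. Qed.
Lemma lv_vecD (x y : M) : lv_vec (x + y) = lv_vec x + lv_vec y.
Proof.
rewrite /lv_vec /lv_pi -rmorphD /lv_vecT -tr_vecDE; congr (rq_pi _ (tr_vec _)).
by congr pair; rewrite /= addr0.
Qed.
Lemma lv_dualD (f g : dual M) : lv_dual (f + g) = lv_dual f + lv_dual g.
Proof.
rewrite /lv_dual /lv_pi -rmorphD /lv_dualT -tr_vecDE; congr (rq_pi _ (tr_vec _)).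
by congr pair; rewrite /= addr0.
Qed.
Lemma ract0 (V : bimodType R) r : ract (0 : V) r = 0.
Proof. by apply: (@addrI _ (ract (0 : V) r)); rewrite -ractDl !addr0. Qed.
Lemma lv_vecZ r (x : M) : lv_vec (r *: x) = lv_scalar M r * lv_vec x.
Proof.
rewrite /lv_vec /lv_scalar /lv_pi -rmorphM /lv_vecT -tr_lactE.
by congr (rq_pi _ (tr_vec _)); congr pair; rewrite /= scaler0.
Qed.
Lemma lv_dualZ r (f : dual M) : lv_dual (r *: f) = lv_scalar M r * lv_dual f.
Proof.
rewrite /lv_dual /lv_scalar /lv_pi -rmorphM /lv_dualT -tr_lactE.
by congr (rq_pi _ (tr_vec _)); congr pair; rewrite /= scaler0.
Qed.
Lemma lv_vec_ract (x : M) r : lv_vec (ract x r) = lv_vec x * lv_scalar M r.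
Proof.
rewrite /lv_vec /lv_scalar /lv_pi -rmorphM /lv_vecT -tr_ractE.
by congr (rq_pi _ (tr_vec _)); congr pair; rewrite ract0.
Qed.
Lemma lv_dual_ract (f : dual M) r : lv_dual (ract f r) = lv_dual f * lv_scalar M r.
Proof.
rewrite /lv_dual /lv_scalar /lv_pi -rmorphM /lv_dualT -tr_ractE.
by congr (rq_pi _ (tr_vec _)); congr pair; rewrite ract0.
Qed.

Lemma leavitt_ind (P : L -> Prop) :
  (forall r, P (lv_scalar M r)) -> (forall x : M, P (lv_vec x)) ->
  (forall f : dual M, P (lv_dual f)) ->
  (forall z, P z -> P (- z)) -> (forall z w, P z -> P w -> P (z + w)) ->
  (forall z w, P z -> P w -> P (z * w)) -> forall z, P z.
Proof.
move=> Ps Px Pf PN PD PM z; rewrite -(rq_reprK z).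
elim/tensor_ring_ind: (rq_repr z) => [r|[f x]|a Ha|a b Ha Hb|a b Ha Hb].
- exact: Ps.
- have -> : tr_vec (f, x) = lv_dualT f + lv_vecT x.
    by rewrite /lv_dualT -tr_vecDE; congr tr_vec; congr pair;
      rewrite /= ?addr0 ?add0r.
  by rewrite rmorphD; apply: PD; [apply: Pf|apply: Px].
- by rewrite rmorphN; apply: PN.
- by rewrite rmorphD; apply: PD.
by rewrite rmorphM; apply: PM.
Qed.

(* Directness of the grading: L acts on the functions int -> L so that an
   element a of degree d sends u to k |-> a * u (k - d). *)
Fixpoint lv_act (a : tr_term (dual M * M)%type) (u : int -> L) : int -> L :=
  match a with
  | TrScalar r => fun k => lv_scalar M r * u k
  | TrVec v => fun k => lv_dual v.1 * u (k - 1) + lv_vec v.2 * u (k + 1)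
  | TrOpp b => fun k => - lv_act b u k
  | TrAdd b c => fun k => lv_act b u k + lv_act c u k
  | TrMul b c => lv_act b (lv_act c u)
  end.

Lemma lv_actD a u v k :
  lv_act a (fun i => u i + v i) k = lv_act a u k + lv_act a v k.
Proof.
elim: a u v k => /= [r|w|a IH|a IHa b IHb|a IHa b IHb] u v k.
- by rewrite mulrDr.
- by rewrite !mulrDr addrACA.
- by rewrite IH opprD.
- by rewrite IHa IHb addrACA.
rewrite -IHa; congr (lv_act a _ k); apply/funext => i; exact: IHb.
Qed.

Lemma lv_act_rel a b : tr_rel a b -> lv_act a = lv_act b.
Proof.
have E (f g : (int -> L) -> int -> L) : (forall u k, f u k = g u k) -> f = g.
  by move=> H; apply/funext => u; apply/funext => k.
elim=> //=.
- by move=> ? ? ? _ -> _ ->.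
- by move=> ? ? _ ->.
- by move=> ? ? ? ? _ -> _ ->.
- by move=> ? ? ? ? _ -> _ ->.
- by move=> *; apply: E => u k; rewrite addrA.
- by move=> *; apply: E => u k; rewrite addrC.
- by move=> *; apply: E => u k; rewrite lv_scalar0 mul0r add0r.
- by move=> *; apply: E => u k; rewrite lv_scalar0 mul0r addNr.
- move=> c; apply: E => u k; rewrite lv_scalar1 mul1r //.
- move=> c; apply: E => u k; congr (lv_act c _ k); apply/funext => i.
  by rewrite lv_scalar1 mul1r.
- by move=> *; apply: E => u k; rewrite lv_actD.
- by move=> *; apply: E => u k; rewrite lv_scalarD mulrDl.
- by move=> *; apply: E => u k; rewrite lv_scalarM mulrA.
- by move=> *; apply: E => u k; rewrite lv_dualD lv_vecD !mulrDl addrACA.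
- by move=> *; apply: E => u k; rewrite lv_dualZ lv_vecZ mulrDr !mulrA.
by move=> *; apply: E => u k; rewrite lv_dual_ract lv_vec_ract !mulrA.
Qed.

Definition lv_actT (z : T) := lv_act (tr_repr z).

Lemma lv_actTE a : lv_actT (tr_pi a) = lv_act a.
Proof. by apply: lv_act_rel; apply: tr_repr_pi. Qed.
Lemma lv_actTD z w u k : lv_actT (z + w) u k = lv_actT z u k + lv_actT w u k.
Proof. by rewrite /GRing.add /= /tring_add lv_actTE. Qed.
Lemma lv_actTN z u k : lv_actT (- z) u k = - lv_actT z u k.
Proof. by rewrite /GRing.opp /= /tring_opp lv_actTE. Qed.
Lemma lv_actTM z w u : lv_actT (z * w) u = lv_actT z (lv_actT w u).
Proof. by rewrite /GRing.mul /= /tring_mul lv_actTE. Qed.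
Lemma lv_actT0 u k : lv_actT 0 u k = 0.
Proof. by apply: (@addrI _ (lv_actT 0 u k)); rewrite -lv_actTD !addr0. Qed.
Lemma lv_actT_scalar r u k : lv_actT (tr_scalar _ r) u k = lv_scalar M r * u k.
Proof. by rewrite /tr_scalar lv_actTE. Qed.
Lemma lv_dual0 : lv_dual (0 : dual M) = 0.
Proof. by apply: (@addrI _ (lv_dual 0)); rewrite -lv_dualD !addr0. Qed.
Lemma lv_vec0 : lv_vec (0 : M) = 0.
Proof. by apply: (@addrI _ (lv_vec 0)); rewrite -lv_vecD !addr0. Qed.
Lemma lv_actT_vec (x : M) u k : lv_actT (lv_vecT x) u k = lv_vec x * u (k + 1).
Proof. by rewrite /lv_vecT lv_actTE /= lv_dual0 mul0r add0r. Qed.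
Lemma lv_actT_dual (f : dual M) u k : lv_actT (lv_dualT f) u k = lv_dual f * u (k - 1).
Proof. by rewrite /lv_dualT lv_actTE /= lv_vec0 mul0r addr0. Qed.

Lemma lv_actT_fun0 z k : lv_actT z (fun=> 0) k = 0.
Proof.
apply: (@addrI _ (lv_actT z (fun=> 0) k)); rewrite addr0 /lv_actT -lv_actD.
by congr (lv_act _ _ k); apply/funext => i; rewrite addr0.
Qed.

Lemma lv_actT_ideal z : two_sided_ideal (@leavitt_gen R M) z ->
  forall u k, lv_actT z u k = 0.
Proof.
elim=> [_ [x f|n al al' H]||a b _ Ha _ Hb|a b _ Hb|a b _ Ha] u k.
- rewrite lv_actTD lv_actTN lv_actTM lv_actT_vec lv_actT_dual lv_actT_scalar.
  by rewrite mulrA lv_vecE addrK subrr.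
- rewrite lv_actTD lv_actTN -tr_scalar1E lv_actT_scalar lv_scalar1 mul1r.
  rewrite (big_morph (fun z => lv_actT z u k) (fun z w => lv_actTD z w u k)
    (lv_actT0 u k)).
  under eq_bigr do rewrite lv_actTM lv_actT_dual lv_actT_vec mulrA subrK.
  by rewrite -mulr_suml lv_casimirE // mul1r subrr.
- exact: lv_actT0.
- by rewrite lv_actTD Ha Hb addr0.
- rewrite lv_actTM; have -> : lv_actT b u = fun=> 0 by apply/funext => i.
  exact: lv_actT_fun0.
by rewrite lv_actTM Ha.
Qed.

Definition lv_actL (z : L) := lv_actT (rq_repr z).

Lemma lv_actLE a u k : lv_actL (rq_pi _ a) u k = lv_actT a u k.
Proof.
have := lv_actT_ideal (rq_repr_pi (@leavitt_gen R M) a) u k.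
by rewrite lv_actTD lv_actTN => /eqP; rewrite subr_eq0 => /eqP.
Qed.

Lemma lv_actLD z w u k : lv_actL (z + w) u k = lv_actL z u k + lv_actL w u k.
Proof. by rewrite [z + w]/(rq_pi _ _) lv_actLE lv_actTD. Qed.
Lemma lv_actL0 u k : lv_actL 0 u k = 0.
Proof. by apply: (@addrI _ (lv_actL 0 u k)); rewrite -lv_actLD !addr0. Qed.
Lemma lv_actLB z w u k : lv_actL (z - w) u k = lv_actL z u k - lv_actL w u k.
Proof.
rewrite lv_actLD; congr (_ + _); apply/eqP; rewrite -addr_eq0 -lv_actLD addNr.
by rewrite lv_actL0.
Qed.
Lemma lv_actLM z w u k : lv_actL (z * w) u k = lv_actL z (lv_actL w u) k.
Proof. by rewrite [z * w]/(rq_pi _ _) lv_actLE lv_actTM. Qed.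

Lemma lv_actL_deg d z : lv_deg d z ->
  forall u k, lv_actL z u k = z * u (k - d).
Proof.
elim=> [e|e a b _ Ha _ Hb|e e' a b _ Ha _ Hb|r|x|f] u k.
- by rewrite lv_actL0 mul0r.
- by rewrite lv_actLB Ha Hb mulrBl.
- by rewrite lv_actLM Ha Hb mulrA opprD addrA.
- by rewrite lv_actLE lv_actT_scalar subr0.
- by rewrite lv_actLE lv_actT_vec opprK.
by rewrite lv_actLE lv_actT_dual.
Qed.

Lemma lv_grading : is_grading (@lv_deg R M).
Proof.
split=> [d|d a b|a|s c us Hc Hs d ds]; try by constructor.
  have N d b : lv_deg d b -> lv_deg d (- b).
    by move=> H; rewrite -sub0r; apply: lv_degB => //; apply: lv_deg0.
  elim/leavitt_ind: a => [r|x|f|a [s [Hs ->]]|a b [s [Hs ->]] [t [Ht ->]]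
      |a b [s [Hs ->]] [t [Ht ->]]].
  - exists [:: lv_scalar M r]; rewrite big_seq1; split=> // b.
    by rewrite inE => /eqP->; exists 0; constructor.
  - exists [:: lv_vec x]; rewrite big_seq1; split=> // b.
    by rewrite inE => /eqP->; exists (-1); constructor.
  - exists [:: lv_dual f]; rewrite big_seq1; split=> // b.
    by rewrite inE => /eqP->; exists 1; constructor.
  - exists [seq - b | b <- s]; split; last by rewrite big_map sumrN.
    by move=> _ /mapP[b /Hs[d Hd] ->]; exists d; apply: N.
  - exists (s ++ t); split; last by rewrite big_cat.
    by move=> e; rewrite mem_cat => /orP[/Hs|/Ht].
  exists [seq x * y | x <- s, y <- t]; split.
    move=> _ /allpairsP[[x y] /= [/Hs[d Hd] /Ht[e He] ->]].
    by exists (d + e); apply: lv_degM.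
  by rewrite big_allpairs_dep mulr_suml; apply: eq_bigr => x _; rewrite mulr_sumr.
pose u (k : int) : L := if k == 0 then 1 else 0.
have : lv_actL (\sum_(e <- s) c e) u d = 0 by rewrite Hs lv_actL0.
rewrite (big_morph (fun z => lv_actL z u d) (fun z w => lv_actLD z w u d)
  (lv_actL0 u d)).
under eq_bigr do rewrite (lv_actL_deg (Hc _)).
rewrite (bigD1_seq d) //= subrr {1}/u eqxx mulr1 big1 ?addr0 // => e ne.
by rewrite /u subr_eq0 eq_sym (negPf ne) mulr0.
Qed.

Lemma lv_deg1 : lv_deg 0 (1 : L).
Proof. by rewrite -lv_scalar1; constructor. Qed.

Definition leavitt_graded : graded_ring :=
  @GradedRing L (@lv_deg R M) lv_grading lv_deg1 (@lv_degM R M).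

End LeavittGrading.

Section ModuleCategory.
Variable R : pzRingType.

Record fp_module := FpModule {
  fp_car :> lmodType R;
  fp_fin_pres : fin_pres fp_car
}.

Program Definition mod_cat : category :=
  @Category fp_module (fun X Y => {linear X -> Y}) (fun _ _ f g => f =1 g)
    (fun X => idfun) (fun _ _ _ g f => g \o f) _ _ _ _ _ _ _.
Next Obligation. by []. Qed.
Next Obligation. exact: fsym. Qed.
Next Obligation. exact: ftrans H H0. Qed.
Next Obligation. by move=> x /=; rewrite H0 H. Qed.
Next Obligation. by []. Qed.
Next Obligation. by []. Qed.
Next Obligation. by []. Qed.

Definition stable_rel (X Y : mod_cat) (f g : hom X Y) : Prop :=
  exists (P : lmodType R) (u : {linear X -> P}) (v : {linear P -> Y}),
    fg_proj P /\ forall x, f x - g x = v (u x).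

Program Definition stable_cong : congruence mod_cat :=
  @Congruence mod_cat stable_rel _ _ _ _.
Next Obligation.
exists 'rV[R]_0, \0, \0; split=> [|x /=]; first exact: fg_proj_row.
by rewrite H subrr.
Qed.
Next Obligation.
case: H => P [u [v [HP E]]]; exists P, u, (\- v); split=> // x /=.
by rewrite -E opprB.
Qed.
Next Obligation.
case: H => P [u [v [HP E]]]; case: H0 => P' [u' [v' [HP' E']]].
have [w Hw] : exists w : {linear X -> (P * P')%type}, forall x, w x = (u x, u' x).
  by apply: exists_linear => a x y; rewrite !linearP.
have [w' Hw'] : exists w : {linear (P * P')%type -> Y},
    forall z, w z = v z.1 + v' z.2.
  by apply: exists_linear => a x y /=; rewrite !linearP /= scalerDr addrACA.
exists (P * P')%type, w, w'; split=> [|x]; first exact: fg_proj_sum.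
by rewrite Hw Hw' /= -E -E' addrA subrK.
Qed.
Next Obligation.
case: H => P [u [v [HP E]]]; case: H0 => P' [u' [v' [HP' E']]].
have [w Hw] : exists w : {linear X -> (P * P')%type},
    forall x, w x = (u (f x), u' x).
  by apply: exists_linear => a x y; rewrite !linearP.
have [w' Hw'] : exists w : {linear (P * P')%type -> Z},
    forall z, w z = v z.1 + g' (v' z.2).
  by apply: exists_linear => a x y /=; rewrite !linearP /= scalerDr addrACA.
exists (P * P')%type, w, w'; split=> [|x /=]; first exact: fg_proj_sum.
by rewrite Hw Hw' /= -E -E' linearB /= addrA subrK.
Qed.

Definition stmod_cat : category := quot_cat stable_cong.

Variable M : bimodType R.
Hypothesis HM : fg_proj M.

Definition tensor_fp (X : fp_module) : fp_module :=
  FpModule (tensor_fin_pres HM (fp_fin_pres X)).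

Program Definition tensor_functor : functor mod_cat mod_cat :=
  @Functor mod_cat mod_cat tensor_fp (fun X Y f => tensor_map M f) _ _ _.
Next Obligation.
apply: linear_tensor_ext => m x; by rewrite !tensor_mapE H.
Qed.
Next Obligation.
apply: (@linear_tensor_ext R M X (tensor M X) _ idfun) => m x.
by rewrite tensor_mapE.
Qed.
Next Obligation.
apply: (@linear_tensor_ext R M X (tensor M Z) _
  (tensor_map M g \o tensor_map M f)) => m x.
by rewrite /= !tensor_mapE.
Qed.

Lemma tensor_stable : preserves_cong stable_cong stable_cong tensor_functor.
Proof.
move=> X Y f g [P [u [v [HP E]]]].
exists (tensor M P), (tensor_map M u), (tensor_map M v).
split; first exact: tensor_fg_proj.
apply: (@linear_tensor_ext R M X (tensor M Y)
  (tensor_map M f \- tensor_map M g) (tensor_map M v \o tensor_map M u)) => m x.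
rewrite /= !tensor_mapE -E; apply/eqP; rewrite subr_eq; apply/eqP.
by rewrite -tensDr subrK.
Qed.

Definition stable_tensor_functor : functor stmod_cat stmod_cat :=
  quot_functor tensor_stable.

End ModuleCategory.

Section GradedModuleCategory.
Variable G : graded_ring.

(* A graded module is a module with an internal grading; it is finitely
   presented, or finitely generated projective, when the underlying ungraded
   module is. *)
Record graded_module := GradedModule {
  gm_car :> lmodType G;
  mdeg : int -> gm_car -> Prop;
  mdeg_grading : is_grading mdeg;
  mdegZ : forall d e (a : G) x, rdeg d a -> mdeg e x -> mdeg (d + e) (a *: x)
}.

Record graded_hom (X Y : graded_module) := GradedHom {
  gh_fun :> {linear X -> Y};
  gh_deg : forall d x, mdeg d x -> mdeg d (gh_fun x)
}.

Record fp_graded_module := FpGradedModule {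
  fpg_car :> graded_module;
  fpg_fin_pres : fin_pres fpg_car
}.

Definition graded_id (X : graded_module) : graded_hom X X :=
  @GradedHom X X idfun (fun _ _ H => H).

Definition graded_comp (X Y Z : graded_module) (g : graded_hom Y Z)
    (f : graded_hom X Y) : graded_hom X Z :=
  @GradedHom X Z (gh_fun g \o gh_fun f)
    (fun _ _ H => gh_deg g (gh_deg f H)).

Program Definition grmod_cat : category :=
  @Category fp_graded_module (fun X Y => graded_hom X Y)
    (fun _ _ f g => f =1 g) (fun X => graded_id X)
    (fun _ _ _ g f => graded_comp g f) _ _ _ _ _ _ _.
Next Obligation. by []. Qed.
Next Obligation. exact: fsym. Qed.
Next Obligation. exact: ftrans H H0. Qed.
Next Obligation. by move=> x /=; rewrite H0 H. Qed.
Next Obligation. by []. Qed.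
Next Obligation. by []. Qed.
Next Obligation. by []. Qed.

Section DirectSum.
Variables P Q : graded_module.

Definition sum_deg (d : int) (z : (P * Q)%type) : Prop :=
  mdeg d z.1 /\ mdeg d z.2.

Lemma sum_grading : is_grading sum_deg.
Proof.
have gP := mdeg_grading P; have gQ := mdeg_grading Q.
split=> [d|d a b [a1 a2] [b1 b2]|[x y]|s c us Hc Hs d ds].
- by split; apply: gr_zero.
- by split; apply: gr_sub.
- have [s [Hs Es]] := gr_gen gP x; have [t [Ht Et]] := gr_gen gQ y.
  exists ([seq (p, 0) | p <- s] ++ [seq (0, q) | q <- t]); split.
    move=> z; rewrite mem_cat => /orP[/mapP[p /Hs[d Hd] ->]|/mapP[q /Ht[d Hd] ->]];
      by exists d; split=> //=; apply: gr_zero.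
  rewrite big_cat !big_map /= Es Et.
  have -> : \sum_(p <- s) (p, 0 : Q) = (\sum_(p <- s) p, 0 : Q).
    elim: (s) => [|p s' IH]; first by rewrite !big_nil.
    by rewrite !big_cons IH; congr pair; rewrite /= addr0.
  have -> : \sum_(q <- t) (0 : P, q) = (0 : P, \sum_(q <- t) q).
    elim: (t) => [|q t' IH]; first by rewrite !big_nil.
    by rewrite !big_cons IH; congr pair; rewrite /= addr0.
  by congr pair; rewrite /= ?addr0 ?add0r.
have E1 : \sum_(e <- s) (c e).1 = 0 by rewrite -(raddf_sum fst) Hs.
have E2 : \sum_(e <- s) (c e).2 = 0 by rewrite -(raddf_sum snd) Hs.
rewrite [c d]surjective_pairing.
rewrite (gr_indep gP us (fun e => (Hc e).1) E1 ds).
by rewrite (gr_indep gQ us (fun e => (Hc e).2) E2 ds).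
Qed.

Lemma sum_degZ d e (a : G) z : rdeg d a -> sum_deg e z -> sum_deg (d + e) (a *: z).
Proof. by move=> Ha [z1 z2]; split; apply: mdegZ. Qed.

Definition graded_sum : graded_module := GradedModule sum_grading sum_degZ.

Definition graded_pair (X : graded_module) (f : graded_hom X P)
    (g : graded_hom X Q) :
  exists h : graded_hom X graded_sum, forall x, h x = (f x, g x).
Proof.
have [h Hh] : exists h : {linear X -> (P * Q)%type}, forall x, h x = (f x, g x).
  by apply: exists_linear => a x y; rewrite !linearP.
have Dh d x : mdeg d x -> sum_deg d (h x).
  by move=> Hx; rewrite Hh; split; apply: gh_deg.
by exists (@GradedHom X graded_sum h Dh).
Qed.

Definition graded_copair (Y : graded_module) (f : graded_hom P Y)
    (g : graded_hom Q Y) :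
  exists h : graded_hom graded_sum Y, forall z, h z = f z.1 + g z.2.
Proof.
have [h Hh] : exists h : {linear (P * Q)%type -> Y},
    forall z, h z = f z.1 + g z.2.
  by apply: exists_linear => a x y /=; rewrite !linearP /= scalerDr addrACA.
have Dh d (z : graded_sum) : mdeg d z -> mdeg d (h z).
  case=> H1 H2; rewrite Hh -[g _]opprK -[- g _]sub0r.
  have gY := mdeg_grading Y.
  by apply: (gr_sub gY); [|apply: (gr_sub gY); [exact: gr_zero|]]; apply: gh_deg.
by exists (@GradedHom graded_sum Y h Dh).
Qed.

End DirectSum.

Definition graded_stable_rel (X Y : grmod_cat) (f g : hom X Y) : Prop :=
  exists (P : graded_module) (u : graded_hom X P) (v : graded_hom P Y),
    fg_proj P /\ forall x, f x - g x = v (u x).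

Program Definition graded_stable_cong : congruence grmod_cat :=
  @Congruence grmod_cat graded_stable_rel _ _ _ _.
Next Obligation.
have gr0 : is_grading (fun (_ : int) (_ : 'rV[G]_0) => True).
  split=> // [a|s c _ _ _ d _]; first by exists [::]; rewrite big_nil thinmx0.
  by apply/rowP; case.
pose P := @GradedModule 'rV[G]_0 _ gr0 (fun _ _ _ _ _ _ => I).
pose u := @GradedHom X P \0 (fun _ _ _ => I).
pose v := @GradedHom P Y \0 (fun d _ _ => gr_zero (mdeg_grading Y) d).
exists P, u, v; split=> [|x /=]; first exact: fg_proj_row.
by rewrite H subrr.
Qed.
Next Obligation.
case: H => P [u [v [HP E]]].
have D d x : mdeg d x -> mdeg d ((\- v) x).
  move=> Hx /=; rewrite -sub0r; apply: (gr_sub (mdeg_grading Y)).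
    exact: (gr_zero (mdeg_grading Y)).
  exact: gh_deg.
exists P, u, (@GradedHom P Y (\- v) D); split=> // x /=.
by rewrite -E opprB.
Qed.
Next Obligation.
case: H => P [u [v [HP E]]]; case: H0 => P' [u' [v' [HP' E']]].
have [w Hw] := graded_pair u u'; have [w' Hw'] := graded_copair v v'.
exists (graded_sum P P'), w, w'; split=> [|x]; first exact: fg_proj_sum.
by rewrite Hw Hw' /= -E -E' addrA subrK.
Qed.
Next Obligation.
case: H => P [u [v [HP E]]]; case: H0 => P' [u' [v' [HP' E']]].
have [w Hw] := graded_pair (graded_comp u f) u'.
have [w' Hw'] := graded_copair v (graded_comp g' v').
exists (graded_sum P P'), w, w'; split=> [|x /=]; first exact: fg_proj_sum.
by rewrite Hw Hw' /= -E -E' linearB /= addrA subrK.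
Qed.

Definition stgrmod_cat : category := quot_cat graded_stable_cong.

End GradedModuleCategory.

(* Main.v *)
From HB Require Import structures.
From mathcomp Require Import all_boot all_algebra.
From mathcomp Require Import boolp zify.
Require Import Defs.

(* Write L = L_R(M) and T X = L (x)_R X.  The relations of L say exactly that a
   graded L-module N satisfies N_d = Hom_R(M, N_(d-1)) via the action of M, so
   an L-linear map out of T X is determined by, and can be prescribed by, its
   restriction along M^a (x) X -> T X for any a.  The functor sends (X, n) to
   T X with the grading shifted by n, and [f; p] with f : M^a (x) X -> M^b (x) Y
   to the L-linear map extending f.

   Faithfulness: T Y maps to a module of germs of sequences in Hom(M^p, M^q (x) Y),
   so an element of M^b (x) Y which vanishes in T Y is killed by M^p for p large;
   finitely generated X allows a uniform p.  Fullness: if v in T Y has degree d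
   then M^p v lies in the image of M^(p-d) (x) Y for p large, so a graded map is
   defined on M^p (x) X up to a kernel, which disappears after tensoring further
   because X is finitely presented.  Essential surjectivity: homogeneous
   generators and relations of a finitely presented N can all be moved to one
   sufficiently negative degree, since v = sum_j a_j^* (a_j v).

   In the stable case, a map factoring through a graded projective module also
   factors through some T(R^k), hence at a finite level through M^c (x) R^k. *)

Set Implicit Arguments.
Unset Strict Implicit.
Unset Printing Implicit Defensive.

Import GRing.Theory.
Local Open Scope ring_scope.
Local Open Scope quotient_scope.

(** * Module constructions *)

(** Degrees explain the shifts: M has degree -1, so M^a (x) X maps to degree -a of T X, and to
    degree -(n + a) = -p once T X is shifted by n. Thus [f; p] prescribes a graded map in degree -p,
    and the level condition of a representative says exactly that its source and target meet there.
    The obstacle is that X -> T X need not be injective (for M = 0 the Casimir relation gives L = 0)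
    and that L is known only by generators and relations, without normal forms. Vanishing and
    homogeneity in T X are therefore detected by L-linear maps to modules built by hand: germs of
    sequences, whose kernel is explicit, and sequences indexed by the integers, which separate
    degrees. Both come from [leavitt_module], which turns actions of M and M^* on an R-module into
    an L-module. Finiteness enters through levels: a statement about one element of T X holds from
    some tensor power on, and finitely many generators or relations give a common power. *)

Section DependentProduct.
Variables (R : pzRingType) (I : Type) (V : I -> lmodType R).

Definition dprod : Type := forall i, V i.
HB.instance Definition _ := gen_eqMixin dprod.
HB.instance Definition _ := gen_choiceMixin dprod.

Lemma dprodP (u v : dprod) : (forall i, u i = v i) -> u = v.
Proof. exact: functional_extensionality_dep. Qed.

Definition dprod_add (u v : dprod) : dprod := fun i => u i + v i.
Definition dprod_opp (u : dprod) : dprod := fun i => - u i.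
Definition dprod_zero : dprod := fun i => 0.
Definition dprod_scale (r : R) (u : dprod) : dprod := fun i => r *: u i.

Lemma dprod_addA : associative dprod_add.
Proof. by move=> u v w; apply: dprodP => i; apply: addrA. Qed.
Lemma dprod_addC : commutative dprod_add.
Proof. by move=> u v; apply: dprodP => i; apply: addrC. Qed.
Lemma dprod_add0 : left_id dprod_zero dprod_add.
Proof. by move=> u; apply: dprodP => i; apply: add0r. Qed.
Lemma dprod_addN : left_inverse dprod_zero dprod_opp dprod_add.
Proof. by move=> u; apply: dprodP => i; apply: addNr. Qed.
HB.instance Definition _ := GRing.isZmodule.Build dprod
  dprod_addA dprod_addC dprod_add0 dprod_addN.

Lemma dprod_scaleA r s u : dprod_scale r (dprod_scale s u) = dprod_scale (r * s) u.
Proof. by apply: dprodP => i; apply: scalerA. Qed.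
Lemma dprod_scale1 : left_id 1 dprod_scale.
Proof. by move=> u; apply: dprodP => i; apply: scale1r. Qed.
Lemma dprod_scaleDr : right_distributive dprod_scale +%R.
Proof. by move=> r u v; apply: dprodP => i; apply: scalerDr. Qed.
Lemma dprod_scaleDl u : {morph dprod_scale^~ u : r s / r + s}.
Proof. by move=> r s; apply: dprodP => i; apply: scalerDl. Qed.
HB.instance Definition _ := GRing.Zmodule_isLmodule.Build R dprod
  dprod_scaleA dprod_scale1 dprod_scaleDr dprod_scaleDl.

Lemma dprodDE (u v : dprod) i : (u + v) i = u i + v i. Proof. by []. Qed.
Lemma dprodZE r (u : dprod) i : (r *: u) i = r *: u i. Proof. by []. Qed.
Lemma dprodNE (u : dprod) i : (- u) i = - u i. Proof. by []. Qed.

End DependentProduct.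

(** * Submodules, quotients and induced maps *)

Section QuotientModule.
Variables (A : pzRingType) (V : lmodType A).

Record submodule := Submodule {
  sub_mem :> V -> Prop;
  sub_mem0 : sub_mem 0;
  sub_memP : forall a x y, sub_mem x -> sub_mem y -> sub_mem (a *: x + y)
}.

Variable S : submodule.

Lemma sub_memN x : S x -> S (- x).
Proof. by move=> Sx; rewrite -[- x]addr0 -scaleN1r; apply: sub_memP => //; apply: sub_mem0. Qed.
Lemma sub_memD x y : S x -> S y -> S (x + y).
Proof. by move=> Sx Sy; rewrite -[x]scale1r; apply: sub_memP. Qed.
Lemma sub_memZ a x : S x -> S (a *: x).
Proof. by move=> Sx; rewrite -[_ *: _]addr0; apply: sub_memP => //; apply: sub_mem0. Qed.

Definition qm_relb : rel V := fun x y => `[< S (x - y) >].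

Lemma qm_relb_refl : reflexive qm_relb.
Proof. by move=> x; apply/asboolP; rewrite subrr; apply: sub_mem0. Qed.
Lemma qm_relb_sym : symmetric qm_relb.
Proof. by move=> x y; apply/asboolP/asboolP => /sub_memN; rewrite opprB. Qed.
Lemma qm_relb_trans : transitive qm_relb.
Proof.
move=> y x z /asboolP H1 /asboolP H2; apply/asboolP.
by have := sub_memD H1 H2; rewrite addrA subrK.
Qed.

Canonical qm_equiv := EquivRel qm_relb qm_relb_refl qm_relb_sym qm_relb_trans.

Definition quot_mod : Type := {eq_quot qm_equiv}.
HB.instance Definition _ := Choice.copy quot_mod {eq_quot qm_equiv}.

Definition qm_pi (x : V) : quot_mod := \pi_{eq_quot qm_equiv} x.
Definition qm_repr (z : quot_mod) : V := repr (z : {eq_quot qm_equiv}).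

Lemma qm_reprK z : qm_pi (qm_repr z) = z.
Proof. exact: reprK. Qed.

Lemma qm_piP x y : qm_pi x = qm_pi y <-> S (x - y).
Proof.
split=> [/eqP|H]; first by rewrite eqmodE => /asboolP.
by apply/eqP; rewrite eqmodE; apply/asboolP.
Qed.

Lemma qm_repr_pi x : S (qm_repr (qm_pi x) - x).
Proof. by apply/qm_piP; rewrite qm_reprK. Qed.

Definition qm_add (z w : quot_mod) : quot_mod := qm_pi (qm_repr z + qm_repr w).
Definition qm_opp (z : quot_mod) : quot_mod := qm_pi (- qm_repr z).
Definition qm_scale a (z : quot_mod) : quot_mod := qm_pi (a *: qm_repr z).

Lemma qm_addE x y : qm_add (qm_pi x) (qm_pi y) = qm_pi (x + y).
Proof. by apply/qm_piP; rewrite opprD addrACA; apply: sub_memD; apply: qm_repr_pi. Qed.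
Lemma qm_oppE x : qm_opp (qm_pi x) = qm_pi (- x).
Proof. by apply/qm_piP; rewrite -opprD; apply/sub_memN/qm_repr_pi. Qed.
Lemma qm_scaleE a x : qm_scale a (qm_pi x) = qm_pi (a *: x).
Proof. by apply/qm_piP; rewrite -scalerBr; apply/sub_memZ/qm_repr_pi. Qed.

Lemma qm_addA : associative qm_add.
Proof.
move=> x y z; rewrite -(qm_reprK x) -(qm_reprK y) -(qm_reprK z).
by rewrite !qm_addE addrA.
Qed.
Lemma qm_addC : commutative qm_add.
Proof. by move=> x y; rewrite /qm_add addrC. Qed.
Lemma qm_add0 : left_id (qm_pi 0) qm_add.
Proof. by move=> x; rewrite -(qm_reprK x) qm_addE add0r. Qed.
Lemma qm_addN : left_inverse (qm_pi 0) qm_opp qm_add.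
Proof. by move=> x; rewrite -(qm_reprK x) qm_oppE qm_addE addNr. Qed.
HB.instance Definition _ := GRing.isZmodule.Build quot_mod
  qm_addA qm_addC qm_add0 qm_addN.

Lemma qm_scaleA a b x : qm_scale a (qm_scale b x) = qm_scale (a * b) x.
Proof. by rewrite -(qm_reprK x) !qm_scaleE scalerA. Qed.
Lemma qm_scale1 : left_id 1 qm_scale.
Proof. by move=> x; rewrite -(qm_reprK x) qm_scaleE scale1r. Qed.
Lemma qm_scaleDr : right_distributive qm_scale +%R.
Proof.
move=> a x y; rewrite -(qm_reprK x) -(qm_reprK y) [_ + _]qm_addE !qm_scaleE.
by rewrite scalerDr [RHS]qm_addE.
Qed.
Lemma qm_scaleDl x : {morph qm_scale^~ x : a b / a + b}.
Proof.
move=> a b /=; rewrite -(qm_reprK x) !qm_scaleE.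
by rewrite scalerDl [RHS]qm_addE.
Qed.
HB.instance Definition _ := GRing.Zmodule_isLmodule.Build A quot_mod
  qm_scaleA qm_scale1 qm_scaleDr qm_scaleDl.

Lemma qm_pi_is_linear : linear qm_pi.
Proof. by move=> a x y; rewrite [a *: qm_pi x]qm_scaleE [RHS]qm_addE. Qed.
HB.instance Definition _ := GRing.isLinear.Build A V quot_mod *:%R qm_pi qm_pi_is_linear.

Lemma qm_pi_eq0 x : qm_pi x = 0 <-> S x.
Proof. by rewrite -[0]/(qm_pi 0) qm_piP subr0. Qed.

End QuotientModule.

Lemma image_submodule (A : pzRingType) (V W : lmodType A) (f : {linear V -> W}) :
  exists S : submodule W, forall w, S w <-> exists v, w = f v.
Proof.
have H0 : exists v, 0 = f v by exists 0; rewrite linear0.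
have HP a x y : (exists v, x = f v) -> (exists v, y = f v) ->
    exists v, a *: x + y = f v.
  by case=> v -> [v' ->]; exists (a *: v + v'); rewrite linearP.
by exists (Submodule H0 HP).
Qed.

Lemma bijective_linear (A : pzRingType) (V W : lmodType A) (f : {linear V -> W}) :
  (forall x, f x = 0 -> x = 0) -> (forall y, exists x, f x = y) ->
  exists g : {linear W -> V}, cancel f g /\ cancel g f.
Proof.
move=> f_inj /choice[s Hs].
have inj x y : f x = f y -> x = y.
  by move=> E; apply/eqP; rewrite -subr_eq0; apply/eqP/f_inj; rewrite linearB /= E subrr.
have [g Hg] : exists g : {linear W -> V}, forall y, g y = s y.
  by apply: exists_linear => a x y; apply: inj; rewrite linearP /= !Hs.
by exists g; split=> x; rewrite ?Hg; [apply: inj|]; rewrite Hs.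
Qed.

Lemma linear_surj_lift (A : pzRingType) (U V W : lmodType A) (p : {linear U -> V})
    (f : {linear U -> W}) :
  (forall v, exists u, p u = v) -> (forall u, p u = 0 -> f u = 0) ->
  exists g : {linear V -> W}, forall u, g (p u) = f u.
Proof.
move=> /choice[s Hs] H.
have E u v : p u = p v -> f u = f v.
  move=> E; apply/eqP; rewrite -subr_eq0 -linearB; apply/eqP/H.
  by rewrite linearB /= E subrr.
have [g Hg] : exists g : {linear V -> W}, forall y, g y = f (s y).
  by apply: exists_linear => a x y; rewrite -linearP; apply: E; rewrite linearP /= !Hs.
by exists g => u; rewrite Hg; apply: E; rewrite Hs.
Qed.

(** * Modules as ring homomorphisms to additive endomorphisms *)

Section EndomorphismRing.
Variable V : zmodType.

(** Additive rather than R-linear maps: the elements of L, and already those of R, do not act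
    R-linearly in general. *)
Definition endo : Type := {f : V -> V | zmod_morphism f}.
HB.instance Definition _ := gen_eqMixin endo.
HB.instance Definition _ := gen_choiceMixin endo.

Lemma endoP (f g : endo) : (forall v, sval f v = sval g v) -> f = g.
Proof.
case: f g => [f Hf] [g Hg] /= /funext E; subst g; congr exist.
exact: Prop_irrelevance.
Qed.

Lemma endo_subD (f : V -> V) : (forall x y, f (x + y) = f x + f y) -> zmod_morphism f.
Proof.
move=> fD x y; apply: (@addIr _ (f y)); by rewrite -fD !subrK.
Qed.
Lemma endoD (f : endo) x y : sval f (x + y) = sval f x + sval f y.
Proof.
have f0 : sval f 0 = 0 by have := svalP f 0 0; rewrite !subrr.
have fN z : sval f (- z) = - sval f z by rewrite -[- z]sub0r (svalP f) f0 sub0r.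
by rewrite -[in LHS](opprK y) (svalP f) fN opprK.
Qed.

Lemma endo_add_subproof (f g : endo) : zmod_morphism (fun v => sval f v + sval g v).
Proof. by apply: endo_subD => x y; rewrite !endoD addrACA. Qed.
Lemma endo_opp_subproof (f : endo) : zmod_morphism (fun v => - sval f v).
Proof. by apply: endo_subD => x y; rewrite endoD opprD. Qed.
Lemma endo_zero_subproof : zmod_morphism (fun _ : V => 0 : V).
Proof. by move=> x y; rewrite subr0. Qed.
Lemma endo_one_subproof : zmod_morphism (fun v : V => v).
Proof. by []. Qed.
Lemma endo_mul_subproof (f g : endo) : zmod_morphism (fun v => sval f (sval g v)).
Proof. by apply: endo_subD => x y; rewrite !endoD. Qed.

Definition endo_add (f g : endo) : endo := exist _ _ (endo_add_subproof f g).
Definition endo_opp (f : endo) : endo := exist _ _ (endo_opp_subproof f).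
Definition endo_zero : endo := exist _ _ endo_zero_subproof.
Definition endo_one : endo := exist _ _ endo_one_subproof.
Definition endo_mul (f g : endo) : endo := exist _ _ (endo_mul_subproof f g).

Lemma endo_addA : associative endo_add.
Proof. by move=> f g h; apply: endoP => v /=; rewrite addrA. Qed.
Lemma endo_addC : commutative endo_add.
Proof. by move=> f g; apply: endoP => v /=; rewrite addrC. Qed.
Lemma endo_add0 : left_id endo_zero endo_add.
Proof. by move=> f; apply: endoP => v /=; rewrite add0r. Qed.
Lemma endo_addN : left_inverse endo_zero endo_opp endo_add.
Proof. by move=> f; apply: endoP => v /=; rewrite addNr. Qed.
Lemma endo_mulA : associative endo_mul.
Proof. by move=> f g h; apply: endoP. Qed.
Lemma endo_mul1l : left_id endo_one endo_mul.
Proof. by move=> f; apply: endoP. Qed.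
Lemma endo_mul1r : right_id endo_one endo_mul.
Proof. by move=> f; apply: endoP. Qed.
Lemma endo_mulDl : left_distributive endo_mul endo_add.
Proof. by move=> f g h; apply: endoP. Qed.
Lemma endo_mulDr : right_distributive endo_mul endo_add.
Proof. by move=> f g h; apply: endoP => v /=; rewrite endoD. Qed.
HB.instance Definition _ := GRing.isPzRing.Build endo
  endo_addA endo_addC endo_add0 endo_addN
  endo_mulA endo_mul1l endo_mul1r endo_mulDl endo_mulDr.

Lemma endoDE (f g : endo) v : sval (f + g) v = sval f v + sval g v. Proof. by []. Qed.
Lemma endoME (f g : endo) v : sval (f * g) v = sval f (sval g v). Proof. by []. Qed.
Lemma endo_sumE I (s : seq I) (F : I -> endo) v :
  sval (\sum_(i <- s) F i) v = \sum_(i <- s) sval (F i) v.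
Proof. exact: (big_morph (fun f => sval f v)). Qed.

Variables (A : pzRingType) (rho : {rmorphism A -> endo}).

(** The dummy [let] makes the type depend on [rho], so that V can carry one module structure for
    each representation. [res] uses the same device for [phi]. *)
Definition rep_mod : Type := let _ := rho in V.
HB.instance Definition _ := GRing.Zmodule.copy rep_mod V.

Definition rep_scale (a : A) (v : rep_mod) : rep_mod := sval (rho a) v.

Lemma rep_scaleA a b v : rep_scale a (rep_scale b v) = rep_scale (a * b) v.
Proof. by rewrite /rep_scale rmorphM. Qed.
Lemma rep_scale1 : left_id 1 rep_scale.
Proof. by move=> v; rewrite /rep_scale rmorph1. Qed.
Lemma rep_scaleDr : right_distributive rep_scale +%R.
Proof. by move=> a v w; rewrite /rep_scale endoD. Qed.
Lemma rep_scaleDl v : {morph rep_scale^~ v : a b / a + b}.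
Proof. by move=> a b; rewrite /rep_scale rmorphD. Qed.
HB.instance Definition _ := GRing.Zmodule_isLmodule.Build A rep_mod
  rep_scaleA rep_scale1 rep_scaleDr rep_scaleDl.

End EndomorphismRing.

(** * Change of scalars *)

Section RestrictionOfScalars.
Variables (R A : pzRingType) (phi : {rmorphism R -> A}) (N : lmodType A).

Definition res : Type := let _ := phi in N.
HB.instance Definition _ := GRing.Zmodule.copy res N.

Definition res_scale (r : R) (v : res) : res := phi r *: (v : N).

Lemma res_scaleA r s v : res_scale r (res_scale s v) = res_scale (r * s) v.
Proof. by rewrite /res_scale scalerA rmorphM. Qed.
Lemma res_scale1 : left_id 1 res_scale.
Proof. by move=> v; rewrite /res_scale rmorph1 scale1r. Qed.
Lemma res_scaleDr : right_distributive res_scale +%R.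
Proof. by move=> a v w; rewrite /res_scale scalerDr. Qed.
Lemma res_scaleDl v : {morph res_scale^~ v : a b / a + b}.
Proof. by move=> a b; rewrite /res_scale rmorphD scalerDl. Qed.
HB.instance Definition _ := GRing.Zmodule_isLmodule.Build R res
  res_scaleA res_scale1 res_scaleDr res_scaleDl.

Lemma resZE r (v : res) : r *: v = phi r *: (v : N) :> N. Proof. by []. Qed.

End RestrictionOfScalars.

Section ExtensionOfScalars.
Variables (R A : pzRingType) (phi : {rmorphism R -> A}) (X : lmodType R).

(* A (x)_R X presented as an A-module; the tensor product of Defs only carries
   the scalars R. *)
Inductive ext_term : Type :=
  | ExtZero
  | ExtOpp of ext_term
  | ExtAdd of ext_term & ext_term
  | ExtScale of A & ext_term
  | ExtGen of X.

Inductive ext_rel : ext_term -> ext_term -> Prop :=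
  | ext_refl s : ext_rel s s
  | ext_sym s t : ext_rel s t -> ext_rel t s
  | ext_trans s t u : ext_rel s t -> ext_rel t u -> ext_rel s u
  | ext_opp s t : ext_rel s t -> ext_rel (ExtOpp s) (ExtOpp t)
  | ext_add s s' t t' : ext_rel s s' -> ext_rel t t' ->
      ext_rel (ExtAdd s t) (ExtAdd s' t')
  | ext_scale a s t : ext_rel s t -> ext_rel (ExtScale a s) (ExtScale a t)
  | ext_addA s t u : ext_rel (ExtAdd s (ExtAdd t u)) (ExtAdd (ExtAdd s t) u)
  | ext_addC s t : ext_rel (ExtAdd s t) (ExtAdd t s)
  | ext_add0 s : ext_rel (ExtAdd ExtZero s) s
  | ext_addN s : ext_rel (ExtAdd (ExtOpp s) s) ExtZero
  | ext_scaleA a b s :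
      ext_rel (ExtScale a (ExtScale b s)) (ExtScale (a * b) s)
  | ext_scale1 s : ext_rel (ExtScale 1 s) s
  | ext_scaleDr a s t :
      ext_rel (ExtScale a (ExtAdd s t)) (ExtAdd (ExtScale a s) (ExtScale a t))
  | ext_scaleDl a b s :
      ext_rel (ExtScale (a + b) s) (ExtAdd (ExtScale a s) (ExtScale b s))
  | ext_genD x y : ext_rel (ExtGen (x + y)) (ExtAdd (ExtGen x) (ExtGen y))
  | ext_genZ r x : ext_rel (ExtGen (r *: x)) (ExtScale (phi r) (ExtGen x)).

HB.instance Definition _ := gen_eqMixin ext_term.
HB.instance Definition _ := gen_choiceMixin ext_term.

Definition ext_relb : rel ext_term := fun s t => `[< ext_rel s t >].

Lemma ext_relb_refl : reflexive ext_relb.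
Proof. by move=> s; apply/asboolP; apply: ext_refl. Qed.
Lemma ext_relb_sym : symmetric ext_relb.
Proof. by move=> s t; apply/asboolP/asboolP; apply: ext_sym. Qed.
Lemma ext_relb_trans : transitive ext_relb.
Proof.
move=> t s u /asboolP H1 /asboolP H2; apply/asboolP; exact: ext_trans H1 H2.
Qed.

Canonical ext_equiv :=
  EquivRel ext_relb ext_relb_refl ext_relb_sym ext_relb_trans.

Definition ext_mod : Type := {eq_quot ext_equiv}.
HB.instance Definition _ := Choice.copy ext_mod {eq_quot ext_equiv}.

Definition ext_pi (s : ext_term) : ext_mod := \pi_{eq_quot ext_equiv} s.
Definition ext_repr (z : ext_mod) : ext_term := repr (z : {eq_quot ext_equiv}).

Lemma ext_reprK z : ext_pi (ext_repr z) = z.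
Proof. exact: reprK. Qed.

Lemma ext_piP s t : ext_pi s = ext_pi t <-> ext_rel s t.
Proof.
split=> [/eqP|H]; first by rewrite eqmodE => /asboolP.
by apply/eqP; rewrite eqmodE; apply/asboolP.
Qed.

Lemma ext_repr_pi s : ext_rel (ext_repr (ext_pi s)) s.
Proof. by apply/ext_piP; rewrite ext_reprK. Qed.

Definition em_add (z w : ext_mod) : ext_mod :=
  ext_pi (ExtAdd (ext_repr z) (ext_repr w)).
Definition em_opp (z : ext_mod) : ext_mod := ext_pi (ExtOpp (ext_repr z)).
Definition em_scale a (z : ext_mod) : ext_mod := ext_pi (ExtScale a (ext_repr z)).

Lemma em_addE s t : em_add (ext_pi s) (ext_pi t) = ext_pi (ExtAdd s t).
Proof. by apply/ext_piP; apply: ext_add; apply: ext_repr_pi. Qed.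
Lemma em_oppE s : em_opp (ext_pi s) = ext_pi (ExtOpp s).
Proof. by apply/ext_piP; apply: ext_opp; apply: ext_repr_pi. Qed.
Lemma em_scaleE a s : em_scale a (ext_pi s) = ext_pi (ExtScale a s).
Proof. by apply/ext_piP; apply: ext_scale; apply: ext_repr_pi. Qed.

Lemma em_addA : associative em_add.
Proof.
move=> x y z; rewrite -(ext_reprK x) -(ext_reprK y) -(ext_reprK z).
by rewrite !em_addE; apply/ext_piP; apply: ext_addA.
Qed.
Lemma em_addC : commutative em_add.
Proof. by move=> x y; apply/ext_piP; apply: ext_addC. Qed.
Lemma em_add0 : left_id (ext_pi ExtZero) em_add.
Proof.
by move=> x; rewrite -(ext_reprK x) em_addE; apply/ext_piP; apply: ext_add0.
Qed.
Lemma em_addN : left_inverse (ext_pi ExtZero) em_opp em_add.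
Proof.
move=> x; rewrite -(ext_reprK x) em_oppE em_addE; apply/ext_piP.
exact: ext_addN.
Qed.
HB.instance Definition _ := GRing.isZmodule.Build ext_mod
  em_addA em_addC em_add0 em_addN.

Lemma em_scaleA a b x : em_scale a (em_scale b x) = em_scale (a * b) x.
Proof.
rewrite -(ext_reprK x) !em_scaleE; apply/ext_piP; exact: ext_scaleA.
Qed.
Lemma em_scale1 : left_id 1 em_scale.
Proof.
by move=> x; rewrite -(ext_reprK x) em_scaleE; apply/ext_piP; apply: ext_scale1.
Qed.
Lemma em_scaleDr : right_distributive em_scale +%R.
Proof.
move=> a x y; rewrite -(ext_reprK x) -(ext_reprK y).
rewrite [_ + _]em_addE !em_scaleE [RHS]em_addE; apply/ext_piP.
exact: ext_scaleDr.
Qed.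
Lemma em_scaleDl x : {morph em_scale^~ x : a b / a + b}.
Proof.
move=> a b /=; rewrite -(ext_reprK x) !em_scaleE [RHS]em_addE; apply/ext_piP.
exact: ext_scaleDl.
Qed.
HB.instance Definition _ := GRing.Zmodule_isLmodule.Build A ext_mod
  em_scaleA em_scale1 em_scaleDr em_scaleDl.

Definition ext_unit (x : X) : res phi ext_mod := ext_pi (ExtGen x).

Lemma ext_unit_is_linear : linear ext_unit.
Proof.
move=> r x y; rewrite [r *: ext_unit x]em_scaleE [RHS]em_addE; apply/ext_piP.
apply: ext_trans (ext_genD _ _) _.
by apply: ext_add; [apply: ext_genZ|apply: ext_refl].
Qed.
HB.instance Definition _ :=
  GRing.isLinear.Build R X (res phi ext_mod) *:%R ext_unit ext_unit_is_linear.

Lemma ext_mod_ind (P : ext_mod -> Prop) : P 0 -> (forall z, P z -> P (- z)) ->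
  (forall z w, P z -> P w -> P (z + w)) ->
  (forall a z, P z -> P (a *: z)) ->
  (forall x, P (ext_unit x)) -> forall z, P z.
Proof.
move=> P0 PN PD PZ Pg z; rewrite -(ext_reprK z).
elim: (ext_repr z) => //= [s IH|s IHs t IHt|a s IH].
- by have := PN _ IH; rewrite [- _]em_oppE.
- by have := PD _ _ IHs IHt; rewrite [_ + _]em_addE.
by have := PZ a _ IH; rewrite [_ *: _]em_scaleE.
Qed.

Section Lift.
Variables (N : lmodType A) (g : {linear X -> res phi N}).

Fixpoint ext_eval (s : ext_term) : N :=
  match s with
  | ExtZero => 0
  | ExtOpp t => - ext_eval t
  | ExtAdd t u => ext_eval t + ext_eval u
  | ExtScale a t => a *: ext_eval t
  | ExtGen x => g x
  end.

Lemma ext_eval_rel s t : ext_rel s t -> ext_eval s = ext_eval t.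
Proof.
elim=> //= [? ? ? _ -> _ //|? ? _ -> //|? ? ? ? _ -> _ -> //|? ? ? _ -> //
  |? ? ?|? ?|?|?|? ? ?|?|? ? ?|? ? ?|? ?|r x].
- exact: addrA.
- exact: addrC.
- exact: add0r.
- exact: addNr.
- exact: scalerA.
- exact: scale1r.
- exact: scalerDr.
- exact: scalerDl.
- by rewrite linearD.
by rewrite linearZ.
Qed.

Lemma ext_lift : exists f : {linear ext_mod -> N}, forall x, f (ext_unit x) = g x.
Proof.
pose F (z : ext_mod) := ext_eval (ext_repr z).
have FE s : F (ext_pi s) = ext_eval s.
  by apply: ext_eval_rel; apply: ext_repr_pi.
have FL a x y : F (a *: x + y) = a *: F x + F y.
  rewrite -(ext_reprK x) -(ext_reprK y) [a *: ext_pi _]em_scaleE.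
  by rewrite [_ + _]em_addE !FE.
have [f Hf] := exists_linear FL.
by exists f => x; rewrite Hf FE.
Qed.

End Lift.

Lemma ext_hom_eq (N : lmodType A) (f g : {linear ext_mod -> N}) :
  (forall x, f (ext_unit x) = g (ext_unit x)) -> forall z, f z = g z.
Proof.
move=> H; elim/ext_mod_ind => [|z IH|z w IHz IHw|a z IH|x].
- by rewrite !linear0.
- by rewrite !linearN IH.
- by rewrite !linearD IHz IHw.
- by rewrite !linearZ IH.
exact: H.
Qed.

Lemma ext_fin_gen : fin_gen X -> fin_gen ext_mod.
Proof.
case=> n [g Hg]; exists n, (fun i => ext_unit (g i)).
have span x : exists a : 'I_n -> A, x = \sum_i a i *: ext_unit (g i).
  elim/ext_mod_ind: x => [|z [c ->]|z w [c ->] [d ->]|a z [c ->]|x].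
  - by exists (fun=> 0); rewrite big1 // => i _; rewrite scale0r.
  - by exists (fun i => - c i); rewrite -sumrN; apply: eq_bigr => i _; rewrite scaleNr.
  - exists (fun i => c i + d i); rewrite -big_split; apply: eq_bigr => i _.
    by rewrite scalerDl.
  - exists (fun i => a * c i); rewrite scaler_sumr; apply: eq_bigr => i _.
    by rewrite scalerA.
  have [c ->] := Hg x; exists (phi \o c); rewrite linear_sum.
  by apply: eq_bigr => i _; rewrite linearZ.
exact: span.
Qed.

(** Extension of scalars is left adjoint to restriction, and restriction keeps surjections
    surjective; so a lifting problem over A becomes one over R for X. *)
Lemma ext_fg_proj : fg_proj X -> fg_proj ext_mod.
Proof.
case=> fgX HX; split; first exact: ext_fin_gen.
move=> U V g h Hg.
have [g' Hg'] : exists g' : {linear res phi U -> res phi V}, forall u, g' u = g u.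
  by apply: exists_linear => a x y; rewrite [LHS]linearP.
have [h' Hh'] : exists h' : {linear X -> res phi V}, forall x, h' x = h (ext_unit x).
  by apply: exists_linear => a x y; rewrite linearP [LHS]linearP.
have [|k Hk] := HX _ _ g' h'; first by move=> v; have [u <-] := Hg v; exists u.
have [f Hf] := ext_lift k; exists f.
apply: (@ext_hom_eq V (g \o f) h) => x /=.
by rewrite Hf -Hg' Hk Hh'.
Qed.

End ExtensionOfScalars.

Section ExtensionMap.
Variables (R A : pzRingType) (phi : {rmorphism R -> A}).

Lemma ext_map_exists (X Y : lmodType R) (f : {linear X -> Y}) :
  exists g : {linear ext_mod phi X -> ext_mod phi Y},
    forall x, g (ext_unit phi x) = ext_unit phi (f x).
Proof.
have [g Hg] := @ext_lift R A phi X (ext_mod phi Y) (@ext_unit R A phi Y \o f).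
by exists g.
Qed.

Lemma ext_fin_pres (X : lmodType R) : fin_pres X -> fin_pres (ext_mod phi X).
Proof.
case=> m [n [rho [p [Hp Hk]]]].
have [r' Hr'] := ext_map_exists rho; have [p' Hp'] := ext_map_exists p.
apply: (@fin_pres_coker A _ _ _ r' p'); first exact/ext_fg_proj/fg_proj_row.
- by apply: ext_fin_gen; case: (fg_proj_row R m).
- elim/ext_mod_ind => [|z [v <-]|z w [v <-] [u <-]|a z [v <-]|x].
  + by exists 0; rewrite linear0.
  + by exists (- v); rewrite linearN.
  + by exists (v + u); rewrite linearD.
  + by exists (a *: v); rewrite linearZ.
  by have [v <-] := Hp x; exists (ext_unit phi v); rewrite Hp'.
move=> v; split=> [Hv|[w ->]]; last first.
  have pr0 x : (p \o rho) x = 0 by apply/Hk; exists x.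
  have -> : p' (r' w) = (\0 : {linear _ -> _}) w; last by [].
  apply: (@ext_hom_eq _ _ _ _ _ (p' \o r') \0) => x /=.
  by rewrite Hr' Hp' [p _]pr0 linear0.
(* Right exactness: the projection onto the cokernel of [r'] factors through [p'] by the universal
   properties of X and of [ext_mod phi X], hence it kills the kernel of [p']. *)
have [S HS] := image_submodule r'; apply/HS/qm_pi_eq0.
have [g0 Hg0] : exists g0 : {linear 'rV[R]_n -> res phi (quot_mod S)},
    forall x, g0 x = qm_pi S (ext_unit phi x).
  by apply: exists_linear => a x y; rewrite linearP [LHS]linearP.
have [|g Hg] := linear_surj_lift (f := g0) Hp.
  move=> u /Hk[w ->]; rewrite Hg0; apply/qm_pi_eq0/HS.
  by exists (ext_unit phi w); rewrite Hr'.
have [G HG] := ext_lift g.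
have -> : qm_pi S v = G (p' v); last by rewrite Hv linear0.
apply/esym/(@ext_hom_eq _ _ _ _ _ (G \o p') (@qm_pi _ _ S)) => x /=.
by rewrite Hp' HG Hg Hg0.
Qed.

End ExtensionMap.

(** * Modules over the Leavitt ring *)

Section LeavittModules.
Variables (R : pzRingType) (M : bimodType R).
Let L := leavitt M.

Lemma lv_scalar_is_zmod_morphism : zmod_morphism (lv_scalar M).
Proof. by move=> r s; apply: (@addIr _ (lv_scalar M s)); rewrite -lv_scalarD !subrK. Qed.
Lemma lv_scalar_is_monoid_morphism : monoid_morphism (lv_scalar M).
Proof. by split=> [|r s]; [apply: lv_scalar1|apply: lv_scalarM]. Qed.
HB.instance Definition _ :=
  GRing.isZmodMorphism.Build R L (lv_scalar M) lv_scalar_is_zmod_morphism.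
HB.instance Definition _ :=
  GRing.isMonoidMorphism.Build R L (lv_scalar M) lv_scalar_is_monoid_morphism.

Lemma lv_vec_is_zmod_morphism : zmod_morphism (@lv_vec R M).
Proof. by move=> x y; apply: (@addIr _ (lv_vec y)); rewrite -lv_vecD !subrK. Qed.
HB.instance Definition _ :=
  GRing.isZmodMorphism.Build M L (@lv_vec R M) lv_vec_is_zmod_morphism.
Lemma lv_dual_is_zmod_morphism : zmod_morphism (@lv_dual R M).
Proof. by move=> x y; apply: (@addIr _ (lv_dual y)); rewrite -lv_dualD !subrK. Qed.
HB.instance Definition _ :=
  GRing.isZmodMorphism.Build (dual M) L (@lv_dual R M) lv_dual_is_zmod_morphism.

Section Construction.
Variables (V : lmodType R) (aM : M -> V -> V) (aD : dual M -> V -> V).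
Hypotheses (aMDr : forall x v w, aM x (v + w) = aM x v + aM x w)
  (aMDl : forall x y v, aM (x + y) v = aM x v + aM y v)
  (aMZ : forall r x v, aM (r *: x) v = r *: aM x v)
  (aM_ract : forall r x v, aM (ract x r) v = aM x (r *: v))
  (aDDr : forall f v w, aD f (v + w) = aD f v + aD f w)
  (aDDl : forall f g v, aD (f + g) v = aD f v + aD g v)
  (aDZ : forall r f v, aD (r *: f) v = r *: aD f v)
  (aD_ract : forall r f v, aD (ract f r) v = aD f (r *: v))
  (aM_aD : forall x f v, aM x (aD f v) = dual_eval f x *: v)
  (aD_aM : forall n (al : 'I_n -> M) (al' : 'I_n -> dual M), is_dual_basis al al' ->
    forall v, \sum_j aD (al' j) (aM (al j) v) = v).

(** The additivity and R-compatibility hypotheses yield a ring map from the tensor ring to the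
    additive endomorphisms of V; [aM_aD] and [aD_aM] make it vanish on the two kinds of generators
    of the Leavitt ideal. In the proof N is V and [i] is the identity; only the bijection is
    exposed. *)
Lemma leavitt_module : exists (N : lmodType L) (i : {linear V -> res (lv_scalar M) N}),
  [/\ bijective i, forall x v, i (aM x v) = lv_vec x *: (i v : N)
    & forall f v, i (aD f v) = lv_dual f *: (i v : N)].
Proof.
have zS (r : R) : zmod_morphism (fun v : V => r *: v) by apply: endo_subD => v w; apply: scalerDr.
have zM (x : M) : zmod_morphism (aM x) by apply: endo_subD.
have zD (f : dual M) : zmod_morphism (aD f) by apply: endo_subD.
pose eS r : endo V := exist _ _ (zS r).
pose eM x : endo V := exist _ _ (zM x).
pose eD f : endo V := exist _ _ (zD f).
have eSB : zmod_morphism eS.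
  by move=> r s; apply: endoP => v; apply: scalerBl.
have eSM : monoid_morphism eS.
  by split=> [|r s]; apply: endoP => v; [apply: scale1r|rewrite [RHS]scalerA].
pose phi : {rmorphism R -> endo V} := HB.pack eS
  (GRing.isZmodMorphism.Build _ _ eS eSB) (GRing.isMonoidMorphism.Build _ _ eS eSM).
pose psi (z : (dual M * M)%type) : endo V := eD z.1 + eM z.2.
have [|||F [FS FV]] := @tensor_ring_lift R _ (endo V) phi psi.
- move=> z w; apply: endoP => v; rewrite !endoDE /= aDDl aMDl; exact: addrACA.
- move=> r z; apply: endoP => v.
  by rewrite endoDE endoME endoD /= aDZ aMZ.
- by move=> z r; apply: endoP => v; rewrite endoME !endoDE /= aD_ract aM_ract.
have aM0 v : aM 0 v = 0 by apply: (@addrI _ (aM 0 v)); rewrite -aMDl !addr0.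
have aD0 v : aD 0 v = 0 by apply: (@addrI _ (aD 0 v)); rewrite -aDDl !addr0.
have FM x : F (lv_vecT x) = eM x.
  by apply: endoP => v; rewrite FV /= aD0 add0r.
have FD f : F (lv_dualT f) = eD f.
  by apply: endoP => v; rewrite FV /= aM0 addr0.
have F0 z : two_sided_ideal (@leavitt_gen R M) z -> F z = 0.
  elim=> [_ [x f|n al al' H]||a b _ Ha _ Hb|a b _ Hb|a b _ Ha].
  - rewrite rmorphB rmorphM FM FD FS; apply/eqP; rewrite subr_eq0; apply/eqP.
    by apply: endoP => v; rewrite endoME /= aM_aD.
  - rewrite rmorphB rmorph1 rmorph_sum; apply/eqP; rewrite subr_eq0; apply/eqP.
    apply: endoP => v; rewrite endo_sumE -[RHS](aD_aM H); apply: eq_bigr => j _.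
    by rewrite rmorphM FM FD.
  - exact: rmorph0.
  - by rewrite rmorphD Ha Hb addr0.
  - by rewrite rmorphM Hb mulr0.
  by rewrite rmorphM Ha mul0r.
pose G (z : L) : endo V := F (rq_repr z).
have GE a : G (lv_pi a) = F a.
  have := F0 _ (rq_repr_pi (@leavitt_gen R M) a).
  by rewrite rmorphB => /eqP; rewrite subr_eq0 => /eqP.
have GB : zmod_morphism G.
  move=> x y; rewrite -(rq_reprK x) -(rq_reprK y) -rmorphB.
  by rewrite [LHS]GE [X in _ = X - _]GE [X in _ = _ - X]GE rmorphB.
have GM : monoid_morphism G.
  split=> [|x y]; first by rewrite [LHS]GE rmorph1.
  rewrite -(rq_reprK x) -(rq_reprK y) -rmorphM.
  by rewrite [LHS]GE [X in _ = X * _]GE [X in _ = _ * X]GE rmorphM.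
pose rho : {rmorphism L -> endo V} := HB.pack G
  (GRing.isZmodMorphism.Build _ _ G GB) (GRing.isMonoidMorphism.Build _ _ G GM).
have actE a v : (lv_pi a : L) *: (v : rep_mod rho) = sval (F a) v.
  by rewrite [LHS]/(sval (G _) v) GE.
have [i Hi] : exists i : {linear V -> res (lv_scalar M) (rep_mod rho)}, forall v, i v = v.
  apply: exists_linear => r v w; congr (_ + _).
  by rewrite resZE [RHS]actE FS.
exists (rep_mod rho : lmodType L), i; split=> [|x v|f v].
- by exists id => v; rewrite Hi.
- by rewrite !Hi actE FM.
by rewrite !Hi actE FD.
Qed.

End Construction.
End LeavittModules.

(** * The maps from M^k (x) X to T X *)

Section TensorAlgebras.
Variables (R : pzRingType) (M : bimodType R) (hM : fg_proj M).
Let L := leavitt M.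
Let rs : {rmorphism R -> L} := lv_scalar M.

(** A splitting of R^n -> M supplies the images of the unit vectors and the coordinates of the
    section. The expansion of f in M^* follows by applying f to the expansion of x. *)
Lemma dual_basis_exists :
  exists n (al : 'I_n -> M) (al' : 'I_n -> dual M), is_dual_basis al al'.
Proof.
have [n [f [t ft]]] := fg_proj_split hM.
have Ht j : linear (fun x : M => t x 0 j : R^o).
  by move=> a x y; rewrite linearP !mxE.
exists n, (fun j => f (delta_mx 0 j)), (fun j => exist _ _ (Ht j)).
have E (x : M) : x = \sum_j t x 0 j *: f (delta_mx 0 j).
  rewrite -[LHS]ft {1}(row_sum (t x)) linear_sum.
  by apply: eq_bigr => j _; rewrite linearZ.
split=> [x|g]; first exact: E.
have sumE (I : Type) (s : seq I) (F : I -> dual M) x :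
    sval (\sum_(i <- s) F i) x = \sum_(i <- s) sval (F i) x.
  exact: (big_morph (fun f => sval f x)).
apply: hom_modP => x; rewrite sumE.
have [g' Hg'] := hom_linear g.
rewrite -Hg' {1}(E x) linear_sum; apply: eq_bigr => j _.
by rewrite linearZ /= Hg'.
Qed.

Lemma casimir_expand n (al : 'I_n -> M) (al' : 'I_n -> dual M) (N : lmodType L) (v : N) :
  is_dual_basis al al' ->
  \sum_j lv_dual (al' j) *: (lv_vec (al j) *: v) = v.
Proof.
move=> /lv_casimirE H; rewrite -[RHS]scale1r -H scaler_suml.
by apply: eq_bigr => j _; rewrite scalerA.
Qed.

(** By the Casimir relation v is recovered from the products of M with v. Identities in L-modules
    can therefore be checked after multiplication by M. *)
Lemma lv_vec_separates (N : lmodType L) (v w : N) :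
  (forall m : M, lv_vec m *: v = lv_vec m *: w) -> v = w.
Proof.
move=> H; have [n [al [al' B]]] := dual_basis_exists.
rewrite -(casimir_expand v B) -(casimir_expand w B).
by apply: eq_bigr => j _; rewrite H.
Qed.

Definition om (k : nat) (X : fp_module R) : fp_module R :=
  oiter (tensor_functor hM) k X.

(** [raise] retyped: as a morphism of [mod_cat] its values are not displayed as linear maps. *)
Definition om_raise k a b (X Y : fp_module R) (f : {linear om a X -> om b Y}) :
    {linear om (k + a) X -> om (k + b) Y} :=
  @raise (mod_cat R) (tensor_functor hM) k a b X Y f.

Lemma om_raiseS k a b (X Y : fp_module R) (f : {linear om a X -> om b Y}) :
  om_raise k.+1 f = tensor_map M (om_raise k f).
Proof. by []. Qed.

(* Modules over the tensor ring T_R(M) are R-modules V with a map M (x) V -> V. *)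
Section Iteration.
Variables (V : lmodType R) (al : {linear tensor M V -> V}).

Definition word (s : seq M) (v : V) : V := foldr (fun m u => al (tens m u)) v s.

Lemma tens0r (Z : lmodType R) (m : M) : tens m (0 : Z) = 0.
Proof. by apply: (@addrI _ (tens m 0)); rewrite -tensDr !addr0. Qed.
Lemma tensNr (Z : lmodType R) (m : M) (z : Z) : tens m (- z) = - tens m z.
Proof. by apply/eqP; rewrite -addr_eq0 -tensDr addNr tens0r. Qed.

Lemma word0 s : word s 0 = 0.
Proof. by elim: s => //= m s ->; rewrite tens0r linear0. Qed.
Lemma wordD s v w : word s (v + w) = word s v + word s w.
Proof. by elim: s => //= m s ->; rewrite tensDr linearD. Qed.
Lemma wordN s v : word s (- v) = - word s v.
Proof. by elim: s => //= m s ->; rewrite tensNr linearN. Qed.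
Lemma word_rcons s m v : word (rcons s m) v = word s (al (tens m v)).
Proof. by rewrite /word foldr_rcons. Qed.
Lemma word_cat s t v : word (s ++ t) v = word s (word t v).
Proof. by rewrite /word foldr_cat. Qed.

(* itr k h (x1 (x) .. (x) xk (x) x) = x1 (.. (xk (h x))). *)
Fixpoint itr (k : nat) (X : fp_module R) (h : {linear X -> V}) : {linear om k X -> V} :=
  match k return {linear om k X -> V} with
  | 0%N => h
  | k'.+1 => al \o tensor_map M (itr k' h)
  end.

Lemma itrS k (X : fp_module R) (h : {linear X -> V}) m (w : om k X) :
  itr k.+1 h (tens m w : om k.+1 X) = al (tens m (itr k h w)).
Proof. by rewrite /= tensor_mapE. Qed.

Lemma itr_raise (X Y : fp_module R) (a b : nat) (g : {linear X -> V})
    (h : {linear Y -> V}) (f : {linear om a X -> om b Y}) k :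
  (forall w, itr a g w = itr b h (f w)) ->
  forall w, itr (k + a) g w = itr (k + b) h (om_raise k f w).
Proof.
move=> H; elim: k => [|k IH] //.
apply: (@linear_tensor_ext R M _ _ (al \o tensor_map M (itr (k + a) g))
  (al \o (tensor_map M (itr (k + b) h) \o tensor_map M (om_raise k f)))) => m x /=.
by rewrite !tensor_mapE IH.
Qed.

End Iteration.

(** Only additivity of f is asked, so that the lemma also applies to an L-linear map, whose type
    does not mention the restricted R-structures. *)
Lemma itr_comp (V W : lmodType R) (al : {linear tensor M V -> V})
    (be : {linear tensor M W -> W}) (f : V -> W) :
  (forall v v', f (v + v') = f v + f v') ->
  (forall m v, f (al (tens m v)) = be (tens m (f v))) ->
  forall (X : fp_module R) (h : {linear X -> V}) (h' : {linear X -> W}) k,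
    (forall x, f (h x) = h' x) -> forall w, f (itr al k h w) = itr be k h' w.
Proof.
move=> fD fM X h h' k H; elim: k => [|k IH] //=.
have f0 : f 0 = 0 by apply: (@addrI _ (f 0)); rewrite -fD !addr0.
have fN v : f (- v) = - f v by apply/eqP; rewrite -addr_eq0 -fD addNr f0.
elim/tensor_ind => [|z IHz|z w IHz IHw|m x].
- by rewrite !linear0.
- by rewrite !linearN fN IHz.
- by rewrite !linearD fD IHz IHw.
by rewrite /= !tensor_mapE fM IH.
Qed.

Section LeavittAction.
Variable N : lmodType L.

Lemma lv_alg_exists : exists al : {linear tensor M (res rs N) -> res rs N},
  forall (m : M) (v : N), al (tens m (v : res rs N)) = lv_vec m *: v.
Proof.
apply: (@tensor_lift R M (res rs N) (res rs N) (fun m v => lv_vec m *: (v : N))).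
- by move=> m m' v; rewrite raddfD scalerDl.
- by move=> m v w; rewrite scalerDr.
- by move=> m r v; rewrite lv_vec_ract -scalerA.
by move=> r m v; rewrite lv_vecZ -scalerA.
Qed.

Definition lv_alg : {linear tensor M (res rs N) -> res rs N} := sval (cid lv_alg_exists).

Lemma lv_algE (m : M) (v : N) : lv_alg (tens m (v : res rs N)) = lv_vec m *: v.
Proof. by rewrite /lv_alg; case: cid. Qed.

(** Adjunction combined with N = Hom_R(M, N): the map z |-> (m |-> k (m (x) z)) takes values in
    Hom_R(M, N), and the Casimir element gives the inverse of N -> Hom_R(M, N). *)
Lemma tensor_transpose (Z : lmodType R) (k : {linear tensor M Z -> res rs N}) :
  exists h : {linear Z -> res rs N}, forall m z, lv_vec m *: (h z : N) = k (tens m z).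
Proof.
have [n [al [al' B]]] := dual_basis_exists.
pose h (z : Z) : res rs N := \sum_j lv_dual (al' j) *: (k (tens (al j) z) : N).
have hE m z : lv_vec m *: (h z : N) = k (tens m z).
  rewrite scaler_sumr; case: B => /(_ m) B _.
  rewrite {2}B tens_suml linear_sum; apply: eq_bigr => j _.
  by rewrite scalerA lv_vecE tensZ linearZ.
(* Linearity is not visible from the formula, since a scalar does not commute with the
   [lv_dual (al' j)]; it is checked after multiplication by M, where [hE] applies. *)
have [g Hg] : exists g : {linear Z -> res rs N}, forall z, g z = h z.
  apply: exists_linear => a x y; apply: lv_vec_separates => m.
  rewrite scalerDr resZE scalerA -lv_vec_ract !hE tensDr linearD.
  by rewrite tens_ract.
by exists g => m z; rewrite Hg hE.
Qed.

Lemma itr_transpose k (X : fp_module R) (g : {linear om k X -> res rs N}) :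
  exists h : {linear X -> res rs N}, forall w, itr lv_alg k h w = g w.
Proof.
elim: k g => [|k IH] g; first by exists g.
have [g' Hg'] := tensor_transpose g; have [h Hh] := IH g'; exists h.
apply: linear_tensor_ext => m x.
by rewrite -[LHS]/(itr lv_alg k.+1 h (tens m x)) itrS Hh lv_algE Hg'.
Qed.

Lemma itr_inj k (X : fp_module R) (h h' : {linear X -> res rs N}) :
  (forall w, itr lv_alg k h w = itr lv_alg k h' w) -> forall x, h x = h' x.
Proof.
elim: k => [|k IH] // H; apply: IH => w; apply: lv_vec_separates => m.
by have := H (tens m w); rewrite !itrS !lv_algE.
Qed.

End LeavittAction.

Lemma lin_itr (N N' : lmodType L) (f : {linear N -> N'}) (X : fp_module R)
    (h : {linear X -> res rs N}) (h' : {linear X -> res rs N'}) k :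
  (forall x, f (h x) = h' x) ->
  forall w, f (itr (lv_alg N) k h w) = itr (lv_alg N') k h' w.
Proof.
apply: (@itr_comp (res rs N) (res rs N') (lv_alg N) (lv_alg N') f).
  by move=> v w; apply: (linearD f).
by move=> m v; rewrite !lv_algE linearZ.
Qed.

Notation T := (ext_mod rs).
Definition jm k (X : fp_module R) : {linear om k X -> res rs (T X)} :=
  itr (lv_alg (T X)) k (@ext_unit R L rs X).

Lemma jmS k (X : fp_module R) m (w : om k X) :
  jm k.+1 X (tens m w : om k.+1 X) = lv_vec m *: (jm k X w : T X).
Proof. by rewrite [LHS]itrS lv_algE. Qed.

Lemma T_hom_eq k (X : fp_module R) (N : lmodType L) (f g : {linear T X -> N}) :
  (forall w, f (jm k X w) = g (jm k X w)) -> forall t, f t = g t.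
Proof.
move=> H; apply: ext_hom_eq.
have lin (u : {linear T X -> N}) :
    exists u' : {linear X -> res rs N}, forall x, u' x = u (ext_unit rs x).
  by apply: exists_linear => a x y; rewrite linearP [LHS]linearP.
have [f' Hf'] := lin f; have [g' Hg'] := lin g => x.
rewrite -Hf' -Hg'; apply: (@itr_inj N k) => w.
by rewrite -(lin_itr (fun x => esym (Hf' x))) -(lin_itr (fun x => esym (Hg' x))).
Qed.

Lemma T_lift k (X : fp_module R) (N : lmodType L) (g : {linear om k X -> res rs N}) :
  exists f : {linear T X -> N}, forall w, f (jm k X w) = g w.
Proof.
have [h Hh] := itr_transpose g; have [f Hf] := ext_lift h.
by exists f => w; rewrite (lin_itr Hf).
Qed.

Lemma T_hom_restrict k (X : fp_module R) (N : lmodType L) (f : {linear T X -> N}) :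
  exists g : {linear om k X -> res rs N}, forall w, g w = f (jm k X w).
Proof. by apply: exists_linear => a x y; rewrite linearP [LHS]linearP. Qed.

End TensorAlgebras.

(* The localization of a T_R(M)-module V, realized by germs at infinity of
   sequences u_p in Hom(M, Hom(M, .. V)) (p times).  The relation
   sum_j a_j^* a_j = 1 fails only at p = 0, hence the germs. *)
Section Localization.
Variables (R : pzRingType) (M : bimodType R) (V : lmodType R).
Variable al : {linear tensor M V -> V}.
Let L := leavitt M.

Fixpoint iter_hom (p : nat) : lmodType R :=
  match p with
  | 0%N => V
  | p'.+1 => hom_mod M (iter_hom p')
  end.

Lemma hom_modZ (W : lmodType R) (h : hom_mod M W) r x : sval h (r *: x) = r *: sval h x.
Proof. by have [k Hk] := hom_linear h; rewrite -!Hk linearZ. Qed.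

Lemma dual_scale_linear (W : lmodType R) (f : dual M) (w : W) :
  linear (fun x : M => dual_eval f x *: w).
Proof.
move=> a x y; rewrite scalerA -scalerDl; congr (_ *: _).
exact: (svalP f).
Qed.

Let D := dprod iter_hom.

Definition seq_vec (x : M) (u : D) : D := fun p => sval (u p.+1 : hom_mod M _) x.
(** At index p + 1 this is x |-> f(x) u_p, so that x (f u) = f(x) u holds on the nose. The value 0
    at index 0 is a default that germs forget. *)
Definition seq_dual (f : dual M) (u : D) : D := fun p =>
  match p return iter_hom p with
  | 0%N => 0
  | p'.+1 => exist _ _ (dual_scale_linear f (u p'))
  end.

Definition ev_zero (u : D) : Prop := exists p0, forall p, (p0 <= p)%N -> u p = 0.

Lemma ev_zero0 : ev_zero 0. Proof. by exists 0%N. Qed.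
Lemma ev_zeroP a u v : ev_zero u -> ev_zero v -> ev_zero (a *: u + v).
Proof.
case=> p Hp [q Hq]; exists (maxn p q) => k; rewrite geq_max => /andP[/Hp Ep /Hq Eq].
by rewrite dprodDE dprodZE Ep Eq scaler0 addr0.
Qed.
Let S : submodule D := Submodule ev_zero0 ev_zeroP.
Let Q : lmodType R := quot_mod S.

Lemma seq_vecD x u v : seq_vec x (u + v) = seq_vec x u + seq_vec x v.
Proof. by []. Qed.
Lemma seq_vec_ev_zero x u : ev_zero u -> ev_zero (seq_vec x u).
Proof. by case=> p0 H; exists p0 => p Hp; rewrite /seq_vec H //; lia. Qed.
Lemma seq_dualD f u v : seq_dual f (u + v) = seq_dual f u + seq_dual f v.
Proof.
by apply: dprodP => -[|p] //=; rewrite dprodDE ?addr0 //=;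
  apply: hom_modP => x /=; rewrite scalerDr.
Qed.
Lemma seq_dual_ev_zero f u : ev_zero u -> ev_zero (seq_dual f u).
Proof.
case=> p0 H; exists p0.+1 => -[|p] //= Hp.
by apply: hom_modP => x /=; rewrite H // scaler0.
Qed.

Lemma quot_map (F : D -> D) :
  (forall u v, F (u + v) = F u + F v) -> (forall u, ev_zero u -> ev_zero (F u)) ->
  forall u, qm_pi S (F (qm_repr (qm_pi S u))) = qm_pi S (F u).
Proof.
move=> FD F0 u; apply/qm_piP; have := F0 _ (qm_repr_pi S u).
suff -> : F (qm_repr (qm_pi S u) - u) = F (qm_repr (qm_pi S u)) - F u by [].
by apply: (@addIr _ (F u)); rewrite -FD !subrK.
Qed.

Definition germ_vec x (q : Q) : Q := qm_pi S (seq_vec x (qm_repr q)).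
Definition germ_dual f (q : Q) : Q := qm_pi S (seq_dual f (qm_repr q)).

Lemma germ_vecE x u : germ_vec x (qm_pi S u) = qm_pi S (seq_vec x u).
Proof. by apply: quot_map; [apply: seq_vecD|apply: seq_vec_ev_zero]. Qed.
Lemma germ_dualE f u : germ_dual f (qm_pi S u) = qm_pi S (seq_dual f u).
Proof. by apply: quot_map; [apply: seq_dualD|apply: seq_dual_ev_zero]. Qed.

Lemma iter_germ_exists (W : lmodType R) (e : {linear V -> W}) :
  exists e' : {linear V -> hom_mod M W}, forall v m, sval (e' v) m = e (al (tens m v)).
Proof.
have lin v : linear (fun m => e (al (tens m v))).
  by move=> a x y; rewrite tensDl tensZ !linearP.
have [e' He'] : exists e' : {linear V -> hom_mod M W}, forall v, e' v = exist _ _ (lin v).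
  apply: exists_linear => a x y; apply: hom_modP => m /=.
  by rewrite tensDr tens_ract !linearD.
by exists e' => v m; rewrite He'.
Qed.

(** The p-th term of the sequence of v is the map (m_1, ..., m_p) |-> m_p (.. (m_1 v)). The first
    argument acts first, which is why words are taken apart from the right in [iter_germ_word]. *)
Fixpoint iter_germ p : {linear V -> iter_hom p} :=
  match p return {linear V -> iter_hom p} with
  | 0%N => idfun
  | p'.+1 => sval (cid (iter_germ_exists (iter_germ p')))
  end.

Lemma iter_germS p v m :
  sval (iter_germ p.+1 v : hom_mod M _) m = iter_germ p (al (tens m v)).
Proof. by rewrite /=; case: cid. Qed.

Lemma iter_germ_word p v : iter_germ p v = 0 ->
  forall s, size s = p -> word al s v = 0.
Proof.
elim: p v => [|p IH] v H s; first by move/size0nil->.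
elim/last_ind: s => // s m _; rewrite size_rcons => -[Hs]; rewrite word_rcons.
by apply: IH => //; rewrite -iter_germS H.
Qed.

(** Here [u v] is the germ of p |-> [iter_germ p v]. If it is 0, then some term vanishes, and that
    term records all words of length p applied to v. *)
Lemma localization : exists (N : lmodType L) (u : {linear V -> res (lv_scalar M) N}),
  (forall m v, u (al (tens m v)) = lv_vec m *: (u v : N)) /\
  (forall v, u v = 0 -> exists p, forall s, size s = p -> word al s v = 0).
Proof.
have [|||||||||n ala ala' B v|N [i [[j ij ji] iM iD]]] := @leavitt_module R M Q germ_vec germ_dual.
- move=> x v w; rewrite -(qm_reprK v) -(qm_reprK w) -linearD !germ_vecE.
  by rewrite seq_vecD linearD.
- move=> x y v; rewrite -(qm_reprK v) !germ_vecE -linearD; congr qm_pi.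
  by apply: dprodP => p; apply: linear_fD.
- move=> r x v; rewrite -(qm_reprK v) !germ_vecE -linearZ; congr qm_pi.
  by apply: dprodP => p; apply: hom_modZ.
- move=> r x v; rewrite -(qm_reprK v) germ_vecE -linearZ germ_vecE.
  by congr qm_pi; apply: dprodP.
- move=> f v w; rewrite -(qm_reprK v) -(qm_reprK w) -linearD !germ_dualE.
  by rewrite seq_dualD linearD.
- move=> f g v; rewrite -(qm_reprK v) !germ_dualE -linearD; congr qm_pi.
  apply: dprodP => -[|p] /=; rewrite dprodDE ?addr0 //=.
  by apply: hom_modP => x /=; rewrite -scalerDl.
- move=> r f v; rewrite -(qm_reprK v) !germ_dualE -linearZ; congr qm_pi.
  apply: dprodP => -[|p] /=; rewrite dprodZE ?scaler0 //=.
  exact: hom_modP.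
- move=> r f v; rewrite -(qm_reprK v) germ_dualE -linearZ germ_dualE.
  congr qm_pi; apply: dprodP => -[|p] //=; apply: hom_modP => x /=.
  by rewrite dprodZE scalerA.
- move=> x f v; rewrite -(qm_reprK v) germ_dualE germ_vecE -linearZ.
  by congr qm_pi; apply: dprodP.
- rewrite -(qm_reprK v); set u := qm_repr v.
  under eq_bigr do rewrite germ_vecE germ_dualE.
  rewrite -linear_sum; apply/qm_piP; exists 1%N => -[//|p] _.
  rewrite dprodDE dprodNE.
  have sumE (F : 'I_n -> D) q : (\sum_j F j) q = \sum_j F j q.
    exact: (big_morph (fun u : D => u q)).
  rewrite sumE; apply/eqP; rewrite subr_eq0; apply/eqP/hom_modP => x.
  have sumE' (F : 'I_n -> hom_mod M (iter_hom p)) : sval (\sum_j F j) x = \sum_j sval (F j) x.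
    exact: (big_morph (fun h : hom_mod M _ => sval h x)).
  rewrite [LHS]sumE' /=; case: B => /(_ x) {2}-> _.
  have [h Hh] := hom_linear (u p.+1); rewrite -Hh linear_sum.
  by apply: eq_bigr => k _; rewrite linearZ /= Hh.
have [u Hu] : exists u : {linear V -> res (lv_scalar M) N},
    forall v, u v = i (qm_pi S (fun p => iter_germ p v)).
  apply: exists_linear => a x y; rewrite -linearP -linearP.
  by congr (i (qm_pi _ _)); apply: dprodP => p; rewrite linearP.
exists N, u; split=> [m v|v].
  rewrite !Hu -iM germ_vecE; congr (i (qm_pi _ _)); apply: dprodP => p.
  by rewrite /seq_vec iter_germS.
rewrite Hu => E; have : qm_pi S (fun p => iter_germ p v) = 0.
  by apply: (can_inj ij); rewrite E linear0.
move/qm_pi_eq0=> [p Hp]; exists p; apply: iter_germ_word; exact: Hp.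
Qed.

End Localization.

(** * Faithfulness *)

Section Faithfulness.
Variables (R : pzRingType) (M : bimodType R) (hM : fg_proj M).
Let L := leavitt M.
Let rs : {rmorphism R -> L} := lv_scalar M.

Section Tensors.
Variable Y : fp_module R.

(** The completed free T_R(M)-module on Y: the product of all M^q (x) Y instead of their direct sum,
    which spares finite supports. M^b (x) Y sits in it as the factor of index b, so nothing is lost
    by computing words there. *)
Definition tensors : lmodType R := dprod (fun q => om hM q Y : lmodType R).

Definition tens_shift (m : M) (z : tensors) : tensors := fun q =>
  match q return om hM q Y with
  | 0%N => 0
  | q'.+1 => tens m (z q')
  end.

Lemma tens_alg_exists : exists al : {linear tensor M tensors -> tensors},
  forall m z, al (tens m z) = tens_shift m z.
Proof.
apply: tensor_lift => [m m' x|m x x'|m r x|r m x]; apply: dprodP => -[|q] //=;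
    rewrite ?dprodDE ?dprodZE /= ?addr0 ?scaler0 //.
- by rewrite tensDl.
- by rewrite tensDr.
- by rewrite tens_ract.
by rewrite tensZ.
Qed.
Definition tens_alg : {linear tensor M tensors -> tensors} := sval (cid tens_alg_exists).
Lemma tens_algE m z : tens_alg (tens m z) = tens_shift m z.
Proof. by rewrite /tens_alg; case: cid. Qed.

Definition tens_fun0 (y : Y) : tensors := fun q =>
  match q return om hM q Y with
  | 0%N => y
  | q'.+1 => 0
  end.
Lemma tens_in0_exists : exists d : {linear Y -> tensors}, forall y, d y = tens_fun0 y.
Proof.
apply: exists_linear => a x y; apply: dprodP => -[|q] //=.
by rewrite dprodDE dprodZE /= scaler0 addr0.
Qed.
Definition tens_in0 := sval (cid tens_in0_exists).

Definition tens_in b : {linear om hM b Y -> tensors} := itr hM tens_alg b tens_in0.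

Lemma tens_in_diag b w : tens_in b w b = w.
Proof.
elim: b w => [|b IH] w; first by rewrite /tens_in /= /tens_in0; case: cid => d /= ->.
have -> : tens_in b.+1 w = tens_alg (tensor_map M (tens_in b) w) by [].
elim/tensor_ind: w => [|z IHz|z w IHz IHw|m x].
- by rewrite !linear0.
- by rewrite !linearN /= dprodNE IHz.
- by rewrite !linearD /= dprodDE IHz IHw.
by rewrite tensor_mapE tens_algE /= IH.
Qed.

(** The map from Y to the localization of [tensors] extends L-linearly to T Y, and on the image of
    M^b (x) Y it is the localization map after [tens_in b]. So vanishing in T Y implies vanishing in
    the localization. *)
Lemma jm_eq0_word b (w : om hM b Y) : jm hM b Y w = 0 ->
  exists p, forall s, size s = p -> word tens_alg s (tens_in b w) = 0.
Proof.
move=> E; have [N [u [uM u0]]] := localization tens_alg; apply: u0.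
have [f Hf] := @ext_lift R L rs Y N (u \o tens_in0).
rewrite (@itr_comp R M hM _ _ tens_alg (lv_alg N) u _ _ Y tens_in0 (u \o tens_in0)) //.
- by rewrite -(lin_itr (hM := hM) Hf) [itr _ _ _ _ _]E linear0.
- exact: linearD.
by move=> m v; rewrite uM lv_algE.
Qed.

Lemma word_size_le p q z : (forall s, size s = p -> word tens_alg s z = 0) ->
  (p <= q)%N -> forall s, size s = q -> word tens_alg s z = 0.
Proof.
move=> H pq s Hs; rewrite -(cat_take_drop (q - p) s) word_cat H ?word0 //.
by rewrite size_drop Hs subKn.
Qed.

(** The innermost letter absorbs the scalar, m (x) r z = m r (x) z, giving another word of the same
    length; with no letter, z itself is 0. *)
Lemma word_scale_eq0 p z r : (forall s, size s = p -> word tens_alg s z = 0) ->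
  forall s, size s = p -> word tens_alg s (r *: z) = 0.
Proof.
move=> H; elim/last_ind => [|s m _] Hs.
  by rewrite [z](H [::] Hs) scaler0 word0.
by rewrite word_rcons -tens_ract -word_rcons H // -Hs !size_rcons.
Qed.

Lemma om_raise_eq0 (X : fp_module R) a b (f : {linear om hM a X -> om hM b Y}) p :
  (forall s, size s = p -> forall x, word tens_alg s (tens_in b (f x)) = 0) ->
  forall z, om_raise p f z = 0.
Proof.
move=> H z; rewrite -[LHS]tens_in_diag.
suff -> : tens_in (p + b) (om_raise p f z) = 0 by [].
(* The empty prefix is generalized for the induction: each tensor factor peeled off [z] becomes the
   last letter of the prefix. *)
have {}H s : size s = p -> forall x, word tens_alg ([::] ++ s) (tens_in b (f x)) = 0 by apply: H.
change (word tens_alg [::] (tens_in (p + b) (om_raise p f z)) = 0).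
elim: p [::] H z => [|p IH] t H; first by move=> z; rewrite -[t]cats0; apply: H.
elim/tensor_ind => [|z IHz|z w IHz IHw|m x].
- by rewrite !linear0 word0.
- by rewrite !linearN wordN IHz oppr0.
- by rewrite !linearD wordD IHz IHw addr0.
rewrite om_raiseS tensor_mapE [tens_in _ _]itrS -word_rcons.
apply: IH => s Hs; rewrite cat_rcons; apply: H; by rewrite /= Hs.
Qed.

End Tensors.

Lemma fin_pres_gen (X : lmodType R) : fin_pres X -> fin_gen X.
Proof. by case=> m [n [rho [p [Hp _]]]]; apply/fin_genP; exists n, p. Qed.

Lemma jm_faithful (X Y : fp_module R) a b (f : {linear om hM a X -> om hM b Y}) :
  (forall w, jm hM b Y (f w) = 0) -> exists p, forall z, om_raise p f z = 0.
Proof.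
move=> H; have [n [g Hg]] := fin_pres_gen (fp_fin_pres (om hM a X)).
have /choice[p Hp] : forall i : 'I_n, exists p, forall s, size s = p ->
    word (tens_alg Y) s (tens_in Y b (f (g i))) = 0.
  by move=> i; apply: jm_eq0_word.
exists (\max_i p i)%N; apply: om_raise_eq0 => s Hs x.
have [c ->] := Hg x; rewrite !linear_sum.
have -> : word (tens_alg Y) s (\sum_i tens_in Y b (f (c i *: g i))) =
    \sum_i word (tens_alg Y) s (tens_in Y b (f (c i *: g i))).
  by apply: (big_morph (word (tens_alg Y) s)); [apply: wordD|apply: word0].
apply: big1 => i _; rewrite !linearZ; apply: word_scale_eq0 Hs => {}s Hs.
by apply: word_size_le (Hp i) _ _ Hs; apply: leq_bigmax.
Qed.
End Faithfulness.

(** * Gradings *)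

Section GradedModules.

Section Grading.
Variables (A : zmodType) (deg : int -> A -> Prop) (gA : is_grading deg).

Lemma gradingN d a : deg d a -> deg d (- a).
Proof. by move=> Ha; rewrite -sub0r; apply: (gr_sub gA) => //; apply: (gr_zero gA). Qed.
Lemma gradingD d a b : deg d a -> deg d b -> deg d (a + b).
Proof. by move=> Ha Hb; rewrite -[b]opprK; apply: (gr_sub gA) => //; apply: gradingN. Qed.
Lemma grading_sum d I (s : seq I) (P : pred I) (F : I -> A) :
  (forall i, P i -> deg d (F i)) -> deg d (\sum_(i <- s | P i) F i).
Proof. by move=> H; elim/big_ind: _ => //; [apply: (gr_zero gA)|apply: gradingD]. Qed.

(** [gr_gen] gives a list of homogeneous summands in which a degree may recur; inserting them one by
    one collects equal degrees. *)
Lemma homogeneous_components a : exists (s : seq int) (c : int -> A),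
  [/\ uniq s, forall d, deg d (c d) & a = \sum_(d <- s) c d].
Proof.
have [l [Hl ->]] := gr_gen gA a; elim: l Hl => [|b l IH] Hl.
  by exists [::], (fun=> 0); split=> // [d|]; [apply: (gr_zero gA)|rewrite !big_nil].
have [|s [c [us Hc E]]] := IH; first by move=> x xl; apply: Hl; rewrite inE xl orbT.
have [|d Hd] := Hl b; first by rewrite inE eqxx.
rewrite big_cons E; have [ds|ds] := boolP (d \in s).
  exists s, (fun e => if e == d then b + c d else c e); split=> // [e|].
    by case: eqP => [->|_]; [apply: gradingD|apply: Hc].
  rewrite !(bigD1_seq d) //= eqxx addrA; congr (_ + _).
  by apply: eq_bigr => e /negPf->.
exists (d :: s), (fun e => if e == d then b else c e); split=> [|e|]; first by rewrite /= ds.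
  by case: eqP => [->|_].
rewrite big_cons eqxx; congr (_ + _); apply: eq_big_seq => e es.
by case: eqP => // ed; rewrite ed (negPf ds) in es *.
Qed.

Lemma grading_shift n : is_grading (fun d => deg (d + n)).
Proof.
split=> [d|d a b|a|s c us Hc Hs d ds].
- exact: (gr_zero gA).
- exact: (gr_sub gA).
- have [s [Hs E]] := gr_gen gA a; exists s; split=> // b /Hs[d Hd].
  by exists (d - n); rewrite subrK.
have H := @gr_indep _ _ gA [seq e + n | e <- s] (fun e => c (e - n)).
rewrite -(addrK n d); apply: H.
- by rewrite map_inj_uniq //; apply: addIr.
- by move=> e; have := Hc (e - n); rewrite subrK.
- by rewrite big_map -[RHS]Hs; apply: eq_bigr => e _; rewrite addrK.
exact: map_f.
Qed.

End Grading.

Variables (R : pzRingType) (M : bimodType R).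
Let L := leavitt M.
Let rs : {rmorphism R -> L} := lv_scalar M.
Notation T := (ext_mod rs).

Section ExtensionGrading.
Variable X : lmodType R.

Let W : lmodType R := dprod (fun _ : int => res rs (T X)).
Let wV (x : M) (u : W) : W := fun k => lv_vec x *: (u (k + 1) : T X).
Let wD (f : dual M) (u : W) : W := fun k => lv_dual f *: (u (k - 1) : T X).

(* A homogeneous z of degree d acts on u : int -> T X by k |-> z u (k - d): the
   L-linear map extending x |-> delta_0 x yields the projections of T X onto its
   homogeneous components. *)
Lemma twisted_module : exists (N : lmodType L) (i : {linear W -> res rs N}),
  [/\ bijective i, forall x v, i (wV x v) = lv_vec x *: (i v : N)
    & forall f v, i (wD f v) = lv_dual f *: (i v : N)].
Proof.
apply: leavitt_module.
- by move=> x u v; apply: dprodP => k; rewrite /wV scalerDr.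
- by move=> x y u; apply: dprodP => k; rewrite /wV raddfD scalerDl.
- by move=> r x u; apply: dprodP => k; rewrite /wV lv_vecZ -scalerA.
- by move=> r x u; apply: dprodP => k; rewrite /wV lv_vec_ract -scalerA.
- by move=> x u v; apply: dprodP => k; rewrite /wD scalerDr.
- by move=> x y u; apply: dprodP => k; rewrite /wD raddfD scalerDl.
- by move=> r x u; apply: dprodP => k; rewrite /wD lv_dualZ -scalerA.
- by move=> r x u; apply: dprodP => k; rewrite /wD lv_dual_ract -scalerA.
- move=> x f u; apply: dprodP => k; rewrite /wV /wD scalerA lv_vecE addrK.
  by [].
move=> n al al' B u; apply: dprodP => k.
have sumE (F : 'I_n -> W) : (\sum_j F j) k = \sum_j (F j k : T X).
  exact: (big_morph (fun u : W => u k)).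
rewrite sumE.
rewrite -[RHS](scale1r (u k : T X)) -(lv_casimirE B) scaler_suml.
by apply: eq_bigr => j _; rewrite /wD /wV scalerA subrK.
Qed.

Lemma T_component_exists : exists pr : T X -> W,
  [/\ forall t u, pr (t + u) = pr t + pr u,
      forall d z t k, lv_deg d z -> pr (z *: t) k = z *: (pr t (k - d) : T X)
    & forall x k, pr (ext_unit rs x) k = if k == 0 then ext_unit rs x else 0].
Proof.
have [N [i [[j ij ji] iV iD]]] := twisted_module.
have jD v w : j (v + w) = j v + j w.
  by apply: (can_inj ij); rewrite linearD !ji.
have j0 : j 0 = 0 by rewrite -(linear0 i) ij.
have jN v : j (- v) = - j v by apply: (can_inj ij); rewrite linearN !ji.
(* Induction on the generation of homogeneous elements: the shifts by +1 and -1 built into [wV] and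
   [wD] add up to the degree. *)
have jdeg d z : lv_deg d z -> forall u k, j (z *: (i u : N)) k = z *: (u (k - d) : T X).
  elim=> [e|e a b _ Ha _ Hb|e e' a b _ Ha _ Hb|r|x|f] u k.
  - by rewrite !scale0r j0.
  - by rewrite !scalerBl jD jN dprodDE dprodNE Ha Hb.
  - by rewrite -!scalerA -(ji (b *: (i u : N))) Ha Hb opprD addrA.
  - by rewrite -[_ *: _]/(r *: i u) -linearZ ij subr0.
  - by rewrite -iV ij opprK.
  by rewrite -iD ij.
have [g Hg] : exists g : {linear X -> W},
    forall x, g x = (fun k => if k == 0 then ext_unit rs x else 0).
  apply: exists_linear => a x y; apply: dprodP => k; rewrite dprodDE dprodZE.
  by case: eqP => _; rewrite ?scaler0 ?addr0 // linearP.
have [f Hf] := @ext_lift R L rs X N (i \o g).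
exists (fun t => j (f t)); split=> [t u|d z t k Hz|x k].
- by rewrite linearD jD.
- by rewrite linearZ -[in LHS](ji (f t)) (jdeg d).
by rewrite Hf /= ij Hg.
Qed.

Definition T_component (t : T X) (k : int) : T X := sval (cid T_component_exists) t k.

Lemma T_componentD t u k : T_component (t + u) k = T_component t k + T_component u k.
Proof. by rewrite /T_component; case: cid => pr [/= -> _ _]. Qed.
Lemma T_componentZ d z t k : lv_deg d z ->
  T_component (z *: t) k = z *: T_component t (k - d).
Proof. by rewrite /T_component; case: cid => pr [/= _ + _]; apply. Qed.
Lemma T_component_unit x k :
  T_component (ext_unit rs x) k = if k == 0 then ext_unit rs x else 0.
Proof. by rewrite /T_component; case: cid => pr [/= _ _ ->]. Qed.
Lemma T_component0 k : T_component 0 k = 0.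
Proof. by apply: (@addrI _ (T_component 0 k)); rewrite -T_componentD !addr0. Qed.
Lemma T_componentB t u k : T_component (t - u) k = T_component t k - T_component u k.
Proof. by apply: (@addIr _ (T_component u k)); rewrite -T_componentD !subrK. Qed.

Inductive Tdeg : int -> T X -> Prop :=
  | Tdeg0 d : Tdeg d 0
  | TdegB d t u : Tdeg d t -> Tdeg d u -> Tdeg d (t - u)
  | TdegZ d z x : lv_deg d z -> Tdeg d (z *: (ext_unit rs x : T X)).

Lemma T_component_homogeneous d t : Tdeg d t ->
  forall k, T_component t k = if k == d then t else 0.
Proof.
elim=> [e|e u v _ Hu _ Hv|e z x Hz] k.
- by rewrite T_component0; case: eqP.
- by rewrite T_componentB Hu Hv; case: eqP; rewrite ?subrr.
by rewrite (T_componentZ _ _ Hz) T_component_unit subr_eq0; case: eqP; rewrite ?scaler0.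
Qed.

Lemma Tdeg_scale d e z t : lv_deg d z -> Tdeg e t -> Tdeg (d + e) (z *: t).
Proof.
move=> Hz; elim=> [f|f u v _ Hu _ Hv|f y x Hy]; first by rewrite scaler0; apply: Tdeg0.
  by rewrite scalerBr; apply: TdegB.
by rewrite scalerA; apply/TdegZ/lv_degM.
Qed.

Lemma Tdeg_unit x : Tdeg 0 (ext_unit rs x).
Proof. by rewrite -[ext_unit _ _](scale1r (_ : T X)); apply/TdegZ/lv_deg1. Qed.

Lemma Tdeg_gen t : exists s : seq (T X),
  (forall b, b \in s -> exists d, Tdeg d b) /\ t = \sum_(b <- s) b.
Proof.
elim/ext_mod_ind: t => [|t [s [Hs ->]]|t u [s [Hs ->]] [l [Hl ->]]|a t [s [Hs ->]]|x].
- by exists [::]; rewrite big_nil.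
- exists [seq - b | b <- s]; rewrite big_map sumrN; split=> // _ /mapP[b /Hs[d Hd] ->].
  by exists d; rewrite -sub0r; apply: TdegB => //; apply: Tdeg0.
- exists (s ++ l); rewrite big_cat; split=> // b.
  by rewrite mem_cat => /orP[/Hs|/Hl].
- have [l [Hl ->]] := gr_gen (lv_grading M) a.
  exists [seq x *: y | x <- l, y <- s]; split.
    move=> _ /allpairsP[[x y] /= [/Hl[d Hd] /Hs[e He] ->]].
    by exists (d + e); apply: Tdeg_scale.
  rewrite big_allpairs_dep scaler_suml; apply: eq_bigr => x _.
  by rewrite scaler_sumr.
exists [:: (ext_unit rs x : T X)]; rewrite big_seq1; split=> // b.
by rewrite inE => /eqP->; exists 0; apply: Tdeg_unit.
Qed.

(** Generation is inherited from the grading of L; independence holds because the component of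
    degree d of a sum of homogeneous terms is its term of degree d. *)
Lemma T_grading : is_grading Tdeg.
Proof.
split=> [||a|s c us Hc Hs d ds]; [exact: Tdeg0|exact: TdegB|exact: Tdeg_gen|].
have : T_component (\sum_(e <- s) c e) d = 0 by rewrite Hs T_component0.
rewrite (big_morph (fun t => T_component t d) (fun t u => T_componentD t u d)
  (T_component0 d)).
rewrite (bigD1_seq d) //= (T_component_homogeneous (Hc d)) eqxx big1 ?addr0 //.
by move=> e ne; rewrite (T_component_homogeneous (Hc e)) eq_sym (negPf ne).
Qed.

Lemma T_component_deg t k : Tdeg k (T_component t k).
Proof.
have [s [Hs ->]] := Tdeg_gen t.
rewrite (big_morph (fun t => T_component t k) (fun t u => T_componentD t u k)
  (T_component0 k)) big_seq; apply: (grading_sum T_grading) => b /Hs[d Hd].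
by rewrite (T_component_homogeneous Hd); case: eqP => [->|_] //; apply: Tdeg0.
Qed.

Definition T_graded (n : int) : graded_module (leavitt_graded M) :=
  @GradedModule (leavitt_graded M) (T X) (fun d => Tdeg (d + n))
    (grading_shift T_grading n)
    (fun d e a t Ha Ht => eq_ind _ (fun k => Tdeg k (a *: t)) (Tdeg_scale Ha Ht) _
       (addrA d e n)).

End ExtensionGrading.

Variable hM : fg_proj M.
Notation G := (leavitt_graded M).

(** In v = sum_j a_j^* (a_j v) the a_j v have degree e and the a_j^* have degree 1. *)
Lemma lv_vec_deg (N : graded_module G) e (v : N) :
  (forall m : M, mdeg e ((lv_vec m : G) *: v)) -> mdeg (1 + e) v.
Proof.
move=> H; have [n [al [al' B]]] := dual_basis_exists hM.
rewrite -(@casimir_expand _ _ _ _ _ (gm_car N) v B).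
apply: (grading_sum (mdeg_grading N)) => j _.
by apply: mdegZ => //; apply: lv_deg_dual.
Qed.

(** Each of the k tensor factors is removed by [lv_vec_deg] at the cost of one degree, so X is sent
    to degree k + e; L-linearity then gives all of T X. *)
Lemma T_hom_graded k (X : fp_module R) (N : graded_module G) (f : {linear T X -> N}) e :
  (forall w, mdeg e (f (jm hM k X w))) -> forall d t, Tdeg d t -> mdeg (d + k%:Z + e) (f t).
Proof.
move=> H; have {}H x : mdeg (k%:Z + e) (f (ext_unit rs x)).
  elim: k e H x => [|k IH] e H x; first by rewrite add0r; apply: H.
  rewrite intS -addrA [1 + _]addrCA; apply: IH => w; apply: lv_vec_deg => m.
  by have := H (tens m w); rewrite jmS linearZ.
move=> d t; elim=> [c|c u v _ Hu _ Hv|c z x Hz].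
- by rewrite linear0; apply: (gr_zero (mdeg_grading N)).
- by rewrite linearB; apply: (gr_sub (mdeg_grading N)).
by rewrite linearZ -addrA; apply: mdegZ.
Qed.

Lemma jm_deg k (X : fp_module R) (w : om hM k X) : Tdeg (- k%:Z) (jm hM k X w).
Proof.
elim: k w => [|k IH] w; first exact: Tdeg_unit.
have gT := T_grading X.
elim/tensor_ind: w => [|z IHz|z w IHz IHw|m x].
- by rewrite linear0; apply: Tdeg0.
- by rewrite linearN; apply: (gradingN gT).
- by rewrite linearD; apply: (gradingD gT).
by rewrite jmS intS opprD; apply: Tdeg_scale => //; apply: lv_deg_vec.
Qed.

End GradedModules.

(** * The comparison functor *)

(** The inverse is chosen: on objects by essential surjectivity, on g : X -> Y as a preimage of the
    conjugate v g u. All its laws are checked after applying F, by faithfulness. *)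
Lemma ff_es_equivalence (C D : category) (F : functor C D) :
  (forall X Y (g : hom (F X) (F Y)), exists f : hom X Y, heq (fmap F f) g) ->
  (forall X Y (f f' : hom X Y), heq (fmap F f) (fmap F f') -> heq f f') ->
  (forall Y : D, exists (X : C) (u : hom (F X) Y) (v : hom Y (F X)),
    heq (comp v u) (idm _) /\ heq (comp u v) (idm _)) ->
  is_equivalence F.
Proof.
move=> full faith es.
have es' (Y : D) : exists t : {X : C & (hom (F X) Y * hom Y (F X))%type},
    heq (comp (projT2 t).2 (projT2 t).1) (idm _) /\
    heq (comp (projT2 t).1 (projT2 t).2) (idm _).
  by have [X [u [v H]]] := es Y; exists (existT _ X (u, v)).
pose G0 Y := sval (cid (es' Y)); have HG0 Y := svalP (cid (es' Y)).
pose ob0 Y := projT1 (G0 Y).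
pose u Y : hom (F (ob0 Y)) Y := (projT2 (G0 Y)).1.
pose v Y : hom Y (F (ob0 Y)) := (projT2 (G0 Y)).2.
have vu Y : heq (comp (v Y) (u Y)) (idm _) by case: (HG0 Y).
have uv Y : heq (comp (u Y) (v Y)) (idm _) by case: (HG0 Y).
pose lift X Y (g : hom (F X) (F Y)) : hom X Y := sval (cid (full X Y g)).
have liftE X Y (g : hom (F X) (F Y)) : heq (fmap F (lift X Y g)) g.
  by rewrite /lift; case: cid.
have R (E : category) (X Y Z : E) (g g' : hom Y Z) (f f' : hom X Y) :
  heq g g' -> heq f f' -> heq (comp g f) (comp g' f') by exact: comp_heq.
have Rl (E : category) (X Y Z : E) (g g' : hom Y Z) (f : hom X Y) :
  heq g g' -> heq (comp g f) (comp g' f) by move=> H; apply: R => //; apply: heq_refl.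
have Rr (E : category) (X Y Z : E) (g : hom Y Z) (f f' : hom X Y) :
  heq f f' -> heq (comp g f) (comp g f') by move=> H; apply: R => //; apply: heq_refl.
have cancel_uv (E : category) (X Y Z : E) (p : hom Y X) (q : hom X Y) (f : hom Z X) :
    heq (comp p q) (idm X) -> heq (comp p (comp q f)) f.
  move=> H; apply: heq_trans (compA _ _ _) _.
  by apply: heq_trans (Rl _ _ _ _ _ _ _ H) _; apply: comp1m.
pose gm X Y (g : hom X Y) : hom (ob0 X) (ob0 Y) := lift _ _ (comp (v Y) (comp g (u X))).
have gmE X Y (g : hom X Y) : heq (fmap F (gm X Y g)) (comp (v Y) (comp g (u X))).
  exact: liftE.
have gm_heq X Y (g g' : hom X Y) : heq g g' -> heq (gm X Y g) (gm X Y g').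
  move=> H; apply/faith; apply: heq_trans (gmE _ _ _) _.
  apply: heq_trans _ (heq_sym (gmE _ _ _)).
  by apply/Rr/Rl.
have gm1 X : heq (gm X X (idm X)) (idm _).
  apply/faith; apply: heq_trans (gmE _ _ _) _.
  apply: heq_trans _ (heq_sym (fmap1 _ _)).
  by apply: heq_trans (Rr _ _ _ _ _ _ _ (comp1m _)) _.
have gmM X Y Z (g : hom Y Z) (f : hom X Y) :
    heq (gm X Z (comp g f)) (comp (gm Y Z g) (gm X Y f)).
  apply/faith; apply: heq_trans (gmE _ _ _) _; apply: heq_sym.
  apply: heq_trans (fmapM _ _ _) _.
  apply: heq_trans (R _ _ _ _ _ _ _ _ (gmE _ _ _) (gmE _ _ _)) _.
  apply: heq_trans (heq_sym (compA _ _ _)) _; apply/Rr.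
  apply: heq_trans (heq_sym (compA _ _ _)) _.
  apply: heq_trans _ (compA _ _ _); apply/Rr.
  exact: cancel_uv.
pose G := @Functor D C ob0 gm gm_heq gm1 gmM.
exists G; split.
  exists (fun X => lift _ _ (u (F X))), (fun X => lift _ _ (v (F X))).
  split=> [X|X|X Y f].
  - apply/faith; apply: heq_trans (fmapM _ _ _) _.
    apply: heq_trans (R _ _ _ _ _ _ _ _ (liftE _ _ _) (liftE _ _ _)) _.
    by apply: heq_trans (vu _) _; apply/heq_sym/fmap1.
  - apply/faith; apply: heq_trans (fmapM _ _ _) _.
    apply: heq_trans (R _ _ _ _ _ _ _ _ (liftE _ _ _) (liftE _ _ _)) _.
    by apply: heq_trans (uv _) _; apply/heq_sym/fmap1.
  apply/faith; apply: heq_trans (fmapM _ _ _) _.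
  apply: heq_trans _ (heq_sym (fmapM _ _ _)).
  apply: heq_trans (R _ _ _ _ _ _ _ _ (liftE _ _ _) (gmE _ _ _)) _.
  apply: heq_trans _ (Rr _ _ _ _ _ _ _ (heq_sym (liftE _ _ _))).
  exact: cancel_uv.
exists u, v; split=> // X Y f /=.
apply: heq_trans (Rr _ _ _ _ _ _ _ (gmE _ _ _)) _.
exact: cancel_uv.
Qed.

Section Comparison.
Variables (R : pzRingType) (M : bimodType R) (hM : fg_proj M).
Let L := leavitt M.
Let rs : {rmorphism R -> L} := lv_scalar M.
Notation T := (ext_mod rs).
Notation G := (leavitt_graded M).
Notation Om := (tensor_functor hM).
Notation jm := (jm hM).

Notation omhom a b X Y := (@hom (mod_cat R) (oiter Om a X) (oiter Om b Y)).

Definition as_linear a b (X Y : mod_cat R) (f : omhom a b X Y) :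
  {linear om hM a X -> om hM b Y} := f.

(** A relation instead of a chosen extension: it is stable under raising and composition, and
    [represents_uniq] then yields every functor law. *)
Definition represents a b (X Y : mod_cat R) (f : omhom a b X Y)
    (g : {linear T (X : fp_module R) -> T (Y : fp_module R)}) : Prop :=
  forall w, g (jm a X w) = jm b Y (as_linear f w).

Lemma represents_exists a b (X Y : mod_cat R) (f : omhom a b X Y) :
  exists g, represents f g.
Proof. by have [g Hg] := T_lift (jm b Y \o as_linear f); exists g. Qed.

Lemma represents_uniq a b (X Y : mod_cat R) (f : omhom a b X Y) g g' :
  represents f g -> represents f g' -> g =1 g'.
Proof. by move=> H H'; apply: (@T_hom_eq R M hM a) => w; rewrite H H'. Qed.

(** With [g'] the restriction of g to X, the hypothesis says that f carries [itr a g'] to [jm b Y];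
    this persists when both sides are tensored with M^k. *)
Lemma represents_raise k a b (X Y : mod_cat R) (f : omhom a b X Y) g :
  represents f g -> represents (raise k f) g.
Proof.
move=> H w; have [g' Hg'] := T_hom_restrict hM 0 g.
rewrite -[RHS](@itr_raise R M hM _ _ X Y a b g') => [|{}w].
  by apply: lin_itr => x; rewrite Hg'.
by rewrite -[RHS]H; apply/esym/lin_itr => x; rewrite Hg'.
Qed.

Lemma jm_ocast a b (e : a = b) (X : mod_cat R) w :
  jm b X (as_linear (ocast Om e X) w) = jm a X w.
Proof. by case: b / e. Qed.

Lemma represents_comp a b c (X Y Z : mod_cat R) (f : omhom a b X Y) (f' : omhom b c Y Z) g g' :
  represents f g -> represents f' g' -> represents (comp f' f) (g' \o g).
Proof. by move=> H H' w; rewrite /= H H'. Qed.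

Lemma represents_cast a b c (e : b = c) (X Y : mod_cat R) (f : omhom a b X Y) g :
  represents f g -> represents (comp (ocast Om e Y) f) g.
Proof. by move=> H w; rewrite H -(jm_ocast e). Qed.

Lemma represents_scomp (A B D : mod_cat R * int) (g : shom Om B D) (f : shom Om A B) u v :
  represents (smor f) u -> represents (smor g) v ->
  represents (smor (scomp g f)) (v \o u).
Proof.
move=> Hu Hv; apply: represents_comp; last exact: represents_raise.
exact/represents_cast/represents_raise.
Qed.

Lemma represents_rel_hom a b a' b' (X Y : mod_cat R) (f : omhom a b X Y)
    (f' : omhom a' b' X Y) g : rel_hom f f' -> represents f g -> represents f' g.
Proof.
move=> H; have [ea [eb _]] := H; subst a' b'; move/rel_homE: H => H Hf w.
by rewrite Hf /as_linear H.
Qed.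

Lemma represents_faithful a b a' b' (X Y : mod_cat R) (f : omhom a b X Y)
    (f' : omhom a' b' X Y) g : a = a' -> b = b' ->
  represents f g -> represents f' g -> exists p, rel_hom (raise p f) (raise p f').
Proof.
move=> ea eb; subst a' b' => H H'.
have [p Hp] := @jm_faithful R M hM X Y a b (as_linear f \- as_linear f')
  (fun w => etrans (linearB _ _ _) (etrans (f_equal2 _ (esym (H w)) (f_equal _ (esym (H' w))))
    (subrr _))).
exists p; apply/rel_homE => w; apply/eqP; rewrite -subr_eq0; apply/eqP.
rewrite -[RHS](Hp w).
elim: p w {Hp} => [|p IH] // w.
apply: (@linear_tensor_ext R M _ _
  (tensor_map M (as_linear (raise p f)) \- tensor_map M (as_linear (raise p f')))
  (tensor_map M (om_raise p (as_linear f \- as_linear f')))) => m x.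
by rewrite /= !tensor_mapE -IH -tensNr -tensDr.
Qed.

Lemma shom_represents (A B : mod_cat R * int) (f : shom Om A B) g :
  represents (smor f) g ->
  forall d t, Tdeg (d + A.2) t -> Tdeg (d + B.2) (g t).
Proof.
move=> H d t Ht.
(* M^(sb f) (x) Y has degree -(sb f) in T Y, hence this degree after the shift by B.2; the level
   condition of f turns it into -(A.2 + sa f). *)
have Hg w : mdeg (g := T_graded M (B.1 : fp_module R) B.2) (- (sb f)%:Z - B.2) (g (jm (sa f) A.1 w)).
  by rewrite H /= subrK; apply: jm_deg.
have := T_hom_graded Hg Ht.
suff -> : d + A.2 + (sa f)%:Z + (- (sb f)%:Z - B.2) = d by [].
by rewrite -(addrA d) (slevel f); lia.
Qed.

Definition leavitt_ob (A : mod_cat R * int) : fp_graded_module G :=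
  @FpGradedModule G (T_graded M (A.1 : fp_module R) A.2)
    (ext_fin_pres rs (fp_fin_pres (A.1 : fp_module R))).

Lemma leavitt_hom_exists (A B : mod_cat R * int) (f : shom Om A B) :
  exists g : graded_hom (leavitt_ob A) (leavitt_ob B), represents (smor f) (gh_fun g).
Proof.
have [g Hg] := represents_exists (smor f).
by exists (@GradedHom _ (leavitt_ob A) (leavitt_ob B) g (shom_represents Hg)).
Qed.

Definition leavitt_hom A B (f : shom Om A B) : graded_hom (leavitt_ob A) (leavitt_ob B) :=
  sval (cid (leavitt_hom_exists f)).

Lemma leavitt_homP A B (f : shom Om A B) : represents (smor f) (gh_fun (leavitt_hom f)).
Proof. by rewrite /leavitt_hom; case: cid. Qed.

Arguments leavitt_homP {A B} f w.

Lemma sheqE A B (f f' : shom Om A B) g g' :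
  represents (smor f) g -> represents (smor f') g' -> sheq f f' <-> g =1 g'.
Proof.
move=> H H'; split=> [/sheqP[k [l E]]|E].
  apply: (represents_uniq (f := raise l (smor f'))); last exact: represents_raise.
  by apply: represents_rel_hom E _; apply: represents_raise.
(* Raising each map by the source exponent of the other makes the sources equal; the two level
   conditions then make the targets equal. *)
have ea : (sa f' + sa f = sa f + sa f')%N by rewrite addnC.
have eb : (sa f' + sb f = sa f + sb f')%N.
  by have := slevel f; have := slevel f'; lia.
have [p Hp] := represents_faithful ea eb (represents_raise (k := sa f') H)
  (represents_raise (k := sa f) (fun w => etrans (E _) (H' w))).
apply/sheqP; exists (p + sa f')%N, (p + sa f)%N.
apply: rel_hom_trans (rel_hom_sym (rel_hom_raiseD _ _ _)) _.
exact: rel_hom_trans Hp (rel_hom_raiseD _ _ _).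
Qed.

Lemma leavitt_hom_heq A B (f f' : shom Om A B) : sheq f f' -> leavitt_hom f =1 leavitt_hom f'.
Proof. by move=> H; have [E _] := sheqE (leavitt_homP f) (leavitt_homP f'); apply: E. Qed.

Lemma leavitt_hom1 A : leavitt_hom (sid Om A) =1 graded_id (leavitt_ob A).
Proof. by apply: (represents_uniq (leavitt_homP _)). Qed.

Lemma leavitt_homM A B D (g : shom Om B D) (f : shom Om A B) :
  leavitt_hom (scomp g f) =1 graded_comp (leavitt_hom g) (leavitt_hom f).
Proof.
by apply: (represents_uniq (leavitt_homP _)); apply: represents_scomp; apply: leavitt_homP.
Qed.

Definition leavitt_functor : functor (stab Om) (grmod_cat G) :=
  @Functor (stab Om) (grmod_cat G) leavitt_ob leavitt_hom leavitt_hom_heq leavitt_hom1 leavitt_homM.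

End Comparison.

Arguments leavitt_homP {R M hM A B} f w.

(** * Fullness *)

Section Fullness.
Variables (R : pzRingType) (M : bimodType R) (hM : fg_proj M).
Let L := leavitt M.
Let rs : {rmorphism R -> L} := lv_scalar M.
Notation T := (ext_mod rs).
Notation Om := (tensor_functor hM).
Notation jm := (jm hM).

Section Reach.
Variable Y : fp_module R.
Notation word := (word (lv_alg (T Y))).

Definition reaches (q p : nat) (v : T Y) : Prop :=
  forall s, size s = p -> exists w : om hM q Y, jm q Y w = word s v.

Lemma lv_word_rcons s m (v : T Y) : word (rcons s m) v = word s (lv_vec m *: v).
Proof. by rewrite word_rcons lv_algE. Qed.

Lemma reaches0 q p : reaches q p 0.
Proof. by move=> s _; exists 0; rewrite linear0 word0. Qed.
Lemma reachesD q p v w : reaches q p v -> reaches q p w -> reaches q p (v + w).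
Proof.
move=> Hv Hw s Hs; have [x Ex] := Hv s Hs; have [y Ey] := Hw s Hs.
by exists (x + y); rewrite linearD wordD Ex Ey.
Qed.
Lemma reachesN q p v : reaches q p v -> reaches q p (- v).
Proof.
by move=> Hv s Hs; have [x Ex] := Hv s Hs; exists (- x); rewrite linearN wordN Ex.
Qed.
Lemma reaches_scalar q p r v : reaches q p v -> reaches q p (lv_scalar M r *: v).
Proof.
move=> Hv; elim/last_ind => [|s m _] Hs.
  by have [x Ex] := Hv [::] Hs; exists (r *: x); rewrite linearZ Ex.
rewrite lv_word_rcons scalerA -lv_vec_ract -lv_word_rcons; apply: Hv.
by rewrite -Hs !size_rcons.
Qed.
Lemma reaches_vec q p (x : M) v : reaches q p.+1 v -> reaches q p (lv_vec x *: v).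
Proof. by move=> Hv s Hs; rewrite -lv_word_rcons; apply: Hv; rewrite size_rcons Hs. Qed.
Lemma reaches_dual q p (f : dual M) v : reaches q p v -> reaches q p.+1 (lv_dual f *: v).
Proof.
move=> Hv; elim/last_ind => [//|s m _]; rewrite size_rcons => -[Hs].
by rewrite lv_word_rcons scalerA lv_vecE; apply: reaches_scalar Hs.
Qed.

(** A word of length p moves degree d to d - p, and M^q (x) Y maps to degree -q; hence q = p - d. *)
Definition ev_reaches (d : int) (v : T Y) : Prop :=
  exists p0, forall p q : nat, (p0 <= p)%N -> q%:Z = p%:Z - d -> reaches q p v.

(** Multiplication by x in M supplies one letter of the word, multiplication by f in M^* uses one
    up; scalars are absorbed by the innermost letter. *)
Lemma ev_reaches_deg e z : lv_deg e z ->
  forall d v, ev_reaches d v -> ev_reaches (e + d) (z *: v).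
Proof.
elim=> [{}e|{}e a b _ Ha _ Hb|{}e e' a b _ Ha _ Hb|r|x|f] d v Hv.
- by exists 0%N => p q _ _; rewrite scale0r; apply: reaches0.
- have [p1 H1] := Ha d v Hv; have [p2 H2] := Hb d v Hv.
  exists (maxn p1 p2) => p q; rewrite geq_max => /andP[h1 h2] E.
  by rewrite scalerBl; apply: reachesD; [apply: H1|apply/reachesN/H2].
- by rewrite -scalerA -addrA; apply/Ha/Hb.
- have [p0 H] := Hv; exists p0 => p q hp E; apply/reaches_scalar/H => //.
  by rewrite E add0r.
- have [p0 H] := Hv; exists p0 => p q hp E; apply/reaches_vec/H; first exact: leqW.
  by rewrite E; lia.
have [p0 H] := Hv; exists p0.+1 => -[//|p] q hp E; apply/reaches_dual/H => //.
by rewrite E; lia.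
Qed.

Lemma ev_reaches_unit y : ev_reaches 0 (ext_unit rs y).
Proof.
exists 0%N => p q _ E s Hs; have -> : q = size s by rewrite Hs; lia.
elim: s {p q E Hs} => [|m s [w Hw]]; first by exists y.
by exists (tens m w); rewrite jmS Hw /= lv_algE.
Qed.

Lemma Tdeg_ev_reaches d t : Tdeg d t -> ev_reaches d t.
Proof.
elim=> [{}d|{}d u v _ [p1 H1] _ [p2 H2]|{}d z x Hz].
- by exists 0%N => p q _ _; apply: reaches0.
- exists (maxn p1 p2) => p q; rewrite geq_max => /andP[h1 h2] E.
  by apply: reachesD; [apply: H1|apply/reachesN/H2].
by rewrite -[d]addr0; apply: ev_reaches_deg => //; apply: ev_reaches_unit.
Qed.

End Reach.

Definition free_module n : fp_module R := FpModule (fg_proj_fin_pres (fg_proj_row R n)).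

Lemma om_raise_exact p a b c (X Y Z : fp_module R) (r : {linear om hM a X -> om hM b Y})
    (s : {linear om hM b Y -> om hM c Z}) :
  (forall z, exists y, s y = z) -> (forall y, s y = 0 <-> exists x, y = r x) ->
  (forall z, exists y, om_raise p s y = z) /\
  (forall y, om_raise p s y = 0 <-> exists x, y = om_raise p r x).
Proof.
move=> Hs Hr; elim: p => [|p [IHs IHr]] //.
exact: tensor_right_exact IHs IHr.
Qed.

Lemma image_level (X Y : fp_module R) (g : {linear T X -> T Y}) e :
  (forall x, Tdeg e (g (ext_unit rs x))) ->
  exists p q : nat, p%:Z = q%:Z + e /\
    forall w : om hM p X, exists u : om hM q Y, jm q Y u = g (jm p X w).
Proof.
move=> Hg; have [n [x Hx]] := fin_pres_gen (fp_fin_pres X).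
have /choice[p0 Hp0] : forall i : 'I_n, exists p0, forall p q : nat,
    (p0 <= p)%N -> q%:Z = p%:Z - e -> reaches q p (g (ext_unit rs (x i))).
  by move=> i; apply: Tdeg_ev_reaches.
(* The summand |e| makes P - e nonnegative, so that q is an honest exponent; the maximum serves all
   generators of X. *)
pose P := (`|e|%N + \max_i p0 i)%N; pose q := absz (P%:Z - e).
have Eq : q%:Z = P%:Z - e by rewrite /q /P; lia.
exists P, q; split=> [|w]; first by rewrite Eq subrK.
have H0 y : reaches q P (g (ext_unit rs y)).
  have [c ->] := Hx y; rewrite !linear_sum.
  apply: (big_ind (reaches q P)) => [||i _]; [exact: reaches0|exact: reachesD|].
  rewrite linearZ [g _]linearZ; apply/reaches_scalar/Hp0 => //.
  by apply: leq_trans (leq_bigmax i) _; apply: leq_addl.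
(* Tensor factors of [u] are moved one at a time into the word [t], until only an element of X is
   left and [H0] applies. *)
suff H k (u : om hM k X) t : (size t + k)%N = P ->
    exists v, jm q Y v = word (lv_alg (T Y)) t (g (jm k X u)).
  by have [v Hv] := H P w [::] erefl; exists v.
elim: k u t => [|k IH] u t Ht; first by apply: H0; rewrite -Ht addn0.
elim/tensor_ind: u => [|z [v Hv]|z z' [v Hv] [v' Hv']|m y].
- by exists 0; rewrite !linear0 word0.
- by exists (- v); rewrite !linearN wordN Hv.
- by exists (v + v'); rewrite !linearD wordD Hv Hv'.
rewrite jmS linearZ -lv_word_rcons; apply: IH.
by rewrite size_rcons addSnnS.
Qed.

Lemma represents_full (X Y : fp_module R) (g : {linear T X -> T Y}) e :
  (forall x, Tdeg e (g (ext_unit rs x))) ->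
  exists (a b : nat) (f : @hom (mod_cat R) (oiter Om a X) (oiter Om b Y)),
    a%:Z = b%:Z + e /\ represents f g.
Proof.
move=> /image_level[p [q [E Hpq]]].
have [m [n [rho [s [Hs Hrho]]]]] := fp_fin_pres (om hM p X).
have /choice[y Hy] : forall i, exists y : om hM q Y, jm q Y y = g (jm p X (s (delta_mx 0 i))).
  by move=> i; apply: Hpq.
have [l Hl] := row_lift y.
have gl v : jm q Y (l v) = g (jm p X (s v)).
  rewrite Hl linear_sum {2}(row_sum v) !linear_sum; apply: eq_bigr => i _.
  by rewrite !linearZ /= Hy.
(* The presentation of M^p (x) X and the lift [l] are retyped as maps between tensor powers, so that
   they can be raised. *)
pose s0 : {linear om hM 0 (free_module n) -> om hM p X} := s.
pose r0 : {linear om hM 0 (free_module m) -> om hM 0 (free_module n)} := rho.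
pose l0 : {linear om hM 0 (free_module n) -> om hM q Y} := l.
(* The lift need not respect the relations in M^q (x) Y, but their images vanish in T Y. As they are
   finitely generated, faithfulness kills them all after tensoring with one M^k; right exactness
   then lets the raised lift descend. *)
have [k Hk] : exists k, forall z, om_raise k (l0 \o r0) z = 0.
  apply: jm_faithful => w; rewrite [LHS](gl (rho w)).
  have -> : s (rho w) = 0 by apply/Hrho; exists w.
  by rewrite !linear0.
have raise_lr z : om_raise k (l0 \o r0) z = om_raise k l0 (om_raise k r0 z).
  exact: (@raise_comp (mod_cat R) Om k 0 0 q (free_module m) (free_module n) Y l0 r0).
have [Hsk Hrk] := om_raise_exact k (s := s0) (r := r0) Hs Hrho.
have [|f Hf] := linear_surj_lift (p := om_raise k s0) (f := om_raise k l0) Hsk.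
  by move=> u /Hrk[w ->]; rewrite -raise_lr Hk.
exists (k + p)%N, (k + q)%N, f; split; first by rewrite !PoszD E addrA.
move=> w; have [v <-] := Hsk w; rewrite [as_linear _ _]Hf.
have [g' Hg'] := T_hom_restrict hM 0 g.
have [g0 Hg0] : exists g0 : {linear free_module n -> res rs (T Y)}, forall v, g0 v = jm q Y (l v).
  by exists (jm q Y \o l).
rewrite -[RHS](@itr_raise R M hM _ _ (free_module n) Y 0 q g0) => [|{}v]; last exact: Hg0.
rewrite (lin_itr (h' := g')); last by move=> x; rewrite Hg'.
apply/esym/(@itr_raise R M hM _ _ (free_module n) X 0 p g0) => {}v.
rewrite [LHS]Hg0 gl; apply: lin_itr => x; by rewrite Hg'.
Qed.

End Fullness.

(** * Essential surjectivity *)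

Section LinearSpan.
Variables (A : pzRingType) (N : lmodType A).

Inductive lspan (B : N -> Prop) : N -> Prop :=
  | lspan0 : lspan B 0
  | lspanD v w : lspan B v -> lspan B w -> lspan B (v + w)
  | lspanZ a v : lspan B v -> lspan B (a *: v)
  | lspan_mem v : B v -> lspan B v.

Lemma lspan_sum B I (s : seq I) (F : I -> N) :
  (forall i, lspan B (F i)) -> lspan B (\sum_(i <- s) F i).
Proof. by move=> H; apply: big_ind => //; [apply: lspan0|apply: lspanD]. Qed.

Lemma lspan_sub (B C : N -> Prop) v :
  (forall b, B b -> lspan C b) -> lspan B v -> lspan C v.
Proof.
move=> H; elim=> [|{}v w _ Hv _ Hw|a {}v _ Hv|{}v /H //].
- exact: lspan0.
- exact: lspanD.
exact: lspanZ.
Qed.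

Lemma lspan_finite B v : lspan B v ->
  exists bs : seq N, (forall b, b \in bs -> B b) /\ lspan (fun b => b \in bs) v.
Proof.
elim=> [|{}v w _ [s [Hs Sv]] _ [t [Ht Sw]]|a {}v _ [s [Hs Sv]]|{}v Bv].
- by exists [::]; split=> //; apply: lspan0.
- exists (s ++ t); split=> [b|]; first by rewrite mem_cat => /orP[/Hs|/Ht].
  apply: lspanD; [apply: lspan_sub Sv|apply: lspan_sub Sw] => b bs;
    by apply: lspan_mem; rewrite mem_cat bs ?orbT.
- by exists s; split=> //; apply: lspanZ.
exists [:: v]; split=> [b|]; first by rewrite inE => /eqP->.
by apply: lspan_mem; rewrite inE.
Qed.

Lemma lspan_finite_seq B (vs : seq N) : (forall v, v \in vs -> lspan B v) ->
  exists bs : seq N, (forall b, b \in bs -> B b) /\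
    forall v, v \in vs -> lspan (fun b => b \in bs) v.
Proof.
elim: vs => [|v vs IH] H; first by exists [::].
have [|s [Hs Ss]] := IH; first by move=> w ws; apply: H; rewrite inE ws orbT.
have [|t [Ht St]] := @lspan_finite B v; first by apply: H; rewrite inE eqxx.
exists (s ++ t); split=> [b|w]; first by rewrite mem_cat => /orP[/Hs|/Ht].
rewrite inE => /orP[/eqP->|/Ss Sw]; [apply: lspan_sub St|apply: lspan_sub Sw] => b bs;
  by apply: lspan_mem; rewrite mem_cat bs ?orbT.
Qed.

Lemma lspan_ker (N' : lmodType A) (f : {linear N -> N'}) B v :
  (forall b, B b -> f b = 0) -> lspan B v -> f v = 0.
Proof.
move=> H; elim=> [|{}v w _ Hv _ Hw|a {}v _ Hv|{}v /H //].
- exact: linear0.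
- by rewrite linearD Hv Hw addr0.
by rewrite linearZ /= Hv scaler0.
Qed.

Lemma lspan_image (N' : lmodType A) (f : {linear N' -> N}) B v :
  (forall b, B b -> exists u, f u = b) -> lspan B v -> exists u, f u = v.
Proof.
move=> H; elim=> [|{}v w _ [x <-] _ [y <-]|a {}v _ [x <-]|{}v /H //].
- by exists 0; apply: linear0.
- by exists (x + y); apply: linearD.
by exists (a *: x); apply: linearZ.
Qed.

Lemma fin_gen_lspan : fin_gen N ->
  exists gs : seq N, forall v, lspan (fun b => b \in gs) v.
Proof.
case=> n [g Hg]; exists [seq g i | i <- enum 'I_n] => v; have [c ->] := Hg v.
apply: lspan_sum => i; apply/lspanZ/lspan_mem.
by apply: map_f; rewrite mem_enum.
Qed.

End LinearSpan.

(* Schanuel's argument. *)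
Lemma fin_pres_kernel (A : pzRingType) (N P : lmodType A) (f : {linear P -> N}) :
  fg_proj P -> fin_pres N -> (forall v, exists p, f p = v) ->
  exists ks : seq P, (forall k, k \in ks -> f k = 0) /\
    forall p, f p = 0 -> lspan (fun k => k \in ks) p.
Proof.
move=> [[k [g Hg]] prP] [m [n [rho [s [Hs Hr]]]]] Hf.
have [a Ha] := (fg_proj_row A n).2 _ _ f s Hf.
have [b Hb] := prP _ _ s f Hs.
(* For p in the kernel write p = (p - a (b p)) + a (b p). The first summand is a combination of the
   g_i - a (b g_i); in the second, b p is a relation, hence a combination of the rho e_i. *)
exists ([seq a (rho (delta_mx 0 i)) | i <- enum 'I_m] ++
        [seq g i - a (b (g i)) | i <- enum 'I_k]); split.
  move=> x; rewrite mem_cat => /orP[] /mapP[i _ ->].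
    by rewrite Ha; apply/Hr; exists (delta_mx 0 i).
  by rewrite linearB /= Ha Hb subrr.
move=> p fp; have [w Ew] : exists w, b p = rho w by apply/Hr; rewrite Hb.
rewrite -[p](subrK (a (b p))); apply: lspanD; last first.
  rewrite Ew {1}(row_sum w) !linear_sum; apply: lspan_sum => i.
  rewrite !linearZ; apply/lspanZ/lspan_mem.
  by rewrite mem_cat (map_f (fun i => a (rho (delta_mx 0 i)))) ?mem_enum.
have [c {1 2}->] := Hg p; rewrite [b _]linear_sum [a _]linear_sum -sumrB; apply: lspan_sum => i.
rewrite [b _]linearZ [a _]linearZ -scalerBr; apply/lspanZ/lspan_mem.
by rewrite mem_cat (map_f (fun i => g i - a (b (g i)))) ?mem_enum ?orbT.
Qed.


(** * Moving generators and relations to a single degree *)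

Section EssentialSurjectivity.

(** Uniqueness of homogeneous components, from independence. When d is missing from s it is added
    with coefficient -y. *)
Lemma grading_components (A : zmodType) (deg : int -> A -> Prop) (gA : is_grading deg)
    (s : seq int) (c : int -> A) d y : uniq s -> (forall e, deg e (c e)) ->
  deg d y -> \sum_(e <- s) c e = y -> forall e, e \in s -> c e = if e == d then y else 0.
Proof.
move=> us Hc Hy E; have [ds|ds] := boolP (d \in s).
  move=> e es; apply/eqP; rewrite -subr_eq0; apply/eqP.
  apply: (gr_indep gA (c := fun e => c e - if e == d then y else 0) us) => [f||] //.
    by apply: (gr_sub gA) => //; case: eqP => [->|_] //; apply: (gr_zero gA).
  rewrite sumrB E (bigD1_seq d) //= eqxx big1 ?addr0 ?subrr // => f /negPf->.
  by [].
move=> e es; have ed : e != d by apply: contraNneq ds => <-.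
rewrite (negPf ed).
have := @gr_indep _ _ gA (d :: s) (fun e => if e == d then - y else c e) _ _ _ e.
rewrite (negPf ed) inE es orbT; apply=> //=; first by rewrite ds.
  by move=> f; case: eqP => [->|_] //; apply: (gradingN gA).
rewrite big_cons eqxx; apply/eqP; rewrite addrC subr_eq0 -E; apply/eqP.
apply: eq_big_seq => f fs; case: eqP => // fd.
by rewrite fd (negPf ds) in fs.
Qed.

Variables (R : pzRingType) (M : bimodType R) (hM : fg_proj M).
Let L := leavitt M.
Let rs : {rmorphism R -> L} := lv_scalar M.
Notation T := (ext_mod rs).
Notation G := (leavitt_graded M).
Notation Om := (tensor_functor hM).
Notation jm := (jm hM).

(** For y of degree d, the components of g y in other degrees are sent to 0 by f, hence vanish. *)
Lemma graded_inverse (X Y : graded_module G) (f : graded_hom X Y) (g : {linear Y -> X}) :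
  cancel f g -> cancel g f -> exists h : graded_hom Y X, forall y, h y = g y.
Proof.
move=> fg gf; suff H d y : mdeg d y -> mdeg d (g y) by exists (@GradedHom _ Y X g H).
move=> Hy; have [s [c [us Hc E]]] := homogeneous_components (mdeg_grading X) (g y).
rewrite E big_seq; apply: (grading_sum (mdeg_grading X)) => e es.
have := grading_components (mdeg_grading Y) (c := fun e => f (c e)) us
  (fun e => gh_deg f (Hc e)) Hy _ es.
rewrite -linear_sum -E gf => /(_ erefl); case: eqP => [<- _ //|_ fc].
rewrite -[c e]fg fc linear0; exact: (gr_zero (mdeg_grading X)).
Qed.

(** The Casimir relation iterated p times; it replaces a generator by finitely many others whose
    degree is lower by p. *)
Lemma word_span (N : lmodType L) p (v : N) :
  lspan (fun b : N => exists s, size s = p /\ b = word (lv_alg N) s v) v.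
Proof.
elim: p v => [|p IH] v; first by apply: lspan_mem; exists [::].
have [n [al [al' B]]] := dual_basis_exists hM.
rewrite -[X in lspan _ X](casimir_expand v B); apply: lspan_sum => j.
apply: lspanZ; apply: lspan_sub (IH _) => b [s [Hs ->]]; apply: lspan_mem.
by exists (rcons s (al j)); rewrite size_rcons Hs word_rcons lv_algE.
Qed.

Lemma word_deg (N : graded_module G) s d (v : N) : mdeg d v ->
  mdeg (d - (size s)%:Z) (word (lv_alg (gm_car N)) s v : N).
Proof.
move=> Hv; elim: s => [|m s IH]; first by rewrite subr0.
rewrite /= lv_algE intS opprD addrCA; apply: mdegZ => //.
exact: lv_deg_vec.
Qed.

(** Serves both generators (S everything) and relations (S the kernel of a cover). S contains the
    components of its elements, and [B c] spans each homogeneous element of S once c is large;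
    finitely many elements then share a level. *)
Lemma span_by_level (N : graded_module G) (S : N -> Prop) (B : nat -> N -> Prop) (vs : seq N) :
  (forall s c, uniq s -> (forall d, mdeg d (c d)) -> S (\sum_(d <- s) c d) ->
     forall d, d \in s -> S (c d)) ->
  (forall d v, mdeg d v -> S v -> exists c0, forall c, (c0 <= c)%N -> lspan (B c) v) ->
  (forall v, v \in vs -> S v) ->
  exists (c : nat) (bs : seq N), (forall b, b \in bs -> B c b) /\
    forall v, v \in vs -> lspan (fun b => b \in bs) v.
Proof.
move=> HS HB Hvs.
have level v : S v -> exists c0, forall c, (c0 <= c)%N -> lspan (B c) v.
  have [s [c [us Hc ->]]] := homogeneous_components (mdeg_grading N) v.
  move=> Sv; have {Sv us}: forall d, d \in s -> S (c d) by apply: HS.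
  elim: s => [|d s IH] H; first by exists 0%N => k _; rewrite big_nil; apply: lspan0.
  have [|c1 H1] := HB d (c d) (Hc d); first by apply: H; rewrite inE eqxx.
  have [|c2 H2] := IH; first by move=> e es; apply: H; rewrite inE es orbT.
  exists (maxn c1 c2) => k; rewrite geq_max => /andP[/H1 ? /H2 ?].
  by rewrite big_cons; apply: lspanD.
have [c0 Hc0] : exists c0, forall v, v \in vs -> lspan (B c0) v.
  have [c0 Hc0] : exists c0, forall c, (c0 <= c)%N -> forall v, v \in vs -> lspan (B c) v.
    elim: vs Hvs => [|v vs IH] H; first by exists 0%N.
    have [|c1 H1] := level v; first by apply: H; rewrite inE eqxx.
    have [|c2 H2] := IH; first by move=> w ws; apply: H; rewrite inE ws orbT.
    exists (maxn c1 c2) => k; rewrite geq_max => /andP[/H1 ? /H2 h2] w.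
    by rewrite inE => /orP[/eqP->|/h2].
  by exists c0; apply: Hc0.
by have [bs Hbs] := lspan_finite_seq Hc0; exists c0, bs.
Qed.

Lemma graded_cover (N : graded_module G) : fin_gen N ->
  exists k (p : nat) (f : graded_hom (T_graded M (free_module R k) p%:Z) N),
    forall v, exists t, f t = v.
Proof.
move=> /fin_gen_lspan[gs Hgs].
have [//|d v Hv _|//|p [bs [Hbs Sbs]]] :=
    @span_by_level N (fun=> True) (fun p b => mdeg (- p%:Z) b) gs.
  (* For p >= |d| the number p + d is a word length, and such words bring degree d to -p. *)
  exists (absz d) => p hp.
  apply: lspan_sub (word_span (absz (p%:Z + d)) v) => b [s [Hs ->]]; apply: lspan_mem.
  have -> : - p%:Z = d - (size s)%:Z by rewrite Hs; lia.
  exact: word_deg.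
have [h Hh] := @row_lift R (res rs (gm_car N)) (size bs) (fun i => bs`_i).
have [f Hf] := @T_lift R M hM 0 (free_module R (size bs)) (gm_car N) h.
have fdeg d t : mdeg (g := T_graded M (free_module R (size bs)) p%:Z) d t -> mdeg d (f t).
  have H w : mdeg (- p%:Z) (f (jm 0 (free_module R (size bs)) w)).
    rewrite Hf Hh; apply: (grading_sum (mdeg_grading N)) => i _.
    rewrite -[- _]add0r; apply: mdegZ; first exact: lv_deg_scalar.
    exact/Hbs/mem_nth.
  by move=> Ht; have := T_hom_graded H Ht; rewrite addr0 addrK.
exists (size bs), p, (@GradedHom G (T_graded M (free_module R (size bs)) p%:Z) N f fdeg).
move=> v; apply: (@lspan_image _ _ _ f _ _ _ (Hgs v)) => b /Sbs.
apply: lspan_image => {}b bbs; have ib : (index b bs < size bs)%N by rewrite index_mem.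
exists (ext_unit rs (delta_mx 0 (Ordinal ib) : free_module R (size bs))).
rewrite [LHS](Hf (delta_mx 0 (Ordinal ib) : free_module R (size bs))) Hh.
rewrite (bigD1 (Ordinal ib)) //= big1 => [|i ne].
  by rewrite mxE !eqxx /= scale1r addr0 nth_index.
by rewrite mxE (negPf ne) andbF scale0r.
Qed.

Lemma om_fg_proj k (X : fp_module R) : fg_proj X -> fg_proj (om hM k X).
Proof. by move=> HX; elim: k => //= k IH; apply: tensor_fg_proj. Qed.

(** Once finitely many relations lie in M^c (x) R^k, let X be its quotient by them. Since M^c (x)
    R^k has degree -(c + p) in the cover, X has to be shifted by c + p. *)
Lemma leavitt_functor_ess_surj (N : fp_graded_module G) : exists (X : mod_cat R * int)
    (u : graded_hom (leavitt_ob M X) N) (v : graded_hom N (leavitt_ob M X)),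
  cancel u v /\ cancel v u.
Proof.
have [k [p [f f_surj]]] := graded_cover (fin_pres_gen (fpg_fin_pres N)).
set X0 := free_module R k in f f_surj.
have prT : fg_proj (T X0) by apply/ext_fg_proj/fg_proj_row.
have [ks [Hks Sks]] := fin_pres_kernel (f := f) prT (fpg_fin_pres N) f_surj.
have [||//|c [bs [Hbs Sbs]]] := @span_by_level (T_graded M X0 p%:Z) (fun t => f t = 0)
    (fun c t => (exists w, jm c X0 w = t) /\ f t = 0) ks.
- move=> s c us Hc; rewrite linear_sum => E d ds.
  apply: (gr_indep (mdeg_grading N) (c := fun d => f (c d)) us) => // e.
  exact: gh_deg.
- move=> d t Ht ft; have [p0 Hp0] := Tdeg_ev_reaches hM Ht.
  (* In the unshifted T X0 the element t has degree d + p, so words of length q = c + d + p bring it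
     to M^c (x) X0; the bound on c makes q at least p0. *)
  exists (p0 + absz (d + p%:Z)%R)%N => c hc; pose q := absz (c%:Z + (d + p%:Z)).
  apply: lspan_sub (word_span q t) => b [s [Hs ->]]; apply: lspan_mem; split.
    by apply: (Hp0 q) => //; rewrite /q; lia.
  elim: s {Hs} => //= m s IH.
  rewrite lv_algE.
  by rewrite -[LHS]/((f : {linear T X0 -> gm_car N}) _) linearZ /= [f _]IH scaler0.
have /choice[w Hw] : forall i : 'I_(size bs), exists w, jm c X0 w = bs`_i.
  by move=> i; have [] := Hbs bs`_i (mem_nth _ (ltn_ord i)).
have [r Hr] := row_lift w; have [S HS] := image_submodule r.
have fpQ : fin_pres (quot_mod S).
  apply: (@fin_pres_coker _ _ _ _ r (@qm_pi _ _ S)).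
  - exact/om_fg_proj/fg_proj_row.
  - by case: (fg_proj_row R (size bs)).
  - by move=> z; exists (qm_repr z); apply: qm_reprK.
  by move=> v; rewrite -HS; apply: qm_pi_eq0.
pose X := FpModule fpQ.
have qm_surj (x : quot_mod S) : exists y, qm_pi S y = x by exists (qm_repr x); apply: qm_reprK.
have [fj Hfj] := T_hom_restrict hM c f.
have [|h Hh] := linear_surj_lift (p := @qm_pi _ _ S) (f := fj) qm_surj.
  move=> y /qm_pi_eq0/HS[v ->]; rewrite Hr linear_sum big1 // => i _.
  rewrite linearZ /= Hfj Hw; have [_ ->] := Hbs bs`_i (mem_nth _ (ltn_ord i)).
  by rewrite scaler0.
have [Psi HPsi] := @T_lift R M hM 0 X (gm_car N) h.
have [pu Hpu] : exists pu : {linear om hM c X0 -> res rs (T X)},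
    forall y, pu y = ext_unit rs (qm_pi S y : X).
  by apply: exists_linear => a x y; rewrite linearP [LHS]linearP.
(* Extension of the projection from M^c (x) X0, not from X0: [Theta] maps T X0 onto T X, and the
   cover f becomes [Psi] after [Theta]. *)
have [Theta HTheta] := T_lift pu.
have PT t : Psi (Theta t) = f t.
  apply: (@T_hom_eq R M hM c _ _ (Psi \o Theta) f) => y.
  by rewrite /= HTheta Hpu [LHS]HPsi Hh Hfj.
have Theta_surj t : exists t', Theta t' = t.
  elim/ext_mod_ind: t => [|z [v <-]|z z' [v <-] [v' <-]|a z [v <-]|x].
  - by exists 0; rewrite linear0.
  - by exists (- v); rewrite linearN.
  - by exists (v + v'); rewrite linearD.
  - by exists (a *: v); rewrite linearZ.
  by have [y <-] := qm_surj x; exists (jm c X0 y); rewrite HTheta Hpu.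
have Psi_deg d t : mdeg (g := T_graded M X (c%:Z + p%:Z)) d t -> mdeg d (Psi t).
  have H x : mdeg (- c%:Z - p%:Z) (Psi (jm 0 X x)).
    have [y <-] := qm_surj x; rewrite [Psi _]HPsi Hh Hfj; apply: (gh_deg f).
    by have := @jm_deg R M hM c X0 y; rewrite -[X in Tdeg X _ -> _](subrK p%:Z).
  move=> Ht; have := T_hom_graded H Ht.
  by rewrite addr0 -opprD addrK.
pose u := @GradedHom G (T_graded M X (c%:Z + p%:Z)) N Psi Psi_deg.
have [||v [uv vu]] := @bijective_linear _ _ _ Psi.
(* A preimage t' under [Theta] lies in the kernel of f, which is spanned by the chosen relations,
   and [Theta] kills these by the construction of X. *)
- move=> t E; have [t' Et'] := Theta_surj t; rewrite -Et'.
  have /Sks : f t' = 0 by rewrite -PT Et'.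
  move/(lspan_sub Sbs); apply: lspan_ker => b bbs.
  have ib : (index b bs < size bs)%N by rewrite index_mem.
  rewrite -(nth_index 0 bbs) -[index b bs]/(val (Ordinal ib)) -Hw HTheta Hpu.
  have -> : qm_pi S (w (Ordinal ib)) = 0; last by rewrite linear0.
  apply/qm_pi_eq0/HS; exists (delta_mx 0 (Ordinal ib)).
  rewrite Hr (bigD1 (Ordinal ib)) //= big1 => [|i ne].
    by rewrite mxE !eqxx /= scale1r addr0.
  by rewrite mxE (negPf ne) andbF scale0r.
- by move=> y; have [t <-] := f_surj y; exists (Theta t).
have [v' Hv'] := @graded_inverse _ _ u v uv vu.
exists (X : mod_cat R, c%:Z + p%:Z), u, v'; split=> x; first by rewrite Hv' uv.
by rewrite Hv' vu.
Qed.

End EssentialSurjectivity.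

(** * The stable categories *)

Section StableEquivalence.
Variables (R : pzRingType) (M : bimodType R) (hM : fg_proj M).
Let L := leavitt M.
Let rs : {rmorphism R -> L} := lv_scalar M.
Notation T := (ext_mod rs).
Notation G := (leavitt_graded M).
Notation Om := (tensor_functor hM).
Notation OmQ := (stable_tensor_functor hM).
Notation jm := (jm hM).
Notation omhom a b X Y := (@hom (mod_cat R) (oiter Om a X) (oiter Om b Y)).

Lemma leavitt_functor_full (A B : mod_cat R * int) (g : graded_hom (leavitt_ob M A) (leavitt_ob M B)) :
  exists f : shom Om A B, represents (smor f) (gh_fun g).
Proof.
have Hg (x : A.1) : Tdeg (- A.2 + B.2) (g (ext_unit rs x)).
  by apply: (gh_deg g); rewrite /= addNr; apply: Tdeg_unit.
have [a [b [f [E Hf]]]] := @represents_full R M hM A.1 B.1 g _ Hg.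
have lev : A.2 + a%:Z = B.2 + b%:Z by rewrite E; lia.
by exists (SHom lev f).
Qed.

Lemma leavitt_functor_is_equivalence : is_equivalence (leavitt_functor hM).
Proof.
apply: ff_es_equivalence => [A B g|A B f f' H|N].
- have [f Hf] := leavitt_functor_full g; exists f => t.
  exact: (represents_uniq (leavitt_homP f) Hf t).
- by have [_ H'] := sheqE (leavitt_homP f) (leavitt_homP f'); apply: H'.
by have [X [u [v [uv vu]]]] := leavitt_functor_ess_surj hM N; exists X, u, v.
Qed.

(** Passing to the stable category changes only the equality of morphisms, so a stable
    representative is already one over [mod_cat]. *)
Definition lift_shom (A B : stmod_cat R * int) (f : shom OmQ A B) :
    @shom (mod_cat R) Om A B :=
  @SHom (mod_cat R) Om A B (sa f) (sb f) (slevel f) (smor f).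

Lemma lift_shom_comp (A B D : stmod_cat R * int) (g : shom OmQ B D) (f : shom OmQ A B) :
  lift_shom (scomp g f) = scomp (lift_shom g) (lift_shom f).
Proof.
rewrite /lift_shom /scomp /= !quot_raise quot_ocast.
by congr SHom; apply: Prop_irrelevance.
Qed.

Lemma T_hom_deg a (X Y : fp_module R) n m e (f : {linear T X -> T Y}) :
  (forall w, Tdeg e (f (jm a X w))) -> n + a%:Z + e = m ->
  exists g : graded_hom (T_graded M X n) (T_graded M Y m), forall t, g t = f t.
Proof.
move=> H E; suff D d t : mdeg (g := T_graded M X n) d t -> mdeg (g := T_graded M Y m) d (f t).
  by exists (@GradedHom G (T_graded M X n) (T_graded M Y m) f D).
have {}H w : mdeg (g := T_graded M Y m) (e - m) (f (jm a X w)) by rewrite /= subrK.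
move=> Ht; have := T_hom_graded H Ht.
by suff -> : d + n + a%:Z + (e - m) = d by []; rewrite -E; lia.
Qed.

Lemma stable_rel_represents a b (X Y : mod_cat R) n m (f f' : omhom a b X Y)
    (g g' : graded_hom (leavitt_ob M (X, n)) (leavitt_ob M (Y, m))) :
  n + a%:Z = m + b%:Z -> represents f (gh_fun g) -> represents f' (gh_fun g') ->
  stable_rel f f' -> graded_stable_rel (X := leavitt_ob M (X, n)) (Y := leavitt_ob M (Y, m)) g g'.
Proof.
move=> E Hg Hg' [P [u [v [HP Huv]]]].
pose P' := FpModule (fg_proj_fin_pres HP).
have [u' Hu'] := @T_lift R M hM a X (T P') (@ext_unit R L rs P' \o u).
have [v' Hv'] := @T_lift R M hM 0 P' (T (Y : fp_module R)) (jm b Y \o v).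
(* T P is shifted by the common level n + a = m + b, which puts P in the degree of both M^a (x) X
   and M^b (x) Y. *)
have [|//|ug Hug] := @T_hom_deg a X P' n (n + a%:Z) 0 u'; rewrite ?addr0 //.
  by move=> w; rewrite Hu'; apply: Tdeg_unit.
have [||vg Hvg] := @T_hom_deg 0 P' Y (n + a%:Z) m (- b%:Z) v'.
- by move=> w; rewrite Hv'; apply: jm_deg.
- by rewrite E; lia.
exists (T_graded M P' (n + a%:Z)), ug, vg; split=> [|t]; first exact: ext_fg_proj.
rewrite Hug Hvg.
apply: (@T_hom_eq R M hM a X _ ((gh_fun g : {linear T X -> T Y}) \- (gh_fun g' : {linear T X -> T Y}))
  (v' \o u')) => w.
rewrite /= Hg Hg' Hu' [RHS]Hv' /= -Huv.
by rewrite linearB.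
Qed.

Lemma represents_precast a b c (e : c = a) (X Y : mod_cat R) (f : omhom a b X Y) g :
  represents f g -> represents (comp f (ocast Om e X)) g.
Proof. by case: a / e f => f H w; apply: H. Qed.

Lemma stable_sheq (A B : stmod_cat R * int) (f f' : shom OmQ A B) : sheq f f' ->
  graded_stable_rel (X := leavitt_ob M A) (Y := leavitt_ob M B)
    (leavitt_hom (lift_shom f)) (leavitt_hom (lift_shom f')).
Proof.
case: A B f f' => [X n] [Y m] f f' [k [l [ea [eb]]]].
rewrite !quot_raise !quot_ocast => H.
have Hf := represents_cast eb (represents_raise (k := k) (leavitt_homP (lift_shom f))).
have Hf' := represents_precast ea (represents_raise (k := l) (leavitt_homP (lift_shom f'))).
apply: stable_rel_represents Hf Hf' H.
by have /= := slevel f; move: eb; rewrite /=; lia.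
Qed.

Definition factors a b (X Y : mod_cat R) (f : omhom a b X Y) : Prop :=
  exists (P : lmodType R) (u : {linear om hM a X -> P}) (v : {linear P -> om hM b Y}),
    fg_proj P /\ forall w, as_linear f w = v (u w).

Lemma factors_raise k a b (X Y : mod_cat R) (f : omhom a b X Y) :
  factors f -> factors (raise k f).
Proof.
move=> Hf; elim: k => //= k [P [u [v [HP H]]]].
exists (tensor M P), (tensor_map M u), (tensor_map M v); split; first exact: tensor_fg_proj.
apply: (@linear_tensor_ext R M _ _ (tensor_map M (as_linear (raise k f)))
  (tensor_map M v \o tensor_map M u)) => m x.
by rewrite /= !tensor_mapE H.
Qed.

Lemma factors_rel_hom a b a' b' (X Y : mod_cat R) (f : omhom a b X Y) (f' : omhom a' b' X Y) :
  rel_hom f f' -> factors f -> factors f'.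
Proof.
move=> H; have [ea [eb _]] := H; subst a' b'; move/rel_homE: H => H [P [u [v [HP E]]]].
by exists P, u, v; split=> // w; rewrite -E; apply/esym/H.
Qed.

Lemma shom_at_level (A B : mod_cat R * int) (f : shom Om A B) k c d :
  (k + sa f = c)%N -> (k + sb f = d)%N ->
  exists f' : omhom c d A.1 B.1, rel_hom (raise k (smor f)) f'.
Proof. by move=> <- <-; exists (raise k (smor f)); apply: rel_hom_refl. Qed.

Lemma om_raiseB k a b (X Y : fp_module R) (f g : {linear om hM a X -> om hM b Y}) w :
  om_raise k (f \- g) w = om_raise k f w - om_raise k g w.
Proof.
elim: k w => [|k IH] // w.
apply: (@linear_tensor_ext R M _ _ (tensor_map M (om_raise k (f \- g)))
  (tensor_map M (om_raise k f) \- tensor_map M (om_raise k g))) => m x.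
by rewrite /= !tensor_mapE IH tensDr tensNr.
Qed.

Lemma rel_hom_quot a b a' b' (X Y : mod_cat R) (f : omhom a b X Y) (f' : omhom a' b' X Y) :
  rel_hom f f' -> @rel_hom (stmod_cat R) OmQ a b a' b' X Y f f'.
Proof.
case=> ea [eb H]; exists ea, eb; rewrite !quot_ocast; exact: crel_heq.
Qed.

(* Composing a section of q with this component of T X makes it
   degree-preserving on homogeneous elements. *)
Lemma T_component_image (P : graded_module G) (X : fp_module R) p
    (q : graded_hom (T_graded M X p) P) d t :
  mdeg d (q t) -> q (T_component t (d + p)) = q t.
Proof.
move=> Hq; have [s [c [us Hc E]]] := homogeneous_components (mdeg_grading (T_graded M X p)) t.
have E' : \sum_(e <- s) q (c e) = q t by rewrite -linear_sum -E.
have Q := grading_components (mdeg_grading P) (c := fun e => q (c e)) us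
  (fun e => gh_deg q (Hc e)) Hq E'.
have -> : T_component t (d + p) = \sum_(e <- s) (if e == d then c e else 0).
  rewrite E (big_morph (fun t => T_component t (d + p))
    (fun t u => T_componentD t u (d + p)) (T_component0 M X (d + p))).
  apply: eq_bigr => e _; rewrite (T_component_homogeneous (Hc e)).
  by rewrite (inj_eq (@addIr _ p)) eq_sym.
rewrite -E' linear_sum; apply: eq_big_seq => e es; have := Q e es.
by case: eqP => // _ ->; rewrite linear0.
Qed.

Lemma graded_factorization (X Y : fp_module R) n m (P : graded_module G)
    (u : graded_hom (T_graded M X n) P) (v : graded_hom P (T_graded M Y m)) :
  fg_proj P -> exists k p (s : graded_hom (T_graded M X n) (T_graded M (free_module R k) p))
    (t : graded_hom (T_graded M (free_module R k) p) (T_graded M Y m)),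
    forall x, t (s x) = v (u x).
Proof.
move=> [fgP prP]; have [k [p [q q_surj]]] := graded_cover hM fgP.
have [sec Hsec] := prP _ _ q (idfun : {linear P -> P}) q_surj.
(* The section is merely L-linear, because projectivity is that of the ungraded module. X has degree
   -n, which in T(R^k) shifted by p is the unshifted degree p - n; keeping only that component makes
   the lift graded. *)
pose e := - n + p%:Z.
have [s0 Hs0] : exists s0 : {linear X -> res rs (T (free_module R k))},
    forall x, s0 x = T_component (sec (u (ext_unit rs x))) e.
  apply: exists_linear => r x y.
  have -> : sec (u (ext_unit rs (r *: x + y))) =
      lv_scalar M r *: sec (u (ext_unit rs x)) + sec (u (ext_unit rs y)).
    rewrite linearP [u _](linearP (u : {linear T X -> gm_car P})).
    exact: (linearP (sec : {linear gm_car P -> T (free_module R k)})).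
  by rewrite T_componentD (T_componentZ _ _ (lv_deg_scalar M r)) subr0.
have [s Hs] := @T_lift R M hM 0 X (T (free_module R k)) s0.
have [||sg Hsg] := @T_hom_deg 0 X (free_module R k) n p%:Z e s.
- by move=> w; rewrite Hs Hs0; apply: T_component_deg.
- by rewrite /e; lia.
exists k, p%:Z, sg, (graded_comp v q) => x /=; rewrite Hsg; congr (v _).
pose q' : {linear T (free_module R k) -> gm_car P} := gh_fun q.
apply: (@T_hom_eq R M hM 0 X _ (q' \o s) (gh_fun u)) => {}x.
rewrite /= Hs Hs0 /q' T_component_image Hsec //.
by apply: gh_deg; rewrite /= addNr; apply: Tdeg_unit.
Qed.

(** The difference of the two graded maps factors through a shifted T(R^k), and fullness represents
    both factors at finite levels. Their composite [ga] factors through some M^c (x) R^k, which is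
    projective, and f - f' - ga vanishes after further tensoring by faithfulness. *)
Lemma stable_faithful (A B : stmod_cat R * int) (f f' : shom OmQ A B) :
  graded_stable_rel (X := leavitt_ob M A) (Y := leavitt_ob M B)
    (leavitt_hom (lift_shom f)) (leavitt_hom (lift_shom f')) -> sheq f f'.
Proof.
case=> P [u [v [HP Huv]]].
have [k [p [s [t Hst]]]] := graded_factorization u v HP.
pose C : mod_cat R * int := (free_module R k : mod_cat R, p).
have [al Hal] := @leavitt_functor_full A C s; have [be Hbe] := @leavitt_functor_full C B t.
pose ga := scomp be al; have Hga : represents (smor ga) (gh_fun t \o gh_fun s).
  exact: represents_scomp.
have Fga : factors (smor ga).
  exists (om hM (sa be - sb al + sb al) (free_module R k)),
    (as_linear (raise (sa be - sb al) (smor al))),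
    (as_linear (raise (sb al - sa be) (smor be)) \o as_linear (ocast Om (smid (sb al) (sa be)) _)).
  by split=> [|w] //; apply/om_fg_proj/fg_proj_row.
pose F0 := lift_shom f; pose F1 := lift_shom f'.
have l0 := slevel F0; have l1 := slevel F1; have lg := slevel ga.
(* Each of the three maps is raised by the source exponents of the other two; the level conditions
   make d the common target exponent. *)
pose c := (sa F0 + sa F1 + sa ga)%N; pose d := (sb F0 + sa F1 + sa ga)%N.
have a0 : (sa F1 + sa ga + sa F0 = c)%N by rewrite /c; lia.
have b0 : (sa F1 + sa ga + sb F0 = d)%N by rewrite /d; lia.
have a1 : (sa F0 + sa ga + sa F1 = c)%N by rewrite /c; lia.
have b1 : (sa F0 + sa ga + sb F1 = d)%N by rewrite /d; lia.
have ag : (sa F0 + sa F1 + sa ga = c)%N by [].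
have bg : (sa F0 + sa F1 + sb ga = d)%N by rewrite /d; lia.
have [f0 Hf0] := shom_at_level a0 b0; have [f1 Hf1] := shom_at_level a1 b1.
have [g1 Hg1] := shom_at_level ag bg.
have R0 := represents_rel_hom Hf0 (represents_raise (leavitt_homP F0)).
have R1 := represents_rel_hom Hf1 (represents_raise (leavitt_homP F1)).
have Rg := represents_rel_hom Hg1 (represents_raise Hga).
have H0 w : jm d B.1 (((as_linear f0 \- as_linear f1) \- as_linear g1) w) = 0.
  rewrite /= !linearB /= -R0 -R1 -Rg /= Hst -Huv; exact: subrr.
have [j Hj] := jm_faithful H0.
have st : stable_rel (raise j f0) (raise j f1).
  have [P' [u' [v' [HP' E]]]] : factors (raise j g1).
    exact/factors_raise/(factors_rel_hom Hg1)/factors_raise.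
  exists P', u', v'; split=> // w; rewrite -E; apply/eqP; rewrite -subr_eq0; apply/eqP.
  by rewrite -[RHS](Hj w) !om_raiseB.
apply/sheqP; exists (j + (sa F1 + sa ga))%N, (j + (sa F0 + sa ga))%N; rewrite !quot_raise.
have up a b (x : omhom a b A.1 B.1) i (y : omhom c d A.1 B.1) :
    rel_hom (raise i x) y ->
    @rel_hom (stmod_cat R) OmQ _ _ _ _ A.1 B.1 (raise (j + i) x) (raise j y).
  move=> H; apply/rel_hom_quot/(rel_hom_trans (rel_hom_sym (rel_hom_raiseD _ _ _))).
  exact: rel_hom_raise.
have mid : @rel_hom (stmod_cat R) OmQ _ _ _ _ A.1 B.1 (raise j f0) (raise j f1).
  exact/(@rel_homE (stmod_cat R) OmQ).
have U0 := up _ _ (smor F0) _ _ Hf0; have U1 := up _ _ (smor F1) _ _ Hf1.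
exact: (@rel_hom_trans (stmod_cat R) OmQ _ _ _ _ _ _ _ _ _ _ _ U0
  (@rel_hom_trans (stmod_cat R) OmQ _ _ _ _ _ _ _ _ _ _ _ mid
    (@rel_hom_sym (stmod_cat R) OmQ _ _ _ _ _ _ _ _ U1))).
Qed.

Definition stable_leavitt_functor : functor (stab OmQ) (stgrmod_cat G).
Proof.
refine (@Functor (stab OmQ) (stgrmod_cat G) (leavitt_ob M)
  (fun A B f => leavitt_hom (lift_shom f)) (fun A B f f' => @stable_sheq A B f f') _ _).
- by move=> A; apply: crel_heq; apply: (represents_uniq (leavitt_homP _)) => w.
- move=> A B D g f; apply: crel_heq; rewrite /= lift_shom_comp.
  exact: leavitt_homM.
Defined.

Lemma stable_leavitt_functor_is_equivalence : is_equivalence stable_leavitt_functor.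
Proof.
apply: ff_es_equivalence => [A B g|A B f f' H|N]; last 1 first.
- have [X [u [v [uv vu]]]] := leavitt_functor_ess_surj hM N.
  by exists X, u, v; split; apply: crel_heq.
- have [f Hf] := leavitt_functor_full g.
  pose f' := @SHom (stmod_cat R) OmQ A B _ _ (slevel f) (smor f).
  exists f'; apply: crel_heq => t.
  exact: (@represents_uniq R M hM _ _ _ _ (smor f) _ _ (leavitt_homP (lift_shom f')) Hf t).
exact: stable_faithful.
Qed.

End StableEquivalence.

Theorem theorem4p4 (R : pzRingType) (M : bimodType R) (hM : fg_proj M) :
  exists F : functor (stab (tensor_functor hM)) (grmod_cat (leavitt_graded M)),
    is_equivalence F /\
    exists Fst : functor (stab (stable_tensor_functor hM))
                         (stgrmod_cat (leavitt_graded M)),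
      is_equivalence Fst /\
      nat_iso (fcomp Fst (stab_quot (tensor_stable hM)))
              (fcomp (quot_proj (graded_stable_cong (leavitt_graded M))) F).
Proof.
exists (leavitt_functor hM); split; first exact: leavitt_functor_is_equivalence.
exists (stable_leavitt_functor hM); split; first exact: stable_leavitt_functor_is_equivalence.
(* Both composites agree on objects and use extensions of the same representative, so identities
   form the natural isomorphism. *)
exists (fun A => graded_id (leavitt_ob M A)), (fun A => graded_id (leavitt_ob M A)).
split=> [A|A|A B f]; apply: crel_heq => // t.
exact: (@represents_uniq R M hM _ _ _ _ (smor f) _ _
  (leavitt_homP (lift_shom (stab_quot_hom (tensor_stable hM) f))) (leavitt_homP f) t).
Qed.
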